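(* Let $j<i_1<i_2<\dots<i_r$ be indices in $\{1,\dots,n\}$, $I=\{i_1,\dots,i_r\}$, and $1\le k\le r$. Let $L_+$, $L_-$, $L_0$ and $L_\infty$ be a skein quadruple of tangles on $n$ strings which differ only in the neighborhood of a single crossing $d$ of the $j$-th and $i_k$-th components. For $m=1,\dots,k$ denote $I_m^-=\{i_1,\dots,i_{m-1}\}$ and $I_m^+=I\setminus I_m^-\setminus\{i_k\}=\{i_m,\dots,i_{k-1},i_{k+1},\dots,i_r\}$. Then $$Z_{I,j}(L_+)-Z_{I,j}(L_-)=Z_{I_k^-,j}(L_\infty)\cdot Z_{I_k^+,i_k}(L_0)$$ and $$Z_{I,j}(L_+)-Z_{I,j}(L_-)=\sum_{m=1}^{k}Z_{I_m^-,j}(L_\pm)\cdot Z_{I_m^+,i_k}(L_0),$$ where the notation $Z_{I_m^-,j}(L_\pm)$ expresses that $Z_{I_m^-,j}(L_+)=Z_{I_m^-,j}(L_-)$.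
   Context: **Tangles and Gauss diagrams.** Let $D^2$ be a disk in the $xy$-plane with prescribed interior points $p_1,p_2,\dots$ on the $x$-axis, and $C=D^2\times[0,1]$. An ordered, oriented $(k,l)$-tangle is an ordered collection of $n=\frac12(k+l)$ disjoint oriented intervals (strings, or components) properly embedded in $C$ with endpoints in $\{p_i\}_{i=1}^k\times\{1\}\cup\{p_i\}_{i=1}^l\times\{0\}$ (no closed components), up to oriented isotopy of $C$ fixed on the boundary. The Gauss diagram of a tangle diagram (generic projection to the $xz$-plane) is an ordered collection of $n$ oriented intervals with the two preimages of each crossing joined by an arrow from the over-passing to the under-passing point, carrying the sign $\pm1$ (local writhe) of the crossing. **Tree invariants.** An arrow diagram on $n$ strings is an ordered set of $n$ oriented intervals with several unsigned arrows connecting pairs of distinct points on them, up to orientation-preserving diffeomorphism of the intervals. For an arrow diagram $A$ and a Gauss diagram $G$ on $n$ strings, $\langle A,G\rangle=\sum_{\phi:A\to G}\operatorname{sign}(\phi)$, where $\phi$ runs over embeddings mapping the $i$-th string to the $i$-th string and arrows to arrows, preserving orientations, and $\operatorname{sign}(\phi)=\prod_{a\in A}\operatorname{sign}(\phi(a))$. For $j\in\{1,\dots,n\}$, $I\subset\{1,\dots,n\}\setminus\{j\}$, a tree diagram with leaves on $I$ and trunk on $j$ is an arrow diagram such that: the tail and head of every arrow lie on different strings; there is exactly one arrow with tail on the $i$-th string if $i\in I$ and none if $i\notin I$; all arrowheads lie on strings in $I\cup\{j\}$; on each string $i\in I$ all arrowheads precede the unique arrowtail. Regard the diagram $A$ as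 a graph, remove strings not in $I\cup\{j\}$ and cut off the part of each string $i\in I$ after its arrowtail; the resulting graph $T_A$ is a tree with leaves at the beginnings of the strings in $I\cup\{j\}$ and root at the endpoint of the $j$-th string. $A$ is planar if $T_A$ can be drawn in the plane so that its leaves, counted clockwise from the root, appear in increasing order of indices. $\mathcal A_{I,j}$ is the set of planar tree diagrams with leaves on $I$ and trunk on $j$. $\operatorname{sign}(A)=(-1)^q$, $q$ being the number of right-pointing arrows (from the $p$-th to the $s$-th string with $p<s$). Then $Z_{I,j}(L)=\sum_{A\in\mathcal A_{I,j}}\operatorname{sign}(A)\langle A,G\rangle$ for any Gauss diagram $G$ of $L$ (known to be independent of $G$), and $Z_{\emptyset,j}=1$. **Skein quadruple.** $L_+$, $L_-$, $L_0$, $L_\infty$ have diagrams which differ only near one crossing $d$ (here a crossing of the $j$-th and $i_k$-th strings): $L_+$ has a positive crossing there, and $L_-$ a negative crossing; $L_0$ is obtained from $L_\pm$ by the orientation-respecting smoothing of $d$; $L_\infty$ is obtained from $L_\pm$ by reversing the orientation of the $i_k$-th string and then applying the orientation-respecting smoothing of $d$. Orders of strings coincide in the beginning of each string. Thus in $L_0$ the $j$-th string follows $L_j$ up to $d$ and then $L_{i_k}$ to its end, while the $i_k$-th string follows $L_{i_k}$ up to $d$ and then $L_j$ to its end; in $L_\infty$ the $j$-th string follows $L_j$ up to $d$ and then $L_{i_k}$ backwards to its beginning, while the $i_k$-th string follows $L_{i_k}$ backwards from its end to $d$ and then $L_j$ to its end. *)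

(* Defs.v *)
From HB Require Import structures.
From mathcomp Require Import all_boot all_order all_algebra.
From mathcomp Require Import all_classical all_reals all_analysis.
Set Implicit Arguments.
Unset Strict Implicit.
Unset Printing Implicit Defensive.
Import Order.TTheory GRing.Theory Num.Theory.
Import numFieldNormedType.Exports.
Local Open Scope classical_set_scope.
Local Open Scope ring_scope.

(** * Gauss diagrams and arrow diagrams

    A string of a diagram is the sequence of the arrow ends met along it, from
    its beginning to its end; up to orientation-preserving diffeomorphisms of
    the strings, this is all the information a diagram carries. *)

(* [true] is the tail (over-passing) end, [false] the head (under-passing). *)
Definition arrow_end (X : Type) := (X * bool)%type.
Definition tail {X : Type} (a : X) : arrow_end X := (a, true).
Definition head {X : Type} (a : X) : arrow_end X := (a, false).

Definition all_ends (n : nat) (X : Type) (w : 'I_n -> seq (arrow_end X)) :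
  seq (arrow_end X) := flatten [seq w i | i <- enum 'I_n].

Record gauss_diagram (n : nat) := GaussDiagram {
  garrow : finType;
  gstring : 'I_n -> seq (arrow_end garrow);
  gsign : garrow -> int;
  gstring_perm :
    perm_eq (all_ends gstring) (enum {: (garrow * bool)%type});
  gsign_unit : forall a, gsign a = 1 \/ gsign a = -1 }.

(* Arrow diagrams with m arrows.  The arrows are numbered in the order in which
   their tails are met when the strings are read one after the other; thus two
   arrow diagrams are equal iff they are related by orientation-preserving
   diffeomorphisms of the strings. *)
Definition is_arrow_diagram (n m : nat)
    (w : {ffun 'I_n -> {bseq m.*2 of ('I_m * bool)%type}}) : bool :=
  let ends := all_ends (fun i => w i : seq _) in
  perm_eq ends (enum {: ('I_m * bool)%type})
  && ([seq e.1 | e <- ends & e.2] == enum 'I_m).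

Definition arrow_diagram (n m : nat) :=
  {w : {ffun 'I_n -> {bseq m.*2 of ('I_m * bool)%type}} | is_arrow_diagram w}.

Definition astring (n m : nat) (A : arrow_diagram n m) (i : 'I_n) :
  seq (arrow_end 'I_m) := val A i.

(* An embedding of A in G is determined by its action on arrows; it has to send
   the ends on the i-th string of A to ends on the i-th string of G, respecting
   their kind and their order. *)
Definition embedding (n m : nat) (A : arrow_diagram n m) (G : gauss_diagram n)
    (phi : {ffun 'I_m -> garrow G}) : bool :=
  [forall i, subseq [seq (phi e.1, e.2) | e <- astring A i] (gstring G i)].

Definition pairing (n m : nat) (A : arrow_diagram n m) (G : gauss_diagram n) :
    int :=
  \sum_(phi : {ffun 'I_m -> garrow G} | embedding A phi)
     \prod_(a : 'I_m) gsign (phi a).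

(** * Planar tree diagrams *)

Inductive rooted_tree (n : nat) : Type :=
| Leaf of 'I_n
| Node of rooted_tree n & rooted_tree n.

Fixpoint leaves (n : nat) (T : rooted_tree n) : seq 'I_n :=
  match T with
  | Leaf i => [:: i]
  | Node T1 T2 => leaves T1 ++ leaves T2
  end.

(* [drawn T s]: some drawing of T in the plane has s as its sequence of leaves,
   counted clockwise from the root; the two branches at each vertex may be
   drawn in either order. *)
Inductive drawn (n : nat) : rooted_tree n -> seq 'I_n -> Prop :=
| drawn_leaf i : drawn (Leaf i) [:: i]
| drawn_node12 T1 T2 s1 s2 :
    drawn T1 s1 -> drawn T2 s2 -> drawn (Node T1 T2) (s1 ++ s2)
| drawn_node21 T1 T2 s1 s2 :
    drawn T1 s1 -> drawn T2 s2 -> drawn (Node T1 T2) (s2 ++ s1).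

(* [grown A i h T]: in the graph of A, the part that flows into the point of the
   i-th string lying just after its first h ends is the tree T.  Every arrowhead
   is a vertex where the string is joined by the tree cut off at the
   corresponding arrowtail.  Diagrams with a cycle of strings (such as two
   strings pointing at each other) produce no tree. *)
Inductive grown (n m : nat) (A : arrow_diagram n m) :
    'I_n -> nat -> rooted_tree n -> Prop :=
| grown_start i : grown A i 0 (Leaf i)
| grown_head i h T a i' T' :
    grown A i h T ->
    onth (astring A i) h = Some (head a) ->
    tail a \in astring A i' ->
    grown A i' (index (tail a) (astring A i')) T' ->
    grown A i h.+1 (Node T T').

Definition is_tree_of (n m : nat) (A : arrow_diagram n m) (I : {set 'I_n})
    (j : 'I_n) (T : rooted_tree n) : Prop :=
  grown A j (size (astring A j)) T /\ perm_eq (leaves T) (enum (j |: I)%SET).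

Record tree_diagram (n m : nat) (I : {set 'I_n}) (j : 'I_n)
    (A : arrow_diagram n m) : Prop := TreeDiagram {
  tree_no_loop : forall a i,
    ~ (tail a \in astring A i /\ head a \in astring A i);
  tree_one_tail : forall i,
    count (fun e => e.2) (astring A i) = (i \in I) :> nat;
  tree_heads : forall a i, head a \in astring A i -> i \in (j |: I)%SET;
  tree_heads_first : forall i a b, i \in I ->
    tail a \in astring A i -> head b \in astring A i ->
    (index (head b) (astring A i) < index (tail a) (astring A i))%N;
  tree_is_tree : exists T, is_tree_of A I j T }.

Definition planar (n m : nat) (I : {set 'I_n}) (j : 'I_n)
    (A : arrow_diagram n m) : Prop :=
  exists T s, [/\ is_tree_of A I j T, drawn T s
                & sorted (fun u v : 'I_n => (u < v)%N) s].

(* A tree diagram with leaves on I has exactly #|I| arrows, one for each tail. *)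
Definition planar_trees (n : nat) (I : {set 'I_n}) (j : 'I_n) :
    {set arrow_diagram n #|I|} :=
  [set A | `[< tree_diagram I j A /\ planar I j A >]]%SET.

Definition right_pointing (n m : nat) (A : arrow_diagram n m) (a : 'I_m) :=
  [exists p, exists s,
    [&& tail a \in astring A p, head a \in astring A s & (p < s)%N]].

Definition tree_sign (n m : nat) (A : arrow_diagram n m) : int :=
  (-1) ^+ #|[set a | right_pointing A a]%SET|.

Definition tree_sum (n : nat) (I : {set 'I_n}) (j : 'I_n)
    (G : gauss_diagram n) : int :=
  \sum_(A in planar_trees I j) tree_sign A * pairing A G.

(** * Tangles *)

Section Tangles.
Variable R : realType.

Definition space : Type := (R * R * R)%type.
Definition xc (q : space) : R := q.1.1.
Definition yc (q : space) : R := q.1.2.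
Definition zc (q : space) : R := q.2.

(* C is the cylinder over the unit disk. *)
Definition cylinder : set space :=
  [set q | xc q ^+ 2 + yc q ^+ 2 <= 1 /\ 0 <= zc q <= 1].
Definition open_cylinder : set space :=
  [set q | xc q ^+ 2 + yc q ^+ 2 < 1 /\ 0 < zc q < 1].

Definition smooth (f : R -> R) : Prop :=
  forall (m : nat) (t : R), derivable (derive1n m f) t 1.

(* Ordered oriented (top, bot)-tangles on n strings (as embedded curves, not yet
   up to isotopy), where p 0, p 1, etc are the prescribed points of the x-axis.
   Only the values of the strands on [0, 1] matter. *)
Record tangle (p : nat -> R) (n top bot : nat) := Tangle {
  strand :> 'I_n -> R -> space;
  strand_smooth : forall i,
    [/\ smooth (xc \o strand i), smooth (yc \o strand i)
      & smooth (zc \o strand i)];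
  strand_regular : forall i t, 0 <= t <= 1 ->
    (derive1 (xc \o strand i) t, derive1 (yc \o strand i) t,
     derive1 (zc \o strand i) t) != 0;
  strand_embedded : forall i i' t t', 0 <= t <= 1 -> 0 <= t' <= 1 ->
    strand i t = strand i' t' -> i = i' /\ t = t';
  strand_ends : forall i t, t = 0 \/ t = 1 ->
    (exists2 a, (a < top)%N & strand i t = (p a, 0, 1)) \/
    (exists2 a, (a < bot)%N & strand i t = (p a, 0, 0));
  strand_proper : forall i t, 0 < t < 1 -> open_cylinder (strand i t) }.

Section Diagrams.
Variables (p : nat -> R) (n top bot : nat).
Notation tangle := (tangle p n top bot).

(* Since the isotopy fixes the boundary, equality of the starting points says
   that it respects the orientation of the strings. *)
Definition isotopic (L L' : tangle) : Prop :=
  exists H : R -> space -> space,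
    [/\ {within [set tq : R * space | 0 <= tq.1 <= 1 /\ cylinder tq.2],
          continuous (fun tq => H tq.1 tq.2)},
        forall t, 0 <= t <= 1 -> set_bij cylinder cylinder (H t),
        forall q, cylinder q -> H 0 q = q,
        forall t q, 0 <= t <= 1 -> cylinder q -> ~ open_cylinder q -> H t q = q
      & forall i, L i 0 = L' i 0 /\
          H 1 @` (L i @` [set t | 0 <= t <= 1]) = L' i @` [set t | 0 <= t <= 1]].

Definition shadow (q : space) : R * R := (xc q, zc q).

(* A passage (i, t) is the point at time t on the i-th string. *)
Definition passage : Type := ('I_n * R)%type.
Definition at_ (L : tangle) (u : passage) : space := L u.1 u.2.

Definition velocity (L : tangle) (u : passage) : R * R :=
  (derive1 (xc \o L u.1) u.2, derive1 (zc \o L u.1) u.2).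

(* The passage u crosses over the passage v.  The viewer is at y = -oo, so that
   the xz-plane is seen with its usual orientation. *)
Definition crossing (L : tangle) (u v : passage) : Prop :=
  [/\ 0 <= u.2 <= 1, 0 <= v.2 <= 1, shadow (at_ L u) = shadow (at_ L v)
    & yc (at_ L u) < yc (at_ L v)].

Definition det2 (a b : R * R) : R := a.1 * b.2 - a.2 * b.1.

Definition writhe (L : tangle) (u v : passage) : int :=
  sgz (det2 (velocity L u) (velocity L v)).

Record generic (L : tangle) : Prop := Generic {
  generic_immersed : forall u, 0 <= u.2 <= 1 -> velocity L u != 0;
  generic_finite : finite_set [set c : passage * passage | crossing L c.1 c.2];
  generic_transversal : forall u v, crossing L u v ->
    det2 (velocity L u) (velocity L v) != 0;
  generic_double : forall u v w,
    0 <= u.2 <= 1 -> 0 <= v.2 <= 1 -> 0 <= w.2 <= 1 ->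
    shadow (at_ L u) = shadow (at_ L v) -> shadow (at_ L v) = shadow (at_ L w) ->
    [\/ u = v, v = w | u = w] }.

(* [pos e] is the time at which the string passes through the arrow end e. *)
Definition gauss_diagram_at (L : tangle) (G : gauss_diagram n) : Prop :=
  exists pos : arrow_end (garrow G) -> R,
    [/\ forall i, sorted (fun e f => pos e < pos f) (gstring G i),
        forall a i i', tail a \in gstring G i -> head a \in gstring G i' ->
          let u := (i, pos (tail a)) in let v := (i', pos (head a)) in
          crossing L u v /\ gsign a = writhe L u v
      & forall u v, crossing L u v ->
          exists a, [/\ tail a \in gstring G u.1, pos (tail a) = u.2,
                        head a \in gstring G v.1 & pos (head a) = v.2]].

Definition gauss_diagram_of (L : tangle) (G : gauss_diagram n) : Prop :=
  exists D, [/\ isotopic L D, generic D & gauss_diagram_at D G].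

(* Z assigns to every tangle L its invariants Z_{I,j}(L). *)
Definition tree_invariants (Z : {set 'I_n} -> 'I_n -> tangle -> int) : Prop :=
  forall (I : {set 'I_n}) j L G, j \notin I -> gauss_diagram_of L G ->
    Z I j L = tree_sum I j G.

(** * Skein quadruples *)

Definition in_disk (c : R * R) (rho : R) (q : R * R) : Prop :=
  (q.1 - c.1) ^+ 2 + (q.2 - c.2) ^+ 2 <= rho ^+ 2.

(* In the disk, D has just one crossing, of the strings j and k, with writhe e. *)
Definition one_crossing_in (c : R * R) (rho : R) (j k : 'I_n) (e : int)
    (D : tangle) : Prop :=
  exists u v,
    [/\ crossing D u v, in_disk c rho (shadow (at_ D u)),
        (u.1 = j /\ v.1 = k) \/ (u.1 = k /\ v.1 = j), writhe D u v = e
      & forall u' v', crossing D u' v' -> in_disk c rho (shadow (at_ D u')) ->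
          u' = u /\ v' = v].

Definition no_crossing_in (c : R * R) (rho : R) (D : tangle) : Prop :=
  forall u v, crossing D u v -> ~ in_disk c rho (shadow (at_ D u)).

(* The four diagrams meet the cylinder over the disk (a neighbourhood of the
   crossing) in two arcs, and coincide outside it.  The strands are parametrized
   (which is no restriction up to isotopy) so that the strings j and k are in
   the disk exactly for the times in [1/3, 2/3] and the parametrizations
   agree. *)
Record skein_diagrams (j k : 'I_n) (Dp Dm D0 Di : tangle)
    (c : R * R) (rho : R) : Prop := SkeinDiagrams {
  skein_rho : 0 < rho;
  skein_generic : [/\ generic Dp, generic Dm, generic D0 & generic Di];
  skein_disk : forall D, [\/ D = Dp, D = Dm, D = D0 | D = Di] ->
    forall i t, 0 <= t <= 1 ->
    in_disk c rho (shadow (D i t)) <-> (i = j \/ i = k) /\ 1/3 <= t <= 2/3;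
  skein_others : forall i t, i <> j -> i <> k -> 0 <= t <= 1 ->
    [/\ Dm i t = Dp i t, D0 i t = Dp i t & Di i t = Dp i t];
  (* Dm: the crossing is changed *)
  skein_shadow : forall i t, 0 <= t <= 1 -> shadow (Dm i t) = shadow (Dp i t);
  skein_Dm : forall i t, 0 <= t <= 1/3 \/ 2/3 <= t <= 1 -> Dm i t = Dp i t;
  (* D0: orientation-respecting smoothing *)
  skein_D0_in : forall t, 0 <= t <= 1/3 ->
    D0 j t = Dp j t /\ D0 k t = Dp k t;
  skein_D0_out : forall t, 2/3 <= t <= 1 ->
    D0 j t = Dp k t /\ D0 k t = Dp j t;
  (* Di: smoothing after the reversal of the string k *)
  skein_Di_in : forall t, 0 <= t <= 1/3 ->
    Di j t = Dp j t /\ Di k t = Dp k (1 - t);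
  skein_Di_out : forall t, 2/3 <= t <= 1 ->
    Di j t = Dp k (1 - t) /\ Di k t = Dp j t;
  skein_Dp_crossing : one_crossing_in c rho j k 1 Dp;
  skein_Dm_crossing : one_crossing_in c rho j k (-1) Dm;
  skein_D0_crossing : no_crossing_in c rho D0;
  skein_Di_crossing : no_crossing_in c rho Di }.

Definition skein_quadruple (j k : 'I_n) (Lp Lm L0 Li : tangle) : Prop :=
  exists Dp Dm D0 Di c rho,
    [/\ isotopic Lp Dp, isotopic Lm Dm, isotopic L0 D0, isotopic Li Di
      & skein_diagrams j k Dp Dm D0 Di c rho].

End Diagrams.
End Tangles.

(* Main.v *)
(* A planar tree with a given trunk is cut at the last arrowhead met along the
   trunk: this leaves the tree carried by the rest of the trunk and the tree that
   flows along that arrow, and planarity says that their leaves lie on the two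
   sides of a cut of the ordered set of leaves.  Hence, with the intervals of
   leaves as entries of unitriangular matrices, the trees whose trunk is a word w
   of arrow ends are counted by L_w and R_w (branches to the left, to the right
   of the trunk), where R_w is the product of the matrices 1 + sign(a) Y_a over
   the heads a met along w, where L_w is the product of the 1 - sign(a) Y_a in the
   opposite order, and where Y_a counts the trees that flow along a.  As
   Y_a ^ 2 = 0, L_w is the inverse of R_w.

   Let d point from the string i_k = U d V to the string j = P d Q.  Then
   Z(L_+) - Z(L_-) is the contribution R_P Y_d R_Q of d, and Y_d splits at the
   leaf i_k into L_U and R_U.  The factor R_P L_U counts the trees on the j-th
   string of L_oo, which is P followed by U backwards, with opposite signs; the
   factor R_U R_Q counts the trees on the i_k-th string U Q of L_0.  The formula
   with a sum follows from R_P L_U = (R_P R_Q) (L_Q L_U). *)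

Require Import Defs.
From HB Require Import structures.
From mathcomp Require Import all_boot all_order all_algebra.
From mathcomp Require Import all_classical all_reals all_analysis.
From mathcomp Require Import ring lra zify.
Set Implicit Arguments.
Unset Strict Implicit.
Unset Printing Implicit Defensive.
Import Order.TTheory GRing.Theory Num.Theory.
Import numFieldNormedType.Exports.
Local Open Scope ring_scope.
Local Notation head := Defs.head.
Local Notation set0 := finset.set0.

(** * Planar trees of arrows in a Gauss diagram *)

(** Trees are counted as sets of arrows. Strings may point at each other cyclically, so the two
    parts into which an arrow cuts a tree are recovered from such a set only through an acyclicity
    argument. The main obstacle is that the matrices Y_a belong to different diagrams: a tree may
    flow along the strings j and i_k, which the smoothings recombine. No tree has j as a leaf. The
    entries that remain at the end, (0, k) or (m, k) on one side and (k + 1, r) on the other, stand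
    for intervals of leaves without i_k. Below the trunk, trees with such leaves use only strings
    common to all the diagrams, and these entries agree by induction on the length of the interval.
    Exactly one of L_+ and L_- has its arrow at d pointing to j. In the other one the arrow leaves j
    and belongs to no tree with trunk j. Either case is treated from the diagram where d points to
    j, and the sign of d there restores the order of the difference. *)

Section SeqFacts.
Variables (T U : eqType).

Lemma uniq_flatten_inj (w : U -> seq T) s x i i' :
  uniq (flatten (map w s)) -> i \in s -> i' \in s ->
  x \in w i -> x \in w i' -> i = i'.
Proof.
elim: s => //= i0 s IHs; rewrite cat_uniq => /and3P[_ /hasPn disj us].
have notin k : k \in s -> x \in w k -> x \notin w i0.
  by move=> ks xk; apply: disj; apply/flattenP; exists (w k); rewrite ?map_f.
rewrite !inE => /predU1P[->|is_] /predU1P[->|i's] // xi xi'.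
- by case/negP: (notin _ i's xi').
- by case/negP: (notin _ is_ xi).
- exact: IHs.
Qed.

Lemma uniq_flatten (w : U -> seq T) s i :
  uniq (flatten (map w s)) -> i \in s -> uniq (w i).
Proof.
elim: s => //= i0 s IHs; rewrite cat_uniq => /and3P[ui _ us].
by rewrite inE => /predU1P[->|/IHs]; last apply.
Qed.

Lemma filter_take_index (p : pred T) x s : p x -> x \in s ->
  seq.filter p (take (index x s) s) = take (index x (seq.filter p s)) (seq.filter p s).
Proof.
move=> px; elim: s => //= y s IHs; rewrite inE eq_sym.
case: eqVneq => [-> _|neq /= xs]; first by rewrite px /= eqxx.
by rewrite IHs //; case: (p y); rewrite //= (negPf neq).
Qed.

Lemma take_index_cat x (s1 s2 : seq T) : x \notin s1 ->
  take (index x (s1 ++ x :: s2)) (s1 ++ x :: s2) = s1.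
Proof.
by move=> xs; rewrite index_cat (negPf xs) /= eqxx addn0 take_size_cat.
Qed.

Lemma cat_cons_injl x (s1 s2 s3 s4 : seq T) : x \notin s1 -> x \notin s3 ->
  s1 ++ x :: s2 = s3 ++ x :: s4 -> s1 = s3.
Proof.
by move=> n1 n3 E; rewrite -(take_index_cat s2 n1) E take_index_cat.
Qed.

End SeqFacts.

(** * Ends, strings and branches of a Gauss diagram *)

Section Ends.
Variables (n : nat) (G : gauss_diagram n).
Implicit Types (e : arrow_end (garrow G)) (a : garrow G) (i : 'I_n).

Lemma uniq_ends : uniq (all_ends (gstring G)).
Proof. by rewrite (perm_uniq (gstring_perm G)) enum_uniq. Qed.

Lemma mem_ends e : e \in all_ends (gstring G).
Proof. by rewrite (perm_mem (gstring_perm G)) mem_enum. Qed.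

Lemma gstring_uniq i : uniq (gstring G i).
Proof. by apply: (uniq_flatten uniq_ends); rewrite mem_enum. Qed.

Lemma end_on_string e : exists i, e \in gstring G i.
Proof. by case/flattenP: (mem_ends e) => _ /mapP[i _ ->]; exists i. Qed.

Definition estr e : 'I_n := xchoose (end_on_string e).

Lemma mem_gstring e i : (e \in gstring G i) = (i == estr e).
Proof.
apply/idP/eqP => [ei|->]; last exact: xchooseP (end_on_string e).
by apply: (uniq_flatten_inj uniq_ends _ _ ei); rewrite ?mem_enum //;
  exact: xchooseP (end_on_string e).
Qed.

Lemma mem_estr e : e \in gstring G (estr e).
Proof. by rewrite mem_gstring. Qed.

Definition tstr a := estr (tail a).
Definition hstr a := estr (head a).

(* What flows along an arrow: its tail's string up to the tail. *)
Definition before_tail a :=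
  take (index (tail a) (gstring G (tstr a))) (gstring G (tstr a)).

Lemma before_tail_cat a i w w' :
  gstring G i = w ++ tail a :: w' -> tstr a = i /\ before_tail a = w.
Proof.
move=> Gi; have ai : tail a \in gstring G i.
  by rewrite Gi mem_cat mem_head orbT.
have /eqP ti : i == tstr a by rewrite /tstr -mem_gstring.
split=> //; rewrite /before_tail -ti Gi take_index_cat //.
by have := gstring_uniq i; rewrite Gi cat_uniq /= => /and3P[_ /norP[]].
Qed.

Lemma before_tailE a : exists w',
  gstring G (tstr a) = before_tail a ++ tail a :: w'.
Proof.
have := mem_estr (tail a); rewrite -/(tstr a) => ta.
exists (drop (index (tail a) (gstring G (tstr a))).+1 (gstring G (tstr a))).
rewrite /before_tail -[LHS](cat_take_drop (index (tail a) (gstring G (tstr a)))).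
by rewrite [drop (index _ _) _](drop_nth (tail a)) ?index_mem // nth_index.
Qed.

End Ends.

(** * Planar trees as sets of arrows *)

Section PlanarSubtrees.
Variables (n : nat) (G : gauss_diagram n).
Implicit Types (e : arrow_end (garrow G)) (a : garrow G) (y t : 'I_n).
Implicit Types (w : seq (arrow_end (garrow G))) (I : {set 'I_n}).
Implicit Types S : {set garrow G}.

Definition before I1 I2 := [forall u in I1, forall v in I2, (u < v)%N].

Lemma beforeP I1 I2 :
  reflect (forall u v : 'I_n, u \in I1 -> v \in I2 -> (u < v)%N)
          (before I1 I2).
Proof.
apply: (iffP 'forall_in_forall_inP) => H u; first by move=> v /H; apply.
by move=> uI v; apply: H.
Qed.

(** Planarity at a vertex: the leaves of one branch all precede those of the other, and a drawing
    may put either branch first. *)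
Definition apart I1 I2 := before I1 I2 || before I2 I1.

Lemma apart_disj I1 I2 : apart I1 I2 -> [disjoint I1 & I2]%B.
Proof.
move=> ap; apply/pred0P => u /=; apply/negP => /andP[u1 u2].
by case/orP: ap => /beforeP/(_ u u); rewrite u1 u2 ltnn => /(_ isT isT).
Qed.

(* [subtree y w I S]: the arrows of S make a planar tree with leaves on I, whose
   trunk is the initial part w of the string y. *)
Inductive subtree : 'I_n -> seq (arrow_end (garrow G)) -> {set 'I_n} ->
    {set garrow G} -> Prop :=
| subtree_nil y : subtree y [::] set0 set0
| subtree_skip y w e I S : subtree y w I S -> subtree y (rcons w e) I S
| subtree_join y w a I1 S1 I2 S2 I S :
    subtree y w I1 S1 -> subtree (tstr a) (before_tail a) I2 S2 ->
    apart (y |: I1) (tstr a |: I2) ->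
    I = I1 :|: (tstr a |: I2) -> S = a |: (S1 :|: S2) ->
    subtree y (rcons w (head a)) I S.

Lemma subtree_notin y w I S : subtree y w I S -> y \notin I.
Proof.
elim=> {y w I S} [y|//|y w a I1 S1 I2 S2 I S _ IH1 _ IH2 ap -> _].
  by rewrite inE.
rewrite !inE (negPf IH1) /=; have /pred0P/(_ y) := apart_disj ap.
by rewrite /= !inE eqxx /= => ->.
Qed.

Lemma subtree_empty y w : subtree y w set0 set0.
Proof.
by elim/last_ind: w => [|w e]; [exact: subtree_nil | exact: subtree_skip].
Qed.

Lemma subtree_cat y w w' I S : subtree y w I S -> subtree y (w ++ w') I S.
Proof.
move=> wIS; elim/last_ind: w' => [|w' e IH]; first by rewrite cats0.
by rewrite -rcons_cat; apply: subtree_skip.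
Qed.

Lemma subtree_tstr y w I S a : subtree y w I S -> a \in S -> tstr a \in I.
Proof.
elim=> {y w I S} [y||y w b I1 S1 I2 S2 I S _ IH1 _ IH2 _ -> ->]; rewrite ?inE //.
by case/predU1P=> [->|/orP[/IH1|/IH2] ->]; rewrite ?eqxx ?orbT.
Qed.

Lemma subtree_head y w I S a : subtree y w I S -> a \in S ->
  head a \in w \/ hstr a \in I.
Proof.
elim=> {y w I S} [y|y w e I S _ IH|y w b I1 S1 I2 S2 I S _ IH1 _ IH2 _ -> ->].
- by rewrite inE.
- by case/IH=> ?; [left; rewrite mem_rcons inE; apply/orP; right | right].
rewrite !inE mem_rcons inE => /predU1P[->|/orP[/IH1|/IH2] []].
- by rewrite eqxx; left.
- by move=> ->; left; rewrite orbT.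
- by move=> ->; right.
- move=> /mem_take; rewrite mem_gstring /hstr => /eqP <-.
  by rewrite eqxx orbT; right.
- by move=> ->; right; rewrite !orbT.
Qed.

Lemma subtree_hstr y w w' I S a : gstring G y = w ++ w' -> subtree y w I S ->
  a \in S -> hstr a \in y |: I.
Proof.
move=> Gy wIS aS; rewrite !inE; case: (subtree_head wIS aS) => [aw|->].
  have : head a \in gstring G y by rewrite Gy mem_cat aw.
  by rewrite mem_gstring eq_sym => ->.
by rewrite orbT.
Qed.

(** A join adds one arrow and one leaf, the string of its tail; [apart] makes all the unions
    involved disjoint. *)
Lemma subtree_card y w I S : subtree y w I S -> #|S| = #|I|.
Proof.
elim=> {y w I S} [y|//|y w a I1 S1 I2 S2 I S h1 IH1 h2 IH2 ap -> ->].
  by rewrite !cards0.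
have dis := apart_disj ap.
have dis12 : I1 :&: (tstr a |: I2) = set0.
  apply/setP => u; rewrite !inE; apply/negP => /andP[u1 u2].
  by move/pred0P/(_ u): dis; rewrite /= !inE u1 u2 orbT.
have aS2 : a \notin S2.
  by apply/negP => /(subtree_tstr h2); apply/negP/(subtree_notin h2).
have aS1 : a \notin S1.
  apply/negP => /(subtree_tstr h1) a1.
  by move/setP/(_ (tstr a)): dis12; rewrite !inE a1 eqxx.
have S12 : S1 :&: S2 = set0.
  apply/setP => b; rewrite !inE; apply/negP => /andP[].
  move=> /(subtree_tstr h1) b1 /(subtree_tstr h2) b2.
  by move/setP/(_ (tstr b)): dis12; rewrite !inE b1 b2 orbT.
rewrite cardsU1 inE negb_or aS1 aS2 (cardsU S1) (cardsU I1) S12 dis12.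
by rewrite !cards0 !subn0 cardsU1 (subtree_notin h2) IH1 IH2 !add1n addnS.
Qed.

Lemma subtree_tstr_inj y w I S : subtree y w I S -> {in S &, injective (@tstr n G)}.
Proof.
elim=> {y w I S} [y||y w c I1 S1 I2 S2 I S h1 IH1 h2 IH2 ap _ ->] a b //.
  by rewrite inE.
have /pred0P dis := apart_disj ap.
have disj u : u \in I1 -> u \in tstr c |: I2 -> False.
  by move=> u1 u2; have := dis u; rewrite /= u2 inE u1 orbT.
rewrite !inE => /predU1P[->|/orP[a1|a2]] /predU1P[->|/orP[b1|b2]] //.
- move=> E; case: (disj (tstr b)); first exact: (subtree_tstr h1).
  by rewrite -E !inE eqxx.
- move=> E; have := subtree_tstr h2 b2.
  by rewrite -E (negPf (subtree_notin h2)).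
- move=> E; case: (disj (tstr a)); first exact: (subtree_tstr h1).
  by rewrite E !inE eqxx.
- exact: IH1.
- move=> E; case: (disj (tstr a)); first exact: (subtree_tstr h1).
  by rewrite E !inE (subtree_tstr h2 b2) orbT.
- move=> E; have := subtree_tstr h2 a2.
  by rewrite E (negPf (subtree_notin h2)).
- move=> E; case: (disj (tstr b)); first exact: (subtree_tstr h1).
  by rewrite -E !inE (subtree_tstr h2 a2) orbT.
- exact: IH2.
Qed.

Lemma subtree_tstr_onto y w I S t : subtree y w I S -> t \in I ->
  exists2 a, a \in S & tstr a = t.
Proof.
elim=> {y w I S} [y||y w c I1 S1 I2 S2 I S h1 IH1 h2 IH2 ap -> ->]; rewrite ?inE //.
case/or3P=> [/IH1[a aS <-]|/eqP ->|/IH2[a aS <-]].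
- by exists a; rewrite // !inE aS orbT.
- by exists c; rewrite // !inE eqxx.
- by exists a; rewrite // !inE aS !orbT.
Qed.

(* Following the arrows of a tree one reaches the trunk. *)
Lemma subtree_acyclic y w I S (D : {set 'I_n}) : subtree y w I S ->
  D \subset I -> (forall b, b \in S -> tstr b \in D -> hstr b \in D) ->
  y \notin D -> (exists w', gstring G y = w ++ w') -> D = set0.
Proof.
move=> wIS; elim: wIS D => {y w I S}
  [y|y w e I S _ IH|y w a I1 S1 I2 S2 I S h1 IH1 h2 IH2 ap -> ->] D DI clD yD [w' Gy].
- by apply/eqP; rewrite -finset.subset0.
- by apply: IH => //; exists (e :: w'); rewrite -cat_rcons.
have hy : hstr a = y.
  have : head a \in gstring G y by rewrite Gy mem_cat mem_rcons mem_head.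
  by rewrite mem_gstring => /eqP ->.
(* The branch behaves like the trunk: [a] ends on [y], which is outside [D], so the closedness of
   [D] keeps the string of its tail outside too. *)
have tD : tstr a \notin D.
  by apply/negP => /(clD a); rewrite !inE eqxx hy (negPf yD) => /(_ isT).
have G1 : gstring G y = w ++ head a :: w' by rewrite -cat_rcons.
have D1 : D :&: I1 = set0.
  apply: IH1; rewrite ?subsetIr //; last by exists (head a :: w').
    move=> b bS; rewrite !inE => /andP[bD _].
    have hD : hstr b \in D by apply: clD; rewrite // !inE bS orbT.
    have := subtree_hstr G1 h1 bS; rewrite hD !inE => /predU1P[E|->//].
    by move: hD; rewrite E (negPf yD).
  by rewrite inE (negPf yD).
have [w2 G2] := before_tailE a.
have D2 : D :&: I2 = set0.
  apply: IH2; rewrite ?subsetIr //; last by exists (tail a :: w2).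
    move=> b bS; rewrite !inE => /andP[bD _].
    have hD : hstr b \in D by apply: clD; rewrite // !inE bS !orbT.
    have := subtree_hstr G2 h2 bS; rewrite hD !inE => /predU1P[E|->//].
    by move: hD; rewrite E (negPf tD).
  by rewrite inE (negPf tD).
apply/setP => u; rewrite inE; apply/negP => uD.
have := fintype.subsetP DI u uD; rewrite !inE => /or3P[u1|/eqP E|u2].
- by move/setP/(_ u): D1; rewrite !inE uD u1.
- by move: uD; rewrite E (negPf tD).
- by move/setP/(_ u): D2; rewrite !inE uD u2.
Qed.

Lemma subtree_rcons_inv y w e I S : subtree y (rcons w e) I S ->
  subtree y w I S \/ exists a I1 S1 I2 S2,
    [/\ e = head a, subtree y w I1 S1, subtree (tstr a) (before_tail a) I2 S2,
        apart (y |: I1) (tstr a |: I2) &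
        I = I1 :|: (tstr a |: I2) /\ S = a |: (S1 :|: S2)].
Proof.
move E: (rcons w e) => w0 H; case: H E => {y w0 I S}
  [y|y w0 e0 I S h|y w0 a I1 S1 I2 S2 I S h1 h2 ap EI ES].
- by move/(congr1 size); rewrite size_rcons.
- by case/rcons_inj => -> ->; left.
- by case/rcons_inj => -> ->; right; exists a, I1, S1, I2, S2.
Qed.

End PlanarSubtrees.

(** * Sums over planar trees and their recursion along the trunk *)

Section SubtreeSums.
Variables (n : nat) (G : gauss_diagram n).
Implicit Types (e : arrow_end (garrow G)) (a : garrow G) (y t : 'I_n).
Implicit Types (w : seq (arrow_end (garrow G))) (I : {set 'I_n}).
Implicit Types S : {set garrow G}.

(* The contribution of an arrow to sign(A) sign(phi). *)
Definition weight a : int :=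
  if (tstr a < hstr a)%N then - gsign a else gsign a.

(** The sum runs over sets of arrows and not over derivations of [subtree]; the recursion at an
    arrowhead therefore rests on the uniqueness of decompositions. *)
Definition subtree_sum y w I : int :=
  \sum_(S | `[< subtree y w I S >]) \prod_(a in S) weight a.

Lemma subtree_sum_nil y I : subtree_sum y [::] I = (I == set0)%:R.
Proof.
have inv J S : subtree y [::] J S -> J = set0 /\ S = set0.
  move E: [::] => w H; case: H E => // [z v e J' S' _ | z v a J1 S1 J2 S2 J' S' _ _
    _ _ _].
    by move/(congr1 size); rewrite size_rcons.
  by move/(congr1 size); rewrite size_rcons.
rewrite /subtree_sum; case: eqVneq => [->|neI].
  rewrite (big_pred1 set0) ?big_set0 // => S; apply/asboolP/eqP => [/inv[]//|->].
  exact: subtree_nil.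
by rewrite big_pred0 // => S; apply/asboolP => /inv[/eqP]; rewrite (negPf neI).
Qed.

Lemma subtree_sum_tail y w e I : e.2 ->
  subtree_sum y (rcons w e) I = subtree_sum y w I.
Proof.
move=> e2; apply: eq_bigl => S; apply/asboolP/asboolP; last exact: subtree_skip.
by case/subtree_rcons_inv => // -[a [I1 [S1 [I2 [S2 [E]]]]]]; rewrite E in e2.
Qed.

(** A leaf in [I2'] but not in [I2] lies in [I1]. The arrow of such a leaf belongs to both [S1] and
    [S2'], so its head is again on a string of the difference. The difference is thus closed under
    following arrows, hence empty by [subtree_acyclic]. *)
Lemma subtree_split_sub y w w' a I1 I2 I1' I2' S1 S2 S1' S2' :
  gstring G y = w ++ w' ->
  subtree y w I1 S1 -> subtree (tstr a) (before_tail a) I2 S2 ->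
  apart (y |: I1) (tstr a |: I2) ->
  subtree y w I1' S1' -> subtree (tstr a) (before_tail a) I2' S2' ->
  apart (y |: I1') (tstr a |: I2') ->
  I1 :|: (tstr a |: I2) = I1' :|: (tstr a |: I2') ->
  a |: (S1 :|: S2) = a |: (S1' :|: S2') -> I2' \subset I2.
Proof.
move=> Gy h1 h2 ap h1' h2' ap' EI ES.
have disj u : u \in y |: I1 -> u \in tstr a |: I2 -> False.
  by move=> u1 u2; move/pred0P/(_ u): (apart_disj ap); rewrite /= u1 u2.
have disj' u : u \in y |: I1' -> u \in tstr a |: I2' -> False.
  by move=> u1 u2; move/pred0P/(_ u): (apart_disj ap'); rewrite /= u1 u2.
suff D0 : I2' :\: I2 = set0 by rewrite -finset.setD_eq0 D0.
have D1 u : u \in I2' :\: I2 -> u \in I1.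
  rewrite inE => /andP[u2 u2']; have : u \in I1' :|: (tstr a |: I2').
    by rewrite !inE u2' !orbT.
  rewrite -EI !inE (negPf u2) orbF => /orP[//|/eqP E].
  by move: u2'; rewrite E (negPf (subtree_notin h2')).
apply: (subtree_acyclic h1); last by exists w'.
- by apply/fintype.subsetP.
- move=> b b1 bD; have := D1 _ bD; have := bD; rewrite inE => /andP[tb2 tb2'] tb1.
  have hb1 := subtree_hstr Gy h1 b1.
  have b2' : b \in S2'.
    have : b \in a |: (S1' :|: S2') by rewrite -ES !inE b1 orbT.
    rewrite !inE => /or3P[/eqP E|/(subtree_tstr h1') tb1'|//].
      by move: tb2'; rewrite E (negPf (subtree_notin h2')).
    by case: (disj' (tstr b)); rewrite !inE ?tb1' ?tb2' ?orbT.
  have [w2 G2] := before_tailE a.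
  have := subtree_hstr G2 h2' b2'.
  rewrite !inE => /predU1P[E|->].
    by case: (disj (hstr b)); rewrite // E !inE eqxx.
  rewrite andbT; apply/negP => hb2.
  by case: (disj (hstr b)); rewrite // !inE hb2 orbT.
- apply/negP => yD; case: (disj' y); first by rewrite !inE eqxx.
  by move: yD; rewrite !inE => /andP[_ ->]; rewrite orbT.
Qed.

(** The two inclusions given by [subtree_split_sub] fix the leaves of the branch, complementation
    fixes those of the trunk, and an arrow belongs to the part whose leaves contain the string of
    its tail. *)
Lemma subtree_split_inj y w w' a I I1 I2 I1' I2' S1 S2 S1' S2' :
  gstring G y = w ++ w' ->
  subtree y w I1 S1 -> subtree (tstr a) (before_tail a) I2 S2 ->
  apart (y |: I1) (tstr a |: I2) ->
  subtree y w I1' S1' -> subtree (tstr a) (before_tail a) I2' S2' ->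
  apart (y |: I1') (tstr a |: I2') ->
  I = I1 :|: (tstr a |: I2) -> I = I1' :|: (tstr a |: I2') ->
  a |: (S1 :|: S2) = a |: (S1' :|: S2') ->
  [/\ I1 = I1', I2 = I2', S1 = S1' & S2 = S2'].
Proof.
move=> Gy h1 h2 ap h1' h2' ap' EI EI' ES.
have EII : I1 :|: (tstr a |: I2) = I1' :|: (tstr a |: I2') by rewrite -EI.
have E2 : I2 = I2'.
  apply/eqP; rewrite finset.eqEsubset.
  rewrite (subtree_split_sub Gy h1 h2 ap h1' h2' ap' EII ES).
  by rewrite (subtree_split_sub Gy h1' h2' ap' h1 h2 ap (esym EII) (esym ES)).
have setI1 J1 J2 : apart (y |: J1) (tstr a |: J2) ->
    J1 = (J1 :|: (tstr a |: J2)) :\: (tstr a |: J2).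
  move=> /apart_disj/pred0P dis; apply/setP => u; rewrite !inE.
  case: (boolP (u \in J1)) => [uJ|_]; last by rewrite /= andNb.
  by have := dis u; rewrite /= !inE uJ orbT /= => ->.
have E1 : I1 = I1' by rewrite (setI1 _ _ ap) EII E2 -setI1 // -E2.
have setS J1 J2 T1 T2 : subtree y w J1 T1 ->
    subtree (tstr a) (before_tail a) J2 T2 -> apart (y |: J1) (tstr a |: J2) ->
    T1 = [set b in a |: (T1 :|: T2) | tstr b \in J1] /\
    T2 = [set b in a |: (T1 :|: T2) | tstr b \in J2].
  move=> g1 g2 /apart_disj/pred0P dis.
  have disj u : u \in J1 -> u \in tstr a |: J2 -> False.
    by move=> u1 u2; have := dis u; rewrite /= u2 inE u1 orbT.
  split; apply/setP => b; rewrite !inE; apply/idP/andP => [bT|[]].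
  - by rewrite bT orbT (subtree_tstr g1 bT).
  - case/or3P=> [/eqP ->|//|/(subtree_tstr g2) b2] b1.
      by case: (disj (tstr a)); rewrite // !inE eqxx.
    by case: (disj (tstr b)); rewrite // !inE b2 orbT.
  - by rewrite bT !orbT (subtree_tstr g2 bT).
  - case/or3P=> [/eqP ->|/(subtree_tstr g1) b1|//].
      by rewrite (negPf (subtree_notin g2)).
    by move=> b2; case: (disj (tstr b)); rewrite // !inE b2 orbT.
have [E3 E4] := setS _ _ _ _ h1 h2 ap; have [E5 E6] := setS _ _ _ _ h1' h2' ap'.
by split=> //; [rewrite E3 E5 ES E1 | rewrite E4 E6 ES E2].
Qed.

(** The trees that omit [a] are those on [w]; in the others [a] joins last, and its removal leaves
    two independent trees. The condition [tstr a \notin p.2] makes [p.2] recoverable from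
    [tstr a |: p.2], so that pairs will correspond to cuts. *)
Lemma subtree_sum_head y w w' a I : gstring G y = rcons w (head a) ++ w' ->
  subtree_sum y (rcons w (head a)) I = subtree_sum y w I +
  \sum_(p : {set 'I_n} * {set 'I_n} |
        [&& I == p.1 :|: (tstr a |: p.2), tstr a \notin p.2
          & apart (y |: p.1) (tstr a |: p.2)])
     weight a * (subtree_sum y w p.1
                 * subtree_sum (tstr a) (before_tail a) p.2).
Proof.
move=> Gy; have Gy1 : gstring G y = w ++ head a :: w' by rewrite -cat_rcons.
have [w2 Gt] := before_tailE a.
have hy : hstr a = y.
  have : head a \in gstring G y by rewrite Gy1 mem_cat mem_head orbT.
  by rewrite mem_gstring => /eqP ->.
have aw : head a \notin w.
  have := gstring_uniq G y; rewrite Gy1 cat_uniq /=.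
  by case/and3P=> _ /norP[].
(* The head of [a] is not on [w], and its string [y] is not a leaf. *)
have aS J S : subtree y w J S -> a \notin S.
  move=> h; apply/negP => /(subtree_head h)[]; first by apply/negP.
  by rewrite hy; apply/negP/(subtree_notin h).
(* [A] collects the decompositions; the union map [h] is a bijection from it onto the trees
   containing [a]. *)
pose A := [set x : ({set 'I_n} * {set 'I_n}) * ({set garrow G} * {set garrow G})
  | [&& I == x.1.1 :|: (tstr a |: x.1.2), tstr a \notin x.1.2
          & apart (y |: x.1.1) (tstr a |: x.1.2)] &&
    (`[< subtree y w x.1.1 x.2.1 >] &&
     `[< subtree (tstr a) (before_tail a) x.1.2 x.2.2 >])].
pose h (x : ({set 'I_n} * {set 'I_n}) * ({set garrow G} * {set garrow G})) :=
  a |: (x.2.1 :|: x.2.2).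
rewrite {1}/subtree_sum (bigID (fun S => a \notin S)) /=; congr (_ + _).
  apply: eq_bigl => S; apply/andP/asboolP => [[/asboolP] | hS]; last first.
    by split; [apply/asboolP/subtree_skip | exact: aS hS].
  case/subtree_rcons_inv => // -[b [I1 [S1 [I2 [S2 [[<-] _ _ _ [_ ->]]]]]]].
  by rewrite !inE eqxx.
rewrite (eq_bigl (mem (h @: A))) => [|S]; last first.
  apply/andP/imsetP => [[/asboolP hS]|].
    case: (subtree_rcons_inv hS) => [/aS ->//|].
    case=> b [I1 [S1 [I2 [S2 [[<-] h1 h2 ap [EI ES]]]]]] _.
    exists ((I1, I2), (S1, S2)); last exact: ES.
    rewrite inE /= EI eqxx (subtree_notin h2) ap /=.
    by apply/andP; split; apply/asboolP.
  case=> -[[I1 I2] [S1 S2]]; rewrite inE /=.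
  case/andP=> /and3P[/eqP EI _ ap] /andP[/asboolP h1 /asboolP h2] ->.
  by split; [apply/asboolP; apply: subtree_join h1 h2 ap _ _ | rewrite !inE eqxx].
rewrite big_imset /= => [|x x']; last first.
  case: x x' => -[I1 I2] [S1 S2] [[I1' I2'] [S1' S2']]; rewrite !inE /=.
  case/andP=> /and3P[/eqP EI _ ap] /andP[/asboolP h1 /asboolP h2].
  case/andP=> /and3P[/eqP EI' _ ap'] /andP[/asboolP h1' /asboolP h2'] ES.
  by have [-> -> -> ->] := subtree_split_inj Gy1 h1 h2 ap h1' h2' ap' EI EI' ES.
rewrite (eq_bigr (fun p => \sum_(q : {set garrow G} * {set garrow G} |
    `[< subtree y w p.1 q.1 >] && `[< subtree (tstr a) (before_tail a) p.2 q.2 >])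
    weight a * (\prod_(b in q.1) weight b * \prod_(b in q.2) weight b))).
  rewrite pair_big_dep /=; apply: eq_big => [x|]; first by rewrite !inE.
  move=> -[[I1 I2] [S1 S2]]; rewrite !inE /=.
  case/andP=> /and3P[_ _ /apart_disj/pred0P dis] /andP[/asboolP h1 /asboolP h2].
  have aS2 : a \notin S2.
    by apply/negP => /(subtree_tstr h2); apply/negP/(subtree_notin h2).
  rewrite /h /= big_setU1 /=; last by rewrite inE negb_or (aS _ _ h1) aS2.
  congr (_ * _); rewrite (eq_bigl [in [predU S1 & S2]]) => [|b]; last by rewrite !inE.
  rewrite bigU //=.
  rewrite disjoint_subset; apply/fintype.subsetP => b b1; rewrite inE.
  apply/negP => /(subtree_tstr h2) b2; have := dis (tstr b).
  by rewrite /= !inE b2 (subtree_tstr h1 b1) !orbT.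
move=> -[I1 I2] _ /=; rewrite -mulr_sumr; congr (_ * _).
by rewrite /subtree_sum big_distrlr /= pair_big.
Qed.

End SubtreeSums.

(** * Flow matrices *)

Section Intervals.
Variables (n r : nat) (x : 'I_r -> 'I_n).
Hypothesis x_incr : forall s t : 'I_r, (s < t)%N -> (x s < x t)%N.

(** Half-open, with natural bounds: the bounds are cuts numbered from 0 to [r], which will index the
    rows and columns of the matrices. *)
Definition itv (a b : nat) : {set 'I_n} := [set x s | s : 'I_r & (a <= s < b)%N].

Lemma x_lt (s t : 'I_r) : (x s < x t)%N = (s < t)%N.
Proof.
apply/idP/idP => [|/x_incr//]; apply: contraTT; rewrite -!leqNgt leq_eqVlt.
by case/predU1P => [/val_inj ->|/x_incr /ltnW].
Qed.

Lemma x_inj : injective x.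
Proof.
move=> s t E; apply: ord_inj; case: (ltngtP s t) => // /x_incr.
  by rewrite E ltnn.
by rewrite E ltnn.
Qed.

Lemma mem_itv a b s : (x s \in itv a b) = (a <= s < b)%N.
Proof. by rewrite finset.mem_imset ?inE //; exact: x_inj. Qed.

Lemma itvP a b u :
  reflect (exists2 s : 'I_r, (a <= s < b)%N & u = x s) (u \in itv a b).
Proof.
by apply: (iffP imsetP) => -[s]; rewrite ?inE => sab ->; exists s; rewrite ?inE.
Qed.

Lemma itv_empty a b : (b <= a)%N -> itv a b = set0.
Proof.
move=> ba; apply/setP => u; rewrite inE; apply/itvP => -[s /andP[as_ sb] _].
by have := leq_trans sb (leq_trans ba as_); rewrite ltnn.
Qed.

Section Splits.
(** The gap between [q] and [q'] leaves room for the trunk's own leaf when [y] is one of the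
    [x s]. *)
Variables (y : 'I_n) (a q q' b : nat) (p0 : 'I_r).
Hypothesis qq' : (q <= q')%N.
Hypothesis lt_left : forall s : 'I_r, (a <= s < q)%N -> (x s < y)%N.
Hypothesis lt_right : forall s : 'I_r, (q' <= s < b)%N -> (y < x s)%N.
Variables (R : nmodType) (f : {set 'I_n} -> {set 'I_n} -> R).
Let I := itv a q :|: itv q' b.
Let t := x p0.

Let mem_I u : u \in I -> exists2 s : 'I_r, (a <= s < q)%N || (q' <= s < b)%N & u = x s.
Proof.
rewrite inE => /orP[] /itvP[s sab ->]; exists s; rewrite ?sab ?orbT //.
Qed.

(** The part [J] that contains [t] is separated from [y], which lies to the left of [t]. So [J] is a
    final segment of the right interval, and the cut is its least index. *)
Lemma sum_splits_right : (q' <= p0 < b)%N ->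
  \sum_(p : {set 'I_n} * {set 'I_n} |
        [&& I == p.1 :|: (t |: p.2), t \notin p.2 & apart (y |: p.1) (t |: p.2)])
     f p.1 p.2 =
  \sum_(c : 'I_r.+1 | (q' <= c <= p0)%N)
     f (itv a q :|: itv q' c) (itv c b :\ t).
Proof.
move=> /andP[q'p pb].
have yt : (y < t)%N by apply: lt_right; rewrite q'p.
pose h (c : 'I_r.+1) := (itv a q :|: itv q' c, itv c b :\ t).
have h_inj : {in [set c : 'I_r.+1 | (q' <= c <= p0)%N] &, injective h}.
  suff lt (c c' : 'I_r.+1) : (q' <= c <= p0)%N -> (q' <= c' <= p0)%N -> h c = h c' ->
      (c' <= c)%N.
    move=> c c'; rewrite !inE => cP c'P E; apply: ord_inj; apply/eqP.
    by rewrite eqn_leq (lt c c') // (lt c' c).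
  move=> /andP[q'c cp] /andP[q'c' c'p] [_ /setP E]; rewrite leqNgt.
  apply/negP => cc'.
  have cr : (c < r)%N := leq_ltn_trans cp (ltn_ord p0).
  have := E (x (Ordinal cr)); rewrite !inE !mem_itv /= leqnn [(c' <= c)%N]leqNgt cc'.
  rewrite (leq_ltn_trans cp pb) /= andbF andbT (inj_eq x_inj) -val_eqE /=.
  by rewrite neq_ltn (leq_trans cc' c'p).
rewrite [RHS](eq_bigl [in [set c : 'I_r.+1 | (q' <= c <= p0)%N]]) => [|c];
  last by rewrite inE.
rewrite -(big_imset (fun p => f p.1 p.2) h_inj) /=; apply: eq_bigl => -[I1 I2] /=.
apply/and3P/imsetP => [[/eqP EI tI2 ap]|[c]]; last first.
  rewrite inE => /andP[q'c cp] [-> ->].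
  have tJ : t |: (itv c b :\ t) = itv c b.
    by apply: finset.setD1K; rewrite mem_itv cp.
  rewrite tJ; split.
  - apply/eqP/setP => u; rewrite !inE -orbA; congr (_ || _).
    apply/idP/orP => [/itvP[s /andP[q's sb] ->]|[]/itvP[s /andP[s1 s2] ->]].
    + by rewrite !mem_itv q's sb andbT; case: ltnP; [left|right].
    + by rewrite mem_itv s1 (leq_trans s2) // (leq_trans cp) // ltnW.
    + by rewrite mem_itv s2 (leq_trans q'c s1).
  - by rewrite !inE eqxx.
  - apply/orP; left; apply/beforeP => u v.
    move=> + /itvP[s' /andP[cs' s'b] ->]; rewrite !inE.
    have ys' : (y < x s')%N by apply: lt_right; rewrite (leq_trans q'c).
    case/or3P => [/eqP ->//|/itvP[s sab ->]|/itvP[s /andP[_ sc] ->]].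
      by apply: ltn_trans ys'; apply: lt_left.
    by rewrite x_lt (leq_trans sc).
move: EI ap; move J_def: (t |: I2) => J EI ap.
have tJ : t \in J by rewrite -J_def !inE eqxx.
have bef : before (y |: I1) J.
  case/orP: ap => // /beforeP/(_ t y tJ); rewrite !inE eqxx => /(_ isT).
  by rewrite ltnNge (ltnW yt).
have {bef}bef u v : u \in y |: I1 -> v \in J -> (u < v)%N by apply/beforeP.
have JI u : u \in J -> u \in I by move=> uJ; rewrite EI finset.in_setU uJ orbT.
have JnI1 u : u \in J -> u \notin I1.
  move=> uJ; apply/negP => uI1.
  by have := bef u u; rewrite !inE uI1 orbT ltnn => /(_ isT uJ).
case: (@arg_minnP _ p0 (fun s => x s \in J) val tJ) => c xcJ c_min.
have cp : (c <= p0)%N := c_min p0 tJ.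
have yc : (y < x c)%N by apply: bef; rewrite // !inE eqxx.
have q'c : (q' <= c)%N.
  have [s sI /x_inj cs] := mem_I (JI _ xcJ); rewrite cs.
  case/orP: sI => [/lt_left|/andP[]//]; rewrite -cs => cy.
  by have := ltn_trans yc cy; rewrite ltnn.
have EJ : J = itv c b.
  apply/setP => u; apply/idP/itvP => [uJ|[s /andP[cs sb] ->]].
    have [s sI us] := mem_I (JI u uJ); exists s => //.
    have cs : (c <= s)%N by apply: c_min; rewrite -us.
    rewrite cs /=; case/orP: sI => [/andP[_ sq]|/andP[]//].
    have := leq_trans (leq_trans sq qq') (leq_trans q'c cs).
    by rewrite ltnn.
  have : x s \in I by rewrite inE !mem_itv (leq_trans q'c cs) sb orbT.
  rewrite EI finset.in_setU => /orP[sI1|//].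
  by have := bef (x s) (x c); rewrite !inE sI1 orbT x_lt ltnNge cs => /(_ isT xcJ).
exists (widen_ord (leqnSn r) c); first by rewrite inE /= q'c.
rewrite /h /= -EJ -J_def finset.setU1K //; congr (_, _).
apply/setP => u; apply/idP/idP => [uI1|].
  have uI : u \in I by rewrite EI finset.in_setU uI1.
  have [s sI us] := mem_I uI; rewrite inE us !mem_itv.
  case/orP: sI => [->//|/andP[q's sb]]; rewrite q's ltnNge.
  case: (leqP c s) => [cs|]; rewrite ?orbT //.
  have : u \in J by rewrite EJ us mem_itv cs.
  by move/JnI1; rewrite uI1.
move=> uI; have [s sac us] : exists2 s : 'I_r,
    (a <= s < q)%N || (q' <= s < c)%N & u = x s.
  by move: uI; rewrite inE => /orP[] /itvP[s sP ->]; exists s; rewrite ?sP ?orbT.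
have sc : (s < c)%N.
  case/orP: sac => /andP[] // _ sq.
  exact: leq_trans sq (leq_trans qq' q'c).
have : u \in I.
  rewrite us inE !mem_itv; case/orP: sac => [->//|/andP[-> _]].
  by rewrite (ltn_trans sc (leq_ltn_trans cp pb)) orbT.
rewrite EI finset.in_setU => /orP[//|]; rewrite EJ us mem_itv leqNgt sc //.
Qed.

(** Mirror image of [sum_splits_right]: [J] is an initial segment of the left interval, and the cut
    comes one after its greatest index, whence [lift ord0 c] below. *)
Lemma sum_splits_left : (a <= p0 < q)%N ->
  \sum_(p : {set 'I_n} * {set 'I_n} |
        [&& I == p.1 :|: (t |: p.2), t \notin p.2 & apart (y |: p.1) (t |: p.2)])
     f p.1 p.2 =
  \sum_(c : 'I_r.+1 | (p0 < c <= q)%N)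
     f (itv c q :|: itv q' b) (itv a c :\ t).
Proof.
move=> /andP[ap0 pq].
have ty : (t < y)%N by apply: lt_left; rewrite ap0.
pose h (c : 'I_r.+1) := (itv c q :|: itv q' b, itv a c :\ t).
have h_inj : {in [set c : 'I_r.+1 | (p0 < c <= q)%N] &, injective h}.
  suff lt (c c' : 'I_r.+1) : (p0 < c <= q)%N -> (p0 < c' <= q)%N -> h c = h c' ->
      (c' <= c)%N.
    move=> c c'; rewrite !inE => cP c'P E; apply: ord_inj; apply/eqP.
    by rewrite eqn_leq (lt c c') // (lt c' c).
  move=> /andP[pc cq] /andP[pc' c'q] [_ /setP E]; rewrite leqNgt.
  apply/negP => cc'.
  have cr : (c < r)%N by rewrite (leq_trans cc') // -ltnS ltn_ord.
  have := E (x (Ordinal cr)); rewrite !inE !mem_itv /= ltnn cc' !andbF.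
  rewrite (leq_trans ap0 (ltnW pc)) !andbT (inj_eq x_inj) -val_eqE /=.
  by rewrite neq_ltn pc orbT.
rewrite [RHS](eq_bigl [in [set c : 'I_r.+1 | (p0 < c <= q)%N]]) => [|c];
  last by rewrite inE.
rewrite -(big_imset (fun p => f p.1 p.2) h_inj) /=; apply: eq_bigl => -[I1 I2] /=.
apply/and3P/imsetP => [[/eqP EI tI2 ap]|[c]]; last first.
  rewrite inE => /andP[pc cq] [-> ->].
  have tJ : t |: (itv a c :\ t) = itv a c.
    by apply: finset.setD1K; rewrite mem_itv ap0.
  rewrite tJ; split.
  - apply/eqP/setP => u; rewrite !inE [RHS]orbAC; congr (_ || _).
    rewrite [RHS]orbC.
    apply/idP/orP => [/itvP[s /andP[as_ sq] ->]|[]/itvP[s /andP[s1 s2] ->]].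
    + by rewrite !mem_itv as_ sq andbT; case: ltnP; [left|right].
    + by rewrite mem_itv s1 (leq_trans s2).
    + by rewrite mem_itv s2 (leq_trans ap0) // (leq_trans (ltnW pc)).
  - by rewrite !inE eqxx.
  - apply/orP; right; apply/beforeP => u v.
    move=> /itvP[s' /andP[as' s'c] ->]; rewrite !inE.
    have ys' : (x s' < y)%N by apply: lt_left; rewrite as' (leq_trans s'c).
    case/or3P => [/eqP ->//|/itvP[s /andP[cs _] ->]|/itvP[s sab ->]].
      by rewrite x_lt (leq_trans s'c).
    by apply: (ltn_trans ys'); apply: lt_right.
move: EI ap; move J_def: (t |: I2) => J EI ap.
have tJ : t \in J by rewrite -J_def !inE eqxx.
have bef : before J (y |: I1).
  case/orP: ap => // /beforeP/(_ y t); rewrite !inE eqxx tJ => /(_ isT isT).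
  by rewrite ltnNge (ltnW ty).
have {bef}bef u v : u \in J -> v \in y |: I1 -> (u < v)%N by apply/beforeP.
have JI u : u \in J -> u \in I by move=> uJ; rewrite EI finset.in_setU uJ orbT.
have JnI1 u : u \in J -> u \notin I1.
  move=> uJ; apply/negP => uI1.
  by have := bef u u; rewrite !inE uI1 orbT ltnn => /(_ uJ isT).
case: (@arg_maxnP _ p0 (fun s => x s \in J) val tJ) => c xcJ c_max.
have pc : (p0 <= c)%N := c_max p0 tJ.
have cy : (x c < y)%N by apply: bef; rewrite // !inE eqxx.
have cq : (c < q)%N.
  have [s sI /x_inj cs] := mem_I (JI _ xcJ); rewrite cs.
  case/orP: sI => [/andP[]//|/lt_right]; rewrite -cs => yc.
  by have := ltn_trans yc cy; rewrite ltnn.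
have EJ : J = itv a c.+1.
  apply/setP => u; apply/idP/itvP => [uJ|[s /andP[as_ sc] ->]].
    have [s sI us] := mem_I (JI u uJ); exists s => //.
    have sc : (s <= c)%N by apply: c_max; rewrite -us.
    rewrite ltnS sc andbT; case/orP: sI => [/andP[]//|/andP[q's _]].
    have := leq_ltn_trans (leq_trans q's sc) cq.
    by rewrite ltnNge qq'.
  have : x s \in I by rewrite inE !mem_itv as_ (leq_ltn_trans _ cq).
  rewrite EI finset.in_setU => /orP[sI1|//].
  have := bef (x c) (x s) xcJ; rewrite !inE sI1 orbT x_lt => /(_ isT).
  by rewrite ltnNge -ltnS sc.
exists (lift ord0 c); first by rewrite inE lift0 ltnS pc.
rewrite /h lift0 -EJ -J_def finset.setU1K //; congr (_, _).
apply/setP => u; apply/idP/idP => [uI1|].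
  have uI : u \in I by rewrite EI finset.in_setU uI1.
  have [s sI us] := mem_I uI; rewrite inE us !mem_itv.
  case/orP: sI => [/andP[as_ sq]|->]; rewrite ?orbT // sq andbT.
  case: (ltnP c s) => [//|sc].
  have : u \in J by rewrite EJ us mem_itv as_.
  by move/JnI1; rewrite uI1.
move=> uI; have [s sac us] : exists2 s : 'I_r,
    (c < s < q)%N || (q' <= s < b)%N & u = x s.
  by move: uI; rewrite inE => /orP[] /itvP[s sP ->]; exists s; rewrite ?sP ?orbT.
have cs : (c < s)%N.
  case/orP: sac => /andP[] // q's _.
  exact: leq_trans cq (leq_trans qq' q's).
have : u \in I.
  rewrite us inE !mem_itv; case/orP: sac => [/andP[_ ->]|->]; rewrite ?orbT //.
  by rewrite (leq_trans ap0) // ltnW // (leq_ltn_trans pc).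
by rewrite EI finset.in_setU => /orP[//|]; rewrite EJ us mem_itv ltnNge cs andbF.
Qed.

End Splits.
End Intervals.

(** * Unitriangular integer matrices indexed by cuts *)

Section Unitriangular.
Variable r : nat.
Implicit Types M N : 'M[int]_r.+1.

(** The diagonal is 1 because an empty interval of leaves admits only the tree without arrows. *)
Definition unitri M := forall c b : 'I_r.+1, (b <= c)%N -> M c b = (c == b)%:R.

Lemma unitri1 : unitri 1.
Proof. by move=> c b _; rewrite !mxE. Qed.

Lemma unitriM M N : unitri M -> unitri N -> unitri (M * N).
Proof.
move=> uM uN c b bc; rewrite -mulmxE mxE (bigD1 c) //= big1 => [|e ec].
  by rewrite uM // eqxx mul1r uN // addr0.
case: (leqP e c) => [le_ec|lt_ce]; first by rewrite uM // eq_sym (negPf ec) mul0r.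
rewrite uN ?(leq_trans bc (ltnW lt_ce)) //.
by rewrite -val_eqE /= gtn_eqF ?mulr0 // (leq_ltn_trans bc).
Qed.

Lemma unitriD M z : (forall c b : 'I_r.+1, (b <= c)%N -> M c b = 0) ->
  unitri (1 + z *: M).
Proof. by move=> M0 c b bc; rewrite !mxE M0 // mulr0 addr0. Qed.

(* An entry (c, b) stands for the interval c, ..., b - 1 of leaves. *)
Definition agree (P : rel 'I_r.+1) M N := forall c b, P c b -> M c b = N c b.

Definition hereditary (P : rel 'I_r.+1) := forall c b c' b' : 'I_r.+1,
  P c b -> (c <= c')%N -> (c' <= b')%N -> (b' <= b)%N -> P c' b'.

(** In the entry (c, b) of a product only the cuts e with c <= e <= b contribute, and then [c, e)
    and [e, b) are subintervals of [c, b). *)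
Lemma agreeM P M N M' N' : hereditary P -> unitri M -> unitri N ->
  unitri M' -> unitri N' -> agree P M M' -> agree P N N' ->
  agree P (M * N) (M' * N').
Proof.
move=> hP uM uN uM' uN' aM aN c b Pcb; rewrite -!mulmxE !mxE.
apply: eq_bigr => e _; case: (leqP c e) => [ce|ec]; last first.
  by rewrite uM ?uM' ?(ltnW ec) // -val_eqE /= gtn_eqF // !mul0r.
case: (leqP e b) => [eb|be]; last first.
  by rewrite uN ?uN' ?(ltnW be) // -val_eqE /= gtn_eqF // !mulr0.
by rewrite aM ?aN //; apply: hP Pcb _ _ _.
Qed.

End Unitriangular.

(** * Trees on a given trunk as products of flow matrices *)

Section FlowMatrices.
Variables (n r : nat) (x : 'I_r -> 'I_n).
Hypothesis x_incr : forall s t : 'I_r, (s < t)%N -> (x s < x t)%N.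
Let x_inj := x_inj x_incr.
Variable G : gauss_diagram n.
Implicit Types (e : arrow_end (garrow G)) (a : garrow G) (y t : 'I_n).
Implicit Types (w : seq (arrow_end (garrow G))) (I : {set 'I_n}).

(* The entry (c, b) sums the trees with leaves on x c, ..., x (b - 1) that flow
   along the arrow a.  Products of such matrices split intervals of leaves. *)
Definition flowmx a : 'M[int]_r.+1 :=
  \matrix_(c, b) \sum_(p : 'I_r | (x p == tstr a) && (c <= p < b)%N)
    subtree_sum (x p) (before_tail a) (itv x c b :\ x p).

Lemma flowmxE a p c b : x p = tstr a ->
  flowmx a c b = if (c <= p < b)%N
    then subtree_sum (tstr a) (before_tail a) (itv x c b :\ tstr a) else 0.
Proof.
move=> xp; rewrite mxE; case: ifP => cpb.
  rewrite (big_pred1 p) ?xp // => s; rewrite -xp (inj_eq x_inj) /=.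
  by case: eqP => //= ->.
rewrite big_pred0 // => s; rewrite -xp (inj_eq x_inj).
by case: eqP => //= ->.
Qed.

Lemma flowmx_off a c b : (forall p, x p != tstr a) -> flowmx a c b = 0.
Proof. by move=> xa; rewrite mxE big_pred0 // => p; rewrite (negPf (xa p)). Qed.

Lemma flowmx_eq0 a (c b : 'I_r.+1) : tstr a \notin itv x c b -> flowmx a c b = 0.
Proof.
move=> ta; rewrite mxE big_pred0 // => p; apply/negP => /andP[/eqP E cpb].
by move: ta; rewrite -E mem_itv ?cpb.
Qed.

Lemma flowmx_strict a (c b : 'I_r.+1) : (b <= c)%N -> flowmx a c b = 0.
Proof. by move=> bc; rewrite flowmx_eq0 // itv_empty // inE. Qed.

(** The leaf [tstr a] would have to lie on both sides of the cut. *)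
Lemma flowmx_sq a : flowmx a * flowmx a = 0.
Proof.
apply/matrixP => c b; rewrite -mulmxE !mxE big1 // => e _.
case: (boolP [exists p, x p == tstr a]) => [/existsP[p /eqP xp]|]; last first.
  by rewrite negb_exists => /forallP xa; rewrite flowmx_off ?mul0r.
rewrite !(flowmxE _ _ xp); case: (ltnP p e) => [pe|ep]; last by rewrite andbF mul0r.
by rewrite mulr0.
Qed.

Definition letter (z : int) a : 'M[int]_r.+1 := 1 + z *: flowmx a.

Definition rmx w := \prod_(e <- w | ~~ e.2) letter (gsign e.1) e.1.
Definition lmx w := \prod_(e <- rev w | ~~ e.2) letter (- gsign e.1) e.1.

Lemma unitri_letter z a : unitri (letter z a).
Proof. by apply: unitriD => c b; apply: flowmx_strict. Qed.

Lemma unitri_rmx w : unitri (rmx w).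
Proof.
by apply: big_rec => [|e M _]; [exact: unitri1 | apply: unitriM; apply: unitri_letter].
Qed.

Lemma unitri_lmx w : unitri (lmx w).
Proof.
by apply: big_rec => [|e M _]; [exact: unitri1 | apply: unitriM; apply: unitri_letter].
Qed.

Lemma rmx_cat w w' : rmx (w ++ w') = rmx w * rmx w'.
Proof. exact: big_cat. Qed.

Lemma lmx_cat w w' : lmx (w ++ w') = lmx w' * lmx w.
Proof. by rewrite /lmx rev_cat big_cat. Qed.

Lemma rmx1 e : rmx [:: e] = if e.2 then 1 else letter (gsign e.1) e.1.
Proof. by rewrite /rmx big_cons big_nil; case: e.2; rewrite //= mulr1. Qed.

Lemma lmx1 e : lmx [:: e] = if e.2 then 1 else letter (- gsign e.1) e.1.
Proof. by rewrite /lmx big_cons big_nil; case: e.2; rewrite //= mulr1. Qed.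

Lemma rmxK w : rmx w * lmx w = 1.
Proof.
elim/last_ind: w => [|w e IHw]; first by rewrite /rmx /lmx !big_nil mulr1.
rewrite -cats1 rmx_cat lmx_cat mulrA -(mulrA (rmx w)).
suff -> : rmx [:: e] * lmx [:: e] = 1 by rewrite mulr1.
rewrite rmx1 lmx1; case: e.2; first by rewrite mulr1.
rewrite /letter scaleNr mulrBr mulr1 mulrDl mul1r.
by rewrite -scalerAl -scalerAr flowmx_sq !scaler0 addr0 addrK.
Qed.

(** Induction from the end of the trunk. The branch that joins last takes the outermost leaves, a
    final segment of the right interval or an initial segment of the left one; hence its letter
    multiplies [rmx] on the right and [lmx] on the left. A branch on the left comes from a string
    before [y], so its arrow is right-pointing, which gives the sign in [lmx]. *)
Lemma subtree_sumE w w' y (a q q' b : 'I_r.+1) :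
  gstring G y = w ++ w' -> (a <= q)%N -> (q <= q')%N -> (q' <= b)%N ->
  (forall s : 'I_r, (a <= s < q)%N -> (x s < y)%N) ->
  (forall s : 'I_r, (q' <= s < b)%N -> (y < x s)%N) ->
  subtree_sum y w (itv x a q :|: itv x q' b) = lmx w a q * rmx w q' b.
Proof.
move=> Gy; elim/last_ind: w w' Gy a q q' b =>
  [|w e IHw] w' Gy a q q' b aq qq' q'b ll lr.
  (* Without arrows only the empty set of leaves counts, that is, both intervals have to be
     empty. *)
  rewrite subtree_sum_nil /lmx /rmx !big_nil !mxE.
  case: (eqVneq a q) aq ll => [->|neq] aq ll.
    rewrite itv_empty // finset.set0U mul1r.
    case: (eqVneq q' b) q'b lr => [->|neq] q'b lr; first by rewrite itv_empty ?eqxx.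
    have q'b' : (q' < b)%N by rewrite ltn_neqAle q'b andbT.
    have q'r : (q' < r)%N by rewrite (leq_trans q'b') // -ltnS.
    apply/eqP; rewrite pnatr_eq0 eqb0; apply/eqP => /setP/(_ (x (Ordinal q'r))).
    by rewrite mem_itv // inE leqnn q'b'.
  have aq' : (a < q)%N by rewrite ltn_neqAle aq andbT.
  have ar : (a < r)%N by rewrite (leq_trans aq') // -ltnS.
  rewrite mul0r; apply/eqP; rewrite pnatr_eq0 eqb0.
  apply/eqP => /setP/(_ (x (Ordinal ar))).
  by rewrite inE !mem_itv // inE leqnn aq'.
have Gy1 : gstring G y = w ++ e :: w' by rewrite -cat_rcons.
rewrite -cats1 lmx_cat rmx_cat rmx1 lmx1 cats1.
case: (boolP e.2) => [e2|]; first by rewrite subtree_sum_tail //= mulr1 mul1r;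
  apply: IHw Gy1 _ _ _ _ _ _ _ _ _.
case: e Gy Gy1 => e [] // Gy Gy1 _ /=; rewrite -/(head e) in Gy Gy1 *.
rewrite (subtree_sum_head _ Gy) (IHw _ Gy1) //.
have hy : hstr e = y.
  have : head e \in gstring G y by rewrite Gy1 mem_cat mem_head orbT.
  by rewrite mem_gstring => /eqP ->.
have rE : (rmx w * letter (gsign e) e) q' b =
    rmx w q' b + gsign e * \sum_(c : 'I_r.+1) rmx w q' c * flowmx e c b.
  by rewrite mulrDr mulr1 -scalerAr -mulmxE !mxE.
have lE : (letter (- gsign e) e * lmx w) a q =
    lmx w a q - gsign e * \sum_(c : 'I_r.+1) flowmx e a c * lmx w c q.
  by rewrite mulrDl mul1r -scalerAl -mulmxE !mxE mulNr.
(* The new letter changes only the factor of the interval that contains the string of its tail. *)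
have L0 : tstr e \notin itv x a q ->
    \sum_(c : 'I_r.+1) flowmx e a c * lmx w c q = 0.
  move=> ta; rewrite big1 // => c _; case: (leqP c q) => [cq|qc].
    rewrite flowmx_eq0 ?mul0r //; apply: contra ta => /itvP[s /andP[as_ sc] ->].
    by rewrite mem_itv // as_ (leq_trans sc).
  by rewrite unitri_lmx ?(ltnW qc) // -val_eqE /= gtn_eqF // mulr0.
have R0 : tstr e \notin itv x q' b ->
    \sum_(c : 'I_r.+1) rmx w q' c * flowmx e c b = 0.
  move=> ta; rewrite big1 // => c _; case: (leqP q' c) => [q'c|cq'].
    rewrite flowmx_eq0 ?mulr0 //; apply: contra ta => /itvP[s /andP[cs sb] ->].
    by rewrite mem_itv // sb (leq_trans q'c).
  by rewrite unitri_rmx ?(ltnW cq') // -val_eqE /= gtn_eqF // mul0r.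
rewrite rE lE; set t := tstr e in L0 R0 *.
have [tI|tI] := boolP (t \in itv x a q :|: itv x q' b); last first.
  rewrite L0 ?R0 ?mulr0 ?subr0 ?addr0; first 1 last.
  - by apply: contra tI; rewrite inE => ->; rewrite orbT.
  - by apply: contra tI; rewrite inE => ->.
  rewrite big_pred0 ?addr0 // => p; apply/negP => /and3P[/eqP E _ _].
  by move: tI; rewrite E !inE eqxx orbT.
move: tI; rewrite inE => /orP[] /itvP[p0 p0P tp].
  rewrite R0 ?mulr0 ?addr0; last first.
    rewrite tp mem_itv //; apply/negP => /andP[q'p _]; case/andP: p0P => _.
    by rewrite ltnNge (leq_trans qq').
  rewrite mulrDl; congr (_ + _); rewrite tp.
  rewrite (@sum_splits_left _ _ _ x_incr y a q q' b p0 qq' ll lr _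
    (fun I1 I2 => weight e * (subtree_sum y w I1
       * subtree_sum (x p0) (before_tail e) I2)) p0P) //.
  rewrite mulNr mulr_sumr mulr_suml -sumrN big_mkcond /=; apply: eq_bigr => c _.
  rewrite (flowmxE _ _ (esym tp)); case/andP: p0P => ap p0q; rewrite ap /=.
  case: (ltnP p0 c) => [pc|]; last by rewrite !(mul0r,mulr0) oppr0.
  case: (leqP c q) => /= [cq|qc]; last first.
    by rewrite unitri_lmx ?(ltnW qc) // -val_eqE /= gtn_eqF // !(mulr0, mul0r) oppr0.
  rewrite (IHw _ Gy1) //; last first.
    by move=> s /andP[cs sq]; rewrite ll // sq (leq_trans _ cs) // (leq_trans ap
      (ltnW pc)).
  have -> : weight e = - gsign e.
    by rewrite /weight hy -/t tp ll // ap.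
  by rewrite -/t tp; ring.
rewrite L0 ?mulr0 ?subr0; last first.
  rewrite tp mem_itv //; apply/negP => /andP[_ pq]; case/andP: p0P => q'p _.
  by move: pq; rewrite ltnNge (leq_trans qq').
rewrite mulrDr; congr (_ + _); rewrite tp.
rewrite (@sum_splits_right _ _ _ x_incr y a q q' b p0 qq' ll lr _
  (fun I1 I2 => weight e * (subtree_sum y w I1
     * subtree_sum (x p0) (before_tail e) I2)) p0P) //.
rewrite !mulr_sumr big_mkcond /=; apply: eq_bigr => c _.
rewrite (flowmxE _ _ (esym tp)); case/andP: p0P => q'p pb; rewrite pb andbT.
case: (leqP c p0) => [cp|]; last by rewrite andbF !(mul0r,mulr0).
rewrite andbT; case: (leqP q' c) => /= [q'c|cq']; last first.
  by rewrite unitri_rmx ?(ltnW cq') // -val_eqE /= gtn_eqF // !(mulr0, mul0r).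
rewrite (IHw _ Gy1) //; last first.
  move=> s /andP[q's sc]; rewrite lr // q's (leq_trans sc) //.
  by rewrite (leq_trans cp) // ltnW.
have yt : (y < t)%N by rewrite tp lr // q'p.
have -> : weight e = gsign e by rewrite /weight hy -/t ltnNge (ltnW yt).
by rewrite -/t tp; ring.
Qed.

End FlowMatrices.

(** * Comparison of the flow matrices of two Gauss diagrams *)

Section Transfer.
Variables (n r : nat) (x : 'I_r -> 'I_n).
Hypothesis x_incr : forall s t : 'I_r, (s < t)%N -> (x s < x t)%N.

(** Common form of [rmx] (z = 1) and of [lmx] (z = -1 on the reversed word), so that a single
    comparison serves both. *)
Definition pmx (G : gauss_diagram n) (z : int) (w : seq (arrow_end (garrow G))) :=
  \prod_(e <- w | ~~ e.2) letter x (z * gsign e.1) e.1.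
Arguments pmx : clear implicits.

Lemma rmxE (G : gauss_diagram n) (w : seq (arrow_end (garrow G))) :
  rmx x w = pmx G 1 w.
Proof. by apply: eq_bigr => e _; rewrite mul1r. Qed.

Lemma lmxE (G : gauss_diagram n) (w : seq (arrow_end (garrow G))) :
  lmx x w = pmx G (-1) (rev w).
Proof. by apply: eq_bigr => e _; rewrite mulN1r. Qed.

Lemma pmx_cat (G : gauss_diagram n) z (w w' : seq (arrow_end (garrow G))) :
  pmx G z (w ++ w') = pmx G z w * pmx G z w'.
Proof. exact: big_cat. Qed.

Lemma unitri_pmx (G : gauss_diagram n) z (w : seq (arrow_end (garrow G))) :
  unitri (pmx G z w).
Proof.
apply: big_rec => [|e M _]; first exact: unitri1.
by apply: unitriM; apply: unitri_letter.
Qed.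

Definition emap (G' G : gauss_diagram n) (g : garrow G' -> garrow G)
  (e : arrow_end (garrow G')) : arrow_end (garrow G) := (g e.1, e.2).

(* The heads through which trees with leaves on B flow. *)
Definition relevant (B : {set 'I_n}) (G : gauss_diagram n)
  (e : arrow_end (garrow G)) := ~~ e.2 && (tstr e.1 \in B).

(** Through [g] the strings in [B] read the same in both diagrams, up to the arrows of [D'] and [D].
    These predicates single out the arrow of a changed crossing, whose tail in [G'] and whose head
    in [G] are off [B]. *)
Variables (G' G : gauss_diagram n) (g : garrow G' -> garrow G) (B : {set 'I_n}).
Variables (D' : pred (garrow G')) (D : pred (garrow G)).
Hypothesis g_inj : injective g.
Hypothesis D'_out : forall a, D' a -> tstr a \notin B.
Hypothesis D_out : forall a, D a -> hstr a \notin B.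
Hypothesis strings : forall i, i \in B ->
  [seq emap g e | e <- gstring G' i & ~~ D' e.1]
  = [seq e <- gstring G i | ~~ D e.1].
Hypothesis signs : forall a, tstr a \in B -> hstr a \in B ->
  gsign a = gsign (g a).

Lemma tstr_transfer a : tstr a \in B -> tstr (g a) = tstr a.
Proof.
move=> aB; have : tail (g a) \in [seq e <- gstring G (tstr a) | ~~ D e.1].
  rewrite -strings // (map_f (emap g) (x := tail a)) // mem_filter mem_estr andbT.
  by apply/negP => /D'_out; rewrite aB.
by rewrite mem_filter mem_gstring => /andP[_ /eqP ->].
Qed.

Lemma tstr_transfer_mem a : ~~ D (g a) -> (tstr (g a) \in B) = (tstr a \in B).
Proof.
move=> nD; apply/idP/idP => [gB|aB]; last by rewrite tstr_transfer.
have : tail (g a) \in [seq e <- gstring G (tstr (g a)) | ~~ D e.1].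
  by rewrite mem_filter /= nD mem_estr.
rewrite -strings // => /mapP[[b c]]; rewrite mem_filter => /andP[_ +].
by move=> + [/g_inj Eb Ec]; rewrite -Eb -Ec mem_gstring => /eqP Ea;
  rewrite -/(tail a) /tstr -Ea.
Qed.

(** On the entries of [Q], whose intervals lie in [B], the letter of an arrow with tail off [B] acts
    as the identity. Once such letters are dropped, the two words correspond letter by letter. The
    factor [zeta] is a common change of signs, -1 along a reversed string. *)
Lemma pmx_transfer (Q : rel 'I_r.+1) z zeta (w' : seq (arrow_end (garrow G')))
    (w : seq (arrow_end (garrow G))) : hereditary Q ->
  (forall c b, Q c b -> itv x c b \subset B) ->
  (forall a, tstr a \in B -> agree Q (flowmx x a) (flowmx x (g a))) ->
  [seq emap g e | e <- w' & relevant B e] = [seq e <- w | relevant B e] ->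
  (forall a, head a \in w' -> tstr a \in B -> gsign a = zeta * gsign (g a)) ->
  agree Q (pmx G' z w') (pmx G (z * zeta) w).
Proof.
move=> hQ QB ag E sg.
have drop (G1 : gauss_diagram n) z1 (w1 : seq (arrow_end (garrow G1))) :
    agree Q (pmx G1 z1 w1) (pmx G1 z1 (seq.filter (@relevant B G1) w1)).
  elim: w1 => [|e w1 IH] /=; first by [].
  rewrite -cat1s pmx_cat; case: ifP => re.
    rewrite -[X in agree _ _ (pmx _ _ X)]cat1s pmx_cat.
    by apply: agreeM => //; apply: unitri_pmx.
  rewrite -[pmx G1 z1 (seq.filter _ _)]mul1r.
  apply: agreeM => //; rewrite ?unitri1 //; try exact: unitri_pmx; try exact: unitri1.
  move=> c b Qcb; rewrite /pmx big_cons big_nil mulr1.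
  case: ifP => // e2; rewrite /letter !mxE.
  move: re; rewrite /relevant e2 /= => /negbT tB.
  have := @flowmx_eq0 _ _ _ x_incr G1 e.1 c b; rewrite !mxE => -> //;
    first by rewrite mulr0 addr0.
  by apply: contra tB; apply: (fintype.subsetP (QB _ _ Qcb)).
move=> c b Qcb; rewrite (drop _ _ _ _ _ Qcb) (drop _ _ w _ _ Qcb) -E.
move: c b Qcb; rewrite -/(agree Q _ _).
have {}sg a : head a \in seq.filter (@relevant B G') w' -> gsign a = zeta * gsign (g a).
  by rewrite mem_filter /relevant /= => /andP[aB aw]; apply: sg.
have : all (@relevant B G') (seq.filter (@relevant B G') w') by apply: filter_all.
elim: (seq.filter _ w') sg => [_ _|e w1 IH sg] /=.
  by rewrite /pmx !big_nil.
move=> /andP[re rw1].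
rewrite -cat1s -[_ :: [seq _ | _ <- _]]cat1s !pmx_cat.
apply: agreeM => //; try exact: unitri_pmx; last first.
  by apply: IH => // a aw1; apply: sg; rewrite inE aw1 orbT.
case: e re sg => a [] //= aB sg c b Qcb.
rewrite /pmx !big_cons !big_nil /= !mulr1.
have := ag a aB c b Qcb; rewrite /letter !mxE => ->.
by rewrite sg ?mem_head // mulrA.
Qed.

Lemma relevant_map (w' : seq (arrow_end (garrow G'))) :
  {in w', forall e, ~~ D (g e.1)} ->
  [seq emap g e | e <- w' & relevant B e]
  = [seq e <- map (emap g) w' | relevant B e].
Proof.
move=> nD; rewrite filter_map; congr map; apply: eq_in_filter => e ew /=.
by rewrite /relevant /= tstr_transfer_mem ?nD.
Qed.

(** A string has no repeated end, so cutting it at the tail commutes with filtering. An arrow of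
    [D'] is not relevant, and one of [D] has no head on a string in [B], so the filter by [relevant]
    absorbs the other two. *)
Lemma before_tail_transfer a : tstr a \in B ->
  [seq emap g e | e <- before_tail a & relevant B e]
  = [seq e <- before_tail (g a) | relevant B e].
Proof.
move=> aB; have ga := tstr_transfer aB.
have [w1 E1] := before_tailE a; have [w2 E2] := before_tailE (g a).
have nD' : ~~ D' a by apply/negP => /D'_out; rewrite aB.
have := strings aB; rewrite E1 -ga E2 !filter_cat map_cat /= nD' /=.
have : tail (g a) \in [seq e <- gstring G (tstr a) | ~~ D e.1].
  by rewrite -strings // (map_f (emap g) (x := tail a)) // mem_filter mem_estr nD'.
rewrite mem_filter => /andP[/= -> _] E.
have {}E : [seq emap g e | e <- before_tail a & ~~ D' e.1] =
    [seq e <- before_tail (g a) | ~~ D e.1].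
  have u1 : uniq [seq e <- gstring G (tstr (g a)) | ~~ D e.1].
    exact: filter_uniq (gstring_uniq _ _).
  have notin (s1 s2 : seq (arrow_end (garrow G))) :
      s1 ++ tail (g a) :: s2 = [seq e <- gstring G (tstr (g a)) | ~~ D e.1] ->
      tail (g a) \notin s1.
    by move=> E3; move: u1; rewrite -E3 cat_uniq => /and3P[_ /norP[]].
  have nDg : ~~ D (g a).
    have : tail (g a) \in [seq e <- gstring G (tstr a) | ~~ D e.1].
      by rewrite -strings // (map_f (emap g) (x := tail a)) // mem_filter mem_estr nD'.
    by rewrite mem_filter => /andP[].
  have E3 : [seq e <- before_tail (g a) | ~~ D e.1] ++ tail (g a) ::
      [seq e <- w2 | ~~ D e.1] = [seq e <- gstring G (tstr (g a)) | ~~ D e.1].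
    by rewrite E2 filter_cat /= nDg.
  have n1 := notin _ _ E3; have n2 := notin _ _ (etrans E E3).
  exact: cat_cons_injl n2 n1 E.
have sub1 : {in before_tail a, forall e, relevant B e -> ~~ D' e.1}.
  by move=> e _ /andP[_ eB]; apply/negP => /D'_out; rewrite eB.
have -> : [seq e <- before_tail a | relevant B e] =
    [seq e <- [seq e <- before_tail a | ~~ D' e.1] | relevant B e].
  rewrite -filter_predI; apply: eq_in_filter => e /sub1 /=.
  by case: (relevant B e) => // ->.
have -> : [seq e <- before_tail (g a) | relevant B e] =
    [seq e <- [seq e <- before_tail (g a) | ~~ D e.1] | relevant B e].
  rewrite -filter_predI; apply: eq_in_filter => e ew /=.
  case: (boolP (relevant B e)) => //= /andP[e2 _]; apply/esym/negP => /D_out.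
  suff -> : hstr e.1 = tstr a by rewrite aB.
  have : e \in gstring G (tstr (g a)) by rewrite E2 mem_cat ew.
  rewrite mem_gstring ga /hstr => /eqP ->.
  by case: e e2 {ew} => b [].
rewrite -E; apply: relevant_map => e ew.
have : emap g e \in [seq emap g e | e <- before_tail a & ~~ D' e.1] by rewrite map_f.
by rewrite E mem_filter => /andP[].
Qed.

(** Induction on the length of the interval of leaves: without the leaf of the tail's string, the
    trees on [before_tail] use two strictly shorter intervals. The strings themselves offer no
    induction, as they may point at each other cyclically. *)
Lemma flowmx_transfer (Q : rel 'I_r.+1) a : hereditary Q ->
  (forall c b, Q c b -> itv x c b \subset B) -> tstr a \in B ->
  agree Q (flowmx x a) (flowmx x (g a)).
Proof.
move=> hQ QB; suff ind N b : tstr b \in B ->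
    agree [rel c1 c2 : 'I_r.+1 | Q c1 c2 && (c2 - c1 <= N)%N]
      (flowmx x b) (flowmx x (g b)).
  by move=> aB c b Qcb; apply: (ind r a aB); rewrite /= Qcb; have := ltn_ord b; lia.
elim: N b => [|N IHN] b bB c1 c2 /= /andP[Qc dc].
  by rewrite !flowmx_strict // -subn_eq0 -leqn0.
have gb := tstr_transfer bB.
case: (boolP [exists p, x p == tstr b]) => [/existsP[p /eqP xp]|]; last first.
  by rewrite negb_exists => /forallP xb; rewrite !flowmx_off // gb.
rewrite (flowmxE x_incr c1 c2 xp) (flowmxE x_incr c1 c2 (a := g b) (p := p)) ?gb //.
case: ifP => // /andP[c1p pc2].
have split : itv x c1 c2 :\ tstr b = itv x c1 p :|: itv x p.+1 c2.
  apply/setP => u; rewrite -xp !inE; apply/andP/orP.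
    case=> + /itvP[s /andP[cs sc] us]; rewrite us (inj_eq (x_inj x_incr)) -val_eqE /=.
    by rewrite neq_ltn !mem_itv // => /orP[] h; [left|right]; apply/andP.
  case=> /itvP[s /andP[cs sc] ->]; rewrite mem_itv // (inj_eq (x_inj x_incr)).
    by rewrite -val_eqE /= ltn_eqF // cs (ltn_trans sc).
  by rewrite -val_eqE /= gtn_eqF // sc (leq_trans c1p (ltnW cs)).
have pr := ltn_ord p.
pose p0 : 'I_r.+1 := widen_ord (leqnSn r) p; pose p1 : 'I_r.+1 := lift ord0 p.
have p1E : p.+1 = p1 :> nat by rewrite /= /bump.
have [w1 E1] := before_tailE b; have [w2 E2] := before_tailE (g b).
rewrite split p1E -[X in itv x c1 X]/(nat_of_ord p0); rewrite gb in E2.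
have cp0 : (c1 <= p0)%N by [].
have lt1 (s : 'I_r) : (c1 <= s < p0)%N -> (x s < tstr b)%N.
  by move=> /andP[_ sp]; rewrite -xp x_lt.
have lt2 (s : 'I_r) : (p1 <= s < c2)%N -> (tstr b < x s)%N.
  by rewrite -p1E => /andP[sp _]; rewrite -xp x_lt.
have p01 : (p0 <= p1)%N by rewrite -p1E /=.
have p1c : (p1 <= c2)%N by rewrite -p1E.
rewrite (subtree_sumE x_incr E1 cp0 p01 p1c lt1 lt2).
rewrite (subtree_sumE x_incr E2 cp0 p01 p1c lt1 lt2) !lmxE !rmxE.
set Q' := [rel c1 c2 : 'I_r.+1 | Q c1 c2 && (c2 - c1 <= N)%N].
have hQ' : hereditary Q'.
  move=> c c' d d' /= /andP[Qcc' cc] h1 h2 h3; rewrite (hQ _ _ _ _ Qcc') //=.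
  by lia.
have QB' c c' : Q' c c' -> itv x c c' \subset B by case/andP => /QB.
have sg e : head e \in before_tail b -> tstr e \in B -> gsign e = 1 * gsign (g e).
  move=> eb eB; rewrite mul1r signs //.
  have : head e \in gstring G' (tstr b) by rewrite E1 mem_cat eb.
  by rewrite mem_gstring /hstr => /eqP <-.
have E3 := before_tail_transfer bB.
congr (_ * _).
  have := @pmx_transfer Q' (-1) 1 (rev (before_tail b)) (rev (before_tail (g b)))
    hQ' QB' IHN.
  rewrite mulr1; apply.
  - by rewrite !filter_rev map_rev E3.
  - by move=> e; rewrite mem_rev; apply: sg.
  - by rewrite /= (hQ _ _ _ _ Qc) //=; [lia | exact: ltnW].
have := @pmx_transfer Q' 1 1 (before_tail b) (before_tail (g b)) hQ' QB' IHN.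
rewrite mulr1; apply => //.
have cp1 : (c1 <= p1)%N by apply: leq_trans p01.
by apply/andP; split; [apply: (hQ _ _ _ _ Qc) | lia].
Qed.

Lemma pmx_map (Q : rel 'I_r.+1) z zeta (w' : seq (arrow_end (garrow G'))) :
  hereditary Q -> (forall c b, Q c b -> itv x c b \subset B) ->
  {in w', forall e, ~~ D (g e.1)} ->
  (forall a, head a \in w' -> tstr a \in B -> gsign a = zeta * gsign (g a)) ->
  agree Q (pmx G' z w') (pmx G (z * zeta) (map (emap g) w')).
Proof.
move=> hQ QB nD sg; apply: (pmx_transfer z hQ QB) => //.
  by move=> a aB; apply: flowmx_transfer.
exact: relevant_map.
Qed.

End Transfer.
Arguments pmx {n r} x {G} z w.

(** * Skein relations for Gauss diagrams *)

(* The four Gauss diagrams of a skein quadruple, as seen from the diagram G in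
   which the crossing d of the strings j and k has its tail on k. *)
Record skein_gauss (n : nat) (j k : 'I_n) (G Gb G0 Gi : gauss_diagram n)
    (d : garrow G) (db : garrow Gb) (P Q U V : seq (arrow_end (garrow G)))
    (Pb Qb Ub Vb : seq (arrow_end (garrow Gb)))
    (gb : garrow Gb -> garrow G) (g0 : garrow G0 -> garrow G)
    (gi : garrow Gi -> garrow G) : Prop := SkeinGauss {
  sg_j : gstring G j = P ++ head d :: Q;
  sg_k : gstring G k = U ++ tail d :: V;
  sg_b_inj : injective gb;
  sg_b_d : gb db = d;
  sg_b_j : gstring Gb j = Pb ++ tail db :: Qb;
  sg_b_k : gstring Gb k = Ub ++ head db :: Vb;
  sg_b_maps : [/\ map (emap gb) Pb = P, map (emap gb) Qb = Q,
                  map (emap gb) Ub = U & map (emap gb) Vb = V];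
  sg_b_others : forall i, i != j -> i != k ->
    map (emap gb) (gstring Gb i) = gstring G i;
  sg_b_sign : forall a, a != db -> gsign a = gsign (gb a);
  sg_0_inj : injective g0;
  sg_0_k : map (emap g0) (gstring G0 k) = U ++ Q;
  sg_0_others : forall i, i != j -> i != k ->
    map (emap g0) (gstring G0 i) = gstring G i;
  sg_0_sign : forall a, gsign a = gsign (g0 a);
  sg_i_inj : injective gi;
  sg_i_j : map (emap gi) (gstring Gi j) = P ++ rev U;
  sg_i_others : forall i, i != j -> i != k ->
    map (emap gi) (gstring Gi i) = gstring G i;
  sg_i_sign : forall a, tstr a != j -> tstr a != k ->
    gsign a = if hstr (gi a) == k then - gsign (gi a) else gsign (gi a) }.

Section SkeinRelations.
Variables (n r : nat) (x : 'I_r -> 'I_n).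
Hypothesis x_incr : forall s t : 'I_r, (s < t)%N -> (x s < x t)%N.
Variables (j : 'I_n) (k : 'I_r).
Hypothesis j_lt : forall s, (j < x s)%N.
Variables (G Gb G0 Gi : gauss_diagram n) (d : garrow G) (db : garrow Gb).
Variables P Q U V : seq (arrow_end (garrow G)).
Variables Pb Qb Ub Vb : seq (arrow_end (garrow Gb)).
Variables (gb : garrow Gb -> garrow G) (g0 : garrow G0 -> garrow G).
Variable gi : garrow Gi -> garrow G.
Hypothesis sg : skein_gauss j (x k) d db P Q U V Pb Qb Ub Vb gb g0 gi.

(** [k0] and [k1] are the cuts before and after the leaf [x k]. A tree with leaves in an interval
    satisfying [avoid] has no branch along [x k], and no tree has one along [j]; on such entries the
    recombination of these two strings is invisible in the branches. *)
Let k0 : 'I_r.+1 := widen_ord (leqnSn r) k.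
Let k1 : 'I_r.+1 := lift ord0 k.
Let avoid : rel 'I_r.+1 := [rel c b : 'I_r.+1 | ~~ (c <= k < b)%N].
Let X : {set 'I_n} := itv x 0 r.

Let avoid_hereditary : hereditary avoid.
Proof. by move=> c b c' b'; rewrite /avoid /=; lia. Qed.

Let itvX (c b : 'I_r.+1) : itv x c b \subset X.
Proof.
apply/fintype.subsetP => u /itvP[s /andP[_ sb] ->].
by rewrite mem_itv //= (leq_trans sb) // -ltnS.
Qed.

Let itvXk (c b : 'I_r.+1) : avoid c b -> itv x c b \subset X :\ x k.
Proof.
rewrite /avoid /= => ckb; apply/fintype.subsetP => u uI.
rewrite !inE (fintype.subsetP (itvX c b)) // andbT.
by apply: contra ckb => /eqP uk; rewrite uk mem_itv in uI.
Qed.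

Let notX : j \notin X.
Proof. by apply/itvP => -[s _ E]; have := j_lt s; rewrite -E ltnn. Qed.

Let Xj i : i \in X -> i != j.
Proof. by move=> iX; apply: contraNneq notX => <-. Qed.

Let xkj : x k != j.
Proof. by rewrite neq_ltn j_lt orbT. Qed.

Let tstr_d : tstr d = x k.
Proof. by have [] := before_tail_cat (sg_k sg). Qed.

Let before_d : before_tail d = U.
Proof. by have [] := before_tail_cat (sg_k sg). Qed.

Let hstr_d : hstr d = j.
Proof.
have : head d \in gstring G j by rewrite (sg_j sg) mem_cat mem_head orbT.
by rewrite mem_gstring => /eqP.
Qed.

Let tstr_db : tstr db = j.
Proof. by have [] := before_tail_cat (sg_b_j sg). Qed.

(** The trunk [j] precedes all the leaves, so the left interval is empty and [lmx] contributes only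
    a diagonal entry. *)
Let trunk_sum (H : gauss_diagram n) (m : 'I_r.+1) :
  subtree_sum j (gstring H j) (itv x 0 m) = rmx x (gstring H j) ord0 m.
Proof.
have Gj : gstring H j = gstring H j ++ [::] by rewrite cats0.
rewrite -[itv x 0 m]finset.set0U -{1}(itv_empty x (leqnn 0)).
rewrite (subtree_sumE x_incr (a := ord0) (q := ord0) (q' := ord0) Gj) //.
by rewrite unitri_lmx // eqxx mul1r.
Qed.

(** Here [x k] is the trunk and sits in the gap between the cuts [k0] and [k1]. *)
Let branch_sum (m : 'I_r.+1) : (m <= k)%N ->
  subtree_sum (x k) (gstring G0 (x k)) (itv x m k :|: itv x k.+1 r) =
  lmx x (gstring G0 (x k)) m k0 * rmx x (gstring G0 (x k)) k1 ord_max.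
Proof.
move=> mk; have G0k : gstring G0 (x k) = gstring G0 (x k) ++ [::] by rewrite cats0.
have k1E : k.+1 = k1 by rewrite /= /bump.
rewrite k1E; apply: (subtree_sumE x_incr (q := k0) (b := ord_max) G0k) => //=.
- by move=> s /andP[_ sk]; rewrite x_lt.
- by move=> s /andP[ks _]; rewrite x_lt.
Qed.

(* In Gb the arrow at the crossing d leaves the string j: it carries nothing. *)
Let rmx_b (c b : 'I_r.+1) : rmx x (gstring Gb j) c b = (rmx x P * rmx x Q) c b.
Proof.
have [mP mQ mU mV] := sg_b_maps sg.
(* The arrow [db] has its tail on [j] and [d] its head there; both can be set aside on the strings
   in [X], which [j] is not. *)
have D'_out a : pred1 db a -> tstr a \notin X by move=> /eqP ->; rewrite tstr_db.
have D_out a : pred1 d a -> hstr a \notin X by move=> /eqP ->; rewrite hstr_d.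
have filt w : [seq emap gb e | e <- w & ~~ pred1 db e.1] =
    [seq e <- map (emap gb) w | ~~ pred1 d e.1].
  rewrite filter_map; congr map; apply: eq_filter => e /=.
  by rewrite -(sg_b_d sg) (inj_eq (sg_b_inj sg)).
have strs i : i \in X -> [seq emap gb e | e <- gstring Gb i & ~~ pred1 db e.1]
    = [seq e <- gstring G i | ~~ pred1 d e.1].
  move=> iX; rewrite filt; case: (eqVneq i (x k)) => [->|ik].
    rewrite (sg_b_k sg) (sg_k sg) map_cat /= mU mV !filter_cat /=.
    by rewrite (sg_b_d sg) eqxx.
  by rewrite (sg_b_others sg) // Xj.
have sgn a : tstr a \in X -> hstr a \in X -> gsign a = gsign (gb a).
  by move=> aX _; apply: (sg_b_sign sg); apply: contraNneq notX => E;
    rewrite -tstr_db -E.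
have nd e : e \in gstring Gb j -> e \notin [:: tail db] -> ~~ pred1 d (gb e.1).
  rewrite mem_seq1 /= -(sg_b_d sg) (inj_eq (sg_b_inj sg)) => ej.
  apply: contraNneq; case: e ej => a [] /= + E; rewrite {}E //.
  move=> hj; have : head db \in gstring Gb (x k).
    by rewrite (sg_b_k sg) mem_cat mem_head orbT.
  rewrite !mem_gstring in hj * => /eqP E.
  by case/eqP: xkj; rewrite E (eqP hj).
have uj := gstring_uniq Gb j; rewrite (sg_b_j sg) in uj nd.
have part w : {subset w <= Pb ++ tail db :: Qb} -> tail db \notin w ->
    agree [rel c b | true] (pmx x 1 w) (pmx x 1 (map (emap gb) w)).
  move=> sw nw; rewrite -[X in pmx x X (map _ _)](mulr1 1).
  apply: (pmx_map x_incr (sg_b_inj sg) D'_out D_out strs sgn) => //.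
    move=> e ew; apply: nd; first exact: sw.
    by rewrite mem_seq1; apply: contraNneq nw => <-.
  move=> a _ aX; rewrite mul1r; apply: (sg_b_sign sg).
  by apply: contraNneq notX => E; rewrite -tstr_db -E.
rewrite (sg_b_j sg) !rmxE -cat1s !pmx_cat [pmx x 1 [:: _]]big_cons big_nil /= mul1r.
move: c b (isT : [rel c b : 'I_r.+1 | true] c b); rewrite -/(agree _ _ _) -mP -mQ.
move: uj; rewrite cat_uniq /= negb_or => /and4P[_ /andP[nP _] nQ _].
apply: agreeM; rewrite ?unitri_pmx //; try exact: unitri_pmx.
  by apply: part => // e eP; rewrite mem_cat eP.
by apply: part => // e eQ; rewrite mem_cat inE eQ !orbT.
Qed.

Let trunk_j : rmx x (gstring G j) =
  rmx x P * rmx x Q + gsign d *: (rmx x P * flowmx x d * rmx x Q).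
Proof.
rewrite (sg_j sg) -cat1s !rmx_cat rmx1 /= /letter mulrA mulrDr mulr1 mulrDl.
by rewrite -scalerAr -scalerAl.
Qed.

Let trunk_jE c b : rmx x (gstring G j) c b = (rmx x P * rmx x Q) c b +
  gsign d * (rmx x P * flowmx x d * rmx x Q) c b.
Proof. by rewrite trunk_j !mxE. Qed.

(** A column times a row, hence of rank at most one: the trees along [d] have the trunk [U] and
    split at the leaf [x k]. Unless c <= k < b both sides vanish, [lmx] and [rmx] being
    unitriangular. *)
Let flow_d : flowmx x d = col k0 (lmx x U) *m row k1 (rmx x U).
Proof.
apply/matrixP => c b; rewrite (flowmxE x_incr c b (esym tstr_d)) mxE big_ord1 !mxE.
have k1E : k.+1 = k1 by rewrite /= /bump.
case: (leqP c k) => [ck|kc] /=; last first.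
  rewrite unitri_lmx //; last exact: ltnW.
  by rewrite -val_eqE /= gtn_eqF // mul0r.
case: (ltnP k b) => [kb|bk] /=; last first.
  rewrite unitri_rmx //; last by rewrite -k1E; apply: leq_trans bk _.
  case: eqP => [E|_]; last by rewrite mulr0.
  by move: bk; rewrite -E -k1E ltnn.
rewrite before_d tstr_d.
have -> : itv x c b :\ x k = itv x c k0 :|: itv x k1 b.
  rewrite -k1E; apply/setP => u; rewrite !inE; apply/andP/orP.
    case=> + /itvP[s /andP[cs sb] us]; rewrite us (inj_eq (x_inj x_incr)) -val_eqE /=.
    by rewrite neq_ltn !mem_itv // => /orP[] h; [left|right]; apply/andP.
  case=> /itvP[s /andP[cs sb] ->]; rewrite mem_itv // (inj_eq (x_inj x_incr)).
    by rewrite -val_eqE /= ltn_eqF // cs (ltn_trans sb).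
  by rewrite -val_eqE /= gtn_eqF // sb (leq_trans ck (ltnW cs)).
apply: (subtree_sumE x_incr (sg_k sg)); rewrite -?k1E //=.
- by move=> s /andP[_ sk]; rewrite x_lt.
- by move=> s /andP[ks _]; rewrite x_lt.
Qed.

(** Multiplying a column times a row on both sides factors each entry into two numbers, one for each
    tree of the product formula. *)
Let flow_product : (rmx x P * flowmx x d * rmx x Q) ord0 ord_max =
  (rmx x P * lmx x U) ord0 k0 * (rmx x U * rmx x Q) k1 ord_max.
Proof.
rewrite flow_d -!mulmxE mulmxA -mulmxA mxE big_ord1.
by congr (_ * _); rewrite !mxE; apply: eq_bigr => e _; rewrite !mxE.
Qed.

(* Below k the arrow d carries nothing. *)
Let trunk_j_avoid c b : avoid c b ->
  rmx x (gstring G j) c b = (rmx x P * rmx x Q) c b.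
Proof.
rewrite (sg_j sg) -cat1s !rmx_cat mulrA => cb; move: c b cb; rewrite -/(agree _ _ _).
apply: agreeM; rewrite ?unitri_rmx //; try exact: unitri_rmx.
  by apply: unitriM; exact: unitri_rmx.
rewrite -[X in agree _ _ X]mulr1; apply: agreeM; rewrite ?unitri_rmx //;
  try exact: unitri_rmx; try exact: unitri1.
move=> c b; rewrite /avoid /= => cb.
rewrite rmx1 /= /letter !mxE.
have := flowmxE x_incr c b (esym tstr_d); rewrite !mxE (negPf cb) => ->.
by rewrite mulr0 addr0.
Qed.

(** Off [j] and [x k] the diagrams have the same strings, so the comparison applies with [B] equal
    to [X :\ x k] and no arrow set aside. *)
Let others_transfer (H : gauss_diagram n) (h : garrow H -> garrow G) z zeta w' :
  injective h ->
  (forall i, i != j -> i != x k -> map (emap h) (gstring H i) = gstring G i) ->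
  (forall a, tstr a \in X :\ x k -> hstr a \in X :\ x k -> gsign a = gsign (h a)) ->
  (forall a, head a \in w' -> tstr a \in X :\ x k ->
     gsign a = zeta * gsign (h a)) ->
  agree avoid (pmx x z w') (pmx x (z * zeta) (map (emap h) w')).
Proof.
move=> h_inj oth sgn sgw.
apply: (@pmx_map _ _ _ x_incr _ _ _ (X :\ x k) pred0 pred0) => //.
move=> i; rewrite !inE => /andP[ik iX].
rewrite !(eq_filter (a2 := predT)) // !filter_predT oth // Xj //.
Qed.

Let rmx_0 : agree avoid (rmx x (gstring G0 (x k))) (rmx x U * rmx x Q).
Proof.
rewrite -rmx_cat -(sg_0_k sg) !rmxE -[X in agree _ _ (pmx _ X _)](mulr1 1).
apply: (others_transfer _ (sg_0_inj sg) (sg_0_others sg)).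
- by move=> a _ _; apply: (sg_0_sign sg).
- by move=> a _ _; rewrite mul1r; apply: (sg_0_sign sg).
Qed.

Let lmx_0 : agree avoid (lmx x (gstring G0 (x k))) (lmx x Q * lmx x U).
Proof.
rewrite -lmx_cat -(sg_0_k sg) !lmxE -map_rev -[X in agree _ _ (pmx _ X _)](mulr1 (-1)).
apply: (others_transfer _ (sg_0_inj sg) (sg_0_others sg)).
- by move=> a _ _; apply: (sg_0_sign sg).
- by move=> a _ _; rewrite mul1r; apply: (sg_0_sign sg).
Qed.

(** Reading [U] backwards reverses the order of the letters, and reversing a string changes the sign
    of its crossings with unreversed strings; together these turn the part [rev U] of the trunk into
    [lmx x U]. The relevant tails are on strings other than [j] and [x k], hence unreversed. *)
Let rmx_i : agree avoid (rmx x (gstring Gi j)) (rmx x P * lmx x U).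
Proof.
have tX a : tstr a \in X :\ x k -> tstr a != j /\ tstr a != x k.
  by rewrite !inE => /andP[ak /Xj].
have Ei := sg_i_j sg.
(* The word of [Gi] is cut at the smoothed crossing, into what comes from [P] and what comes from
   [rev U]. *)
have := cat_take_drop (size P) (gstring Gi j).
move: Ei; set P' := take _ _; set U' := drop _ _ => Ei EPU.
have [EP EU] : map (emap gi) P' = P /\ map (emap gi) U' = rev U.
  by rewrite /P' /U' map_take map_drop Ei take_size_cat // drop_size_cat.
have sgn a : tstr a \in X :\ x k -> hstr (gi a) != x k -> gsign a = gsign (gi a).
  move=> /tX[aj ak] /negPf hk; by rewrite (sg_i_sign sg) // hk.
have hP a i : head a \in gstring G i -> hstr a = i.
  by rewrite mem_gstring => /eqP.
have oth a : tstr a \in X :\ x k -> hstr a \in X :\ x k -> gsign a = gsign (gi a).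
  move=> aX; rewrite !inE => /andP[hk hX]; apply: sgn => //.
  suff /hP -> : head (gi a) \in gstring G (hstr a) by [].
  rewrite -(sg_i_others sg) //; last exact: Xj.
  by apply/mapP; exists (head a); rewrite // mem_estr.
have aux z zeta w' := others_transfer z (zeta := zeta) (w' := w') (sg_i_inj sg)
  (sg_i_others sg) oth.
rewrite !rmxE lmxE -EPU pmx_cat -EP -EU.
apply: agreeM => //; try exact: unitri_pmx.
  rewrite -[X in agree _ _ (pmx _ X _)](mulr1 1); apply: aux => a aP aX.
  rewrite mul1r; apply: sgn => //.
  suff /hP -> : head (gi a) \in gstring G j by rewrite eq_sym.
  rewrite (sg_j sg) mem_cat -EP; apply/orP; left.
  by apply/mapP; exists (head a).
rewrite -[X in agree _ _ (pmx _ X _)]mul1r; apply: aux => a aU aX.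
have [aj ak] := tX _ _ aX; rewrite (sg_i_sign sg) // mulN1r.
suff /hP -> : head (gi a) \in gstring G (x k) by rewrite eqxx.
rewrite (sg_k sg) mem_cat -mem_rev -EU; apply/orP; left.
by apply/mapP; exists (head a).
Qed.

Let avoid_low (c b : 'I_r.+1) : (b <= k)%N -> avoid c b.
Proof. by rewrite /avoid /=; lia. Qed.

Let avoid_high (c b : 'I_r.+1) : (k < c)%N -> avoid c b.
Proof. by rewrite /avoid /=; lia. Qed.

Let k1_gt : (k < k1)%N.
Proof. by []. Qed.

(** The terms without [d] cancel and [flow_product] evaluates the rest. Its entries (0, k) and (k +
    1, r) avoid the leaf [x k], so they can be read off in [Gi] and [G0]; the interval [k, k)
    contributes a diagonal entry. *)
Lemma skein_difference :
  subtree_sum j (gstring G j) (itv x 0 r) - subtree_sum j (gstring Gb j) (itv x 0 r) =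
  gsign d * (subtree_sum j (gstring Gi j) (itv x 0 k) *
    subtree_sum (x k) (gstring G0 (x k)) (itv x k k :|: itv x k.+1 r)).
Proof.
rewrite (trunk_sum G ord_max) (trunk_sum Gb ord_max) (trunk_sum Gi k0).
rewrite (branch_sum (m := k0)) // unitri_lmx // eqxx mul1r.
rewrite rmx_b trunk_jE addrAC subrr add0r flow_product.
by rewrite (rmx_i (avoid_low _ _)) // (rmx_0 (avoid_high _ k1_gt)).
Qed.

Lemma skein_low (m : nat) : (m <= k)%N ->
  subtree_sum j (gstring G j) (itv x 0 m) = subtree_sum j (gstring Gb j) (itv x 0 m).
Proof.
move=> mk; have mr : (m < r.+1)%N by rewrite ltnS (leq_trans mk) // ltnW.
rewrite (trunk_sum G (Ordinal mr)) (trunk_sum Gb (Ordinal mr)) rmx_b.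
by rewrite trunk_j_avoid // avoid_low.
Qed.

Lemma skein_sum :
  subtree_sum j (gstring G j) (itv x 0 r) - subtree_sum j (gstring Gb j) (itv x 0 r) =
  gsign d * \sum_(m : 'I_r | (m <= k)%N)
    subtree_sum j (gstring G j) (itv x 0 m) *
    subtree_sum (x k) (gstring G0 (x k)) (itv x m k :|: itv x k.+1 r).
Proof.
rewrite (trunk_sum G ord_max) (trunk_sum Gb ord_max).
rewrite rmx_b trunk_jE addrAC subrr add0r flow_product; congr (_ * _).
transitivity (\sum_(m < r.+1 | (m <= k)%N)
    (rmx x P * rmx x Q) ord0 m * (lmx x Q * lmx x U) m k0 *
    (rmx x U * rmx x Q) k1 ord_max); last first.
  (* The last cut is r > k; dropping it turns a sum over cuts into a sum over indices of leaves. *)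
  rewrite [LHS]big_mkcond big_ord_recr /= leqNgt ltn_ord addr0 [RHS]big_mkcond.
  apply: eq_bigr => m _ /=; case: ifP => // mk.
  rewrite (trunk_sum G (widen_ord (leqnSn r) m)).
  rewrite (branch_sum (m := widen_ord (leqnSn r) m)) //.
  rewrite (rmx_0 (avoid_high _ k1_gt)) (lmx_0 (avoid_low _ _)) //.
  by rewrite trunk_j_avoid ?avoid_low // mulrA.
rewrite -mulr_suml; congr (_ * _).
(* Inserting the product of [rmx x Q] and its inverse completes the left factor to the trunk [j]
   without [d], and the right one to [lmx] of the word [U ++ Q] of [x k] in [G0]. *)
have -> : rmx x P * lmx x U = (rmx x P * rmx x Q) * (lmx x Q * lmx x U).
  by rewrite -mulrA (mulrA (rmx x Q)) (rmxK x_incr) mul1r.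
have mulE (A B : 'M[int]_r.+1) c b : (A * B) c b = \sum_e A c e * B e b.
  by rewrite -mulmxE mxE.
rewrite [LHS]mulE [RHS]big_mkcond; apply: eq_bigr => m _ /=.
(* Cuts beyond [k] meet the zero part of a unitriangular matrix. *)
case: leqP => // km.
have uL : unitri (lmx x Q * lmx x U) by apply: unitriM; exact: unitri_lmx.
by rewrite uL ?(ltnW km) // -val_eqE /= gtn_eqF // mulr0.
Qed.

End SkeinRelations.

(** * Tree sums as sums over sets of arrows *)

Section MoreSubtrees.
Variables (n : nat) (G : gauss_diagram n).

(** Tails in a tree are on distinct strings, so a loop at [a] would make the singleton of its string
    closed under following arrows, against [subtree_acyclic]. *)
Lemma subtree_no_loop y w w' I S (a : garrow G) : gstring G y = w ++ w' ->
  subtree y w I S -> a \in S -> tstr a != hstr a.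
Proof.
move=> Gy h aS; have aI := subtree_tstr h aS; apply/eqP => loop.
have /setP/(_ (tstr a)) : [set tstr a] = set0; last by rewrite !inE eqxx.
apply: (subtree_acyclic h); last by exists w'.
- by rewrite finset.sub1set.
- move=> b bS; rewrite !inE => /eqP E.
  by rewrite (subtree_tstr_inj h bS aS E) loop.
- by rewrite !inE; apply: contraNneq (subtree_notin h) => ->.
Qed.

(** If [a] is the arrow along which a branch joins and [b] ends on the trunk of that branch, the
    claim holds because this trunk stops at the tail of [a]. The other cases are inductive or
    excluded by disjointness. *)
Lemma subtree_order y w w' I S (a b : garrow G) : gstring G y = w ++ w' ->
  subtree y w I S -> a \in S -> b \in S -> hstr b = tstr a ->
  head b \in before_tail a.
Proof.
move=> + h; elim: h a b w' => {y w I S}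
  [y|y w e I S _ IH|y w c I1 S1 I2 S2 I S h1 IH1 h2 IH2 ap EI ES] a b w' Gy.
- by rewrite inE.
- by apply: (IH _ _ (e :: w')); rewrite -cat_rcons.
have h : subtree y (rcons w (head c)) I S by apply: subtree_join h1 h2 ap EI ES.
have Gy1 : gstring G y = w ++ head c :: w' by rewrite -cat_rcons.
have hc : hstr c = y.
  have : head c \in gstring G y by rewrite Gy1 mem_cat mem_head orbT.
  by rewrite mem_gstring => /eqP.
have [w2 Gt] := before_tailE c.
have /pred0P dis := apart_disj ap.
have disj u : u \in y |: I1 -> u \in tstr c |: I2 -> False.
  by move=> u1 u2; have := dis u; rewrite /= u1 u2.
move=> aS bS E; have aI := subtree_tstr h aS.
have ay : tstr a != y by apply: contraNneq (subtree_notin h) => <-.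
move: (bS); rewrite ES !inE => /or3P[/eqP Eb|b1|b2].
- by move: ay; rewrite -E Eb hc eqxx.
- have := subtree_hstr Gy1 h1 b1; rewrite E !inE (negPf ay) /= => a1.
  move: (aS); rewrite ES !inE => /or3P[/eqP Ea|aS1|/(subtree_tstr h2) a2].
  + by case: (disj (tstr a)); rewrite Ea !inE ?eqxx // -Ea a1 orbT.
  + exact: (IH1 _ _ (head c :: w')).
  + by case: (disj (tstr a)); rewrite !inE ?a1 ?a2 orbT.
- have := subtree_hstr Gt h2 b2; rewrite E !inE => /predU1P[Ea|a2].
    have -> : a = c by apply: (subtree_tstr_inj h) => //; rewrite ES !inE eqxx.
    case: (subtree_head h2 b2) => //.
    by rewrite E Ea (negPf (subtree_notin h2)).
  move: (aS); rewrite ES !inE => /or3P[/eqP Ea|/(subtree_tstr h1) a1|aS2].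
  + by move: a2; rewrite Ea (negPf (subtree_notin h2)).
  + by case: (disj (tstr a)); rewrite !inE ?a1 ?a2 orbT.
  + exact: (IH2 _ _ (tail c :: w2)).
Qed.

End MoreSubtrees.

Lemma drawn_leaves n (T : rooted_tree n) s : drawn T s -> perm_eq s (leaves T).
Proof.
elim=> {T s} //= [T1 T2 s1 s2 _ p1 _ p2|T1 T2 s1 s2 _ p1 _ p2]; first exact: perm_cat.
by rewrite perm_catC; apply: perm_cat.
Qed.

Lemma drawn_node n (T1 T2 : rooted_tree n) s : drawn (Node T1 T2) s ->
  exists s1 s2, [/\ drawn T1 s1, drawn T2 s2 & s = s1 ++ s2 \/ s = s2 ++ s1].
Proof.
move E: (Node T1 T2) => T H; case: H E => // T3 T4 s1 s2 d1 d2 [-> ->];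
  by exists s1, s2; split; auto.
Qed.

Lemma sorted_ord_cat n (s1 s2 : seq 'I_n) :
  sorted (fun u v : 'I_n => (u < v)%N) (s1 ++ s2) =
  [&& allrel (fun u v : 'I_n => (u < v)%N) s1 s2,
      sorted (fun u v : 'I_n => (u < v)%N) s1
    & sorted (fun u v : 'I_n => (u < v)%N) s2].
Proof.
have tr : transitive (fun u v : 'I_n => (u < v)%N) by move=> v u w; apply: ltn_trans.
by rewrite !(sorted_pairwise tr) pairwise_cat.
Qed.

Lemma filter_eq_rcons (T : eqType) (p : pred T) w s e : seq.filter p w = rcons s e ->
  exists w1 w2, [/\ w = w1 ++ e :: w2, seq.filter p w1 = s & seq.filter p w2 = [::]].
Proof.
elim/last_ind: w => [|w e0 IH]; first by case: s.
rewrite filter_rcons; case: ifP => pe0; last first.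
  move=> /IH[w1 [w2 [-> E1 E2]]]; exists w1, (rcons w2 e0).
  by rewrite rcons_cat filter_rcons pe0 E1 E2.
by case/rcons_inj => <- <-; exists w, [::]; rewrite cats1.
Qed.

Lemma uniq_map_inj (T U : eqType) (f : T -> U) s :
  uniq (map f s) -> {in s &, injective f}.
Proof.
elim: s => //= z s IH /andP[nz us] u v; rewrite !inE.
case/predU1P=> [->|us'] /predU1P[->|vs] // E; last exact: IH.
- by case/mapP: nz; exists v.
- by case/mapP: nz; exists u.
Qed.

Lemma map_flatten_filter (T U : eqType) (I : Type) (f : T -> U) (p : pred U)
    (w : I -> seq T) (w' : I -> seq U) l :
  (forall i, map f (w i) = seq.filter p (w' i)) ->
  map f (flatten (map w l)) = seq.filter p (flatten (map w' l)).
Proof.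
move=> E; elim: l => //= i l IH.
by rewrite map_cat filter_cat E IH.
Qed.

(** * Embedded arrow diagrams and their images *)

Section Embeddings.
Variables (n m : nat) (A : arrow_diagram n m) (G : gauss_diagram n).
Variable phi : {ffun 'I_m -> garrow G}.
Hypothesis emb : embedding A phi.

Let S := [set phi a | a : 'I_m].
Let fe (e : arrow_end 'I_m) : arrow_end (garrow G) := (phi e.1, e.2).

Lemma diagram_ends : perm_eq (all_ends (astring A)) (enum {: ('I_m * bool)%type}).
Proof. by have /andP[] := valP A. Qed.

Lemma diagram_numbering : [seq e.1 | e <- all_ends (astring A) & e.2] = enum 'I_m.
Proof. by have /andP[_ /eqP] := valP A. Qed.

Lemma diagram_end_string e : exists i, e \in astring A i.
Proof.
have : e \in all_ends (astring A) by rewrite (perm_mem diagram_ends) mem_enum.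
by case/flattenP => _ /mapP[i _ ->]; exists i.
Qed.

Let emb_sub i : subseq (map fe (astring A i)) (gstring G i).
Proof. exact: (forallP emb). Qed.

(** Membership is reflected because every end of [A] lies on some string, and the embedding
    preserves it. *)
Lemma emb_mem e i : ((phi e.1, e.2) \in gstring G i) = (e \in astring A i).
Proof.
have memG k : e \in astring A k -> fe e \in gstring G k.
  by move=> ek; apply: (mem_subseq (emb_sub k)); apply: map_f.
apply/idP/idP => [ei|/memG//]; have [k ek] := diagram_end_string e.
move: ei (memG k ek); rewrite !mem_gstring /fe => /eqP -> /eqP E.
by rewrite -E.
Qed.

(** Injectivity comes from the words: each is sent to a subsequence of a word without repetition. *)
Lemma emb_inj : injective phi.
Proof.
move=> a b E; have [i ai] := diagram_end_string (tail a).
have bi : tail b \in astring A i by rewrite -emb_mem /= -E (emb_mem (tail a)).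
have ui : uniq (map fe (astring A i)).
  exact: subseq_uniq (emb_sub i) (gstring_uniq _ _).
have : tail a = tail b by apply: (uniq_map_inj ui ai bi); rewrite /fe /= E.
by case.
Qed.

Let fe_inj : injective fe.
Proof. by move=> [a b] [a' b'] [/emb_inj -> ->]. Qed.

Lemma emb_filter i :
  map fe (astring A i) = [seq e <- gstring G i | e.1 \in S].
Proof.
have /(subseq_uniqP (gstring_uniq G i)) -> := emb_sub i.
apply: eq_in_filter => e eG; apply/mapP/imsetP => [[e' _ ->]|[a _ Ea]].
  by exists e'.1.
exists (a, e.2); last by rewrite /fe /= -Ea; case: (e).
by rewrite -emb_mem /= -Ea; case: (e) eG.
Qed.

(** Both sides list the arrows in the order of their tails; the image [S] alone therefore determines
    [phi]. *)
Lemma emb_numbering : [seq phi a | a <- enum 'I_m] =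
  [seq e.1 | e <- all_ends (gstring G) & e.2 && (e.1 \in S)].
Proof.
rewrite -diagram_numbering -map_comp filter_predI /=.
rewrite -(map_flatten_filter _ emb_filter) filter_map -map_comp.
exact: eq_map.
Qed.

Lemma emb_card : #|S| = m.
Proof. by rewrite card_imset ?card_ord //; exact: emb_inj. Qed.

Lemma emb_tstr a i : (tail a \in astring A i) = (i == tstr (phi a)).
Proof. by rewrite -emb_mem mem_gstring. Qed.

Lemma emb_hstr a i : (head a \in astring A i) = (i == hstr (phi a)).
Proof. by rewrite -emb_mem mem_gstring. Qed.

Lemma emb_before_tail a i : tail a \in astring A i ->
  [seq e <- before_tail (phi a) | e.1 \in S] =
  map fe (take (index (tail a) (astring A i)) (astring A i)).
Proof.
move=> ai; have /eqP ti : i == tstr (phi a) by rewrite -emb_tstr.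
rewrite map_take -(index_map fe_inj) emb_filter ti /before_tail.
apply: filter_take_index; rewrite ?mem_estr //=.
by apply/imsetP; exists a.
Qed.

Lemma grown_leaf i h T : grown A i h T -> i \in leaves T.
Proof. by elim=> {i h T} [i|i h T a i' T' _ IH _ _ _ _] /=;
  rewrite ?mem_head // mem_cat IH. Qed.

(** A sorted drawing of a node concatenates drawings of its branches, so their leaves are [apart].
    The set [S'] is only shown to lie in [S]; equality follows from a count in [planar_subtree]. *)
Lemma grown_subtree i h T : grown A i h T -> forall s w w', drawn T s ->
  sorted (fun u v : 'I_n => (u < v)%N) s -> gstring G i = w ++ w' ->
  [seq e <- w | e.1 \in S] = map fe (take h (astring A i)) ->
  exists2 S', subtree i w ([set u in leaves T] :\ i) S' & S' \subset S.
Proof.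
elim=> {i h T} [i|i h T a i' T' gT IH ha ai' gT' IH'] s w w' dr so Gi Ew.
  exists set0; rewrite ?finset.sub0set //.
  suff -> : [set u in leaves (Leaf i)] :\ i = set0 by apply: subtree_empty.
  by apply/setP => u; rewrite !inE /= andNb.
have [s1 [s2 [d1 d2 Es]]] := drawn_node dr.
have [so1 so2 ap] : [/\ sorted (fun u v : 'I_n => (u < v)%N) s1,
    sorted (fun u v : 'I_n => (u < v)%N) s2 &
    apart [set u in leaves T] [set u in leaves T']].
  have p1 := drawn_leaves d1; have p2 := drawn_leaves d2.
  case: Es so => ->; rewrite sorted_ord_cat => /and3P[/allrelP al ? ?]; split=> //;
    apply/orP; [left|right]; apply/beforeP => u v;
    by rewrite !inE -(perm_mem p1) -(perm_mem p2) => ? ?; apply: al.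
have hs : (h < size (astring A i))%N by rewrite -onthTE ha.
have Eh : nth (head a) (astring A i) h = head a.
  exact: onth_nth ha.
rewrite (take_nth (head a)) // Eh map_rcons in Ew.
have [w1 [w2 [Ew12 Ew1 Ew2]]] := filter_eq_rcons Ew.
have E0 : fe (head a) = head (phi a) by [].
rewrite E0 in Ew12.
have [S1 h1 S1S] := IH s1 w1 (head (phi a) :: w2 ++ w') d1 so1 (etrans Gi (etrans
  (congr1 (cat^~ w') Ew12) (esym (catA _ _ _)))) Ew1.
have /eqP ti : i' == tstr (phi a) by rewrite -emb_tstr.
have [w3 E3] := before_tailE (phi a); rewrite -ti in E3.
have [S2 h2 S2S] := IH' s2 (before_tail (phi a)) _ d2 so2 E3 (emb_before_tail ai').
exists (phi a |: (S1 :|: S2)); last first.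
  apply/fintype.subsetP => b; rewrite !inE => /or3P[/eqP ->|b1|b2].
  - by apply/imsetP; exists a.
  - exact: (fintype.subsetP S1S).
  - exact: (fintype.subsetP S2S).
rewrite Ew12 -cat_rcons; apply: subtree_cat.
rewrite ti in h2.
have iT : i \in [set u in leaves T] by rewrite inE (grown_leaf gT).
have i'T : tstr (phi a) \in [set u in leaves T'] by rewrite inE -ti (grown_leaf gT').
apply: (subtree_join h1 h2) => //; first by rewrite !finset.setD1K.
rewrite finset.setD1K //; apply/setP => u; rewrite !inE /= mem_cat.
case: (eqVneq u i) => [->|//] /=; apply/esym/negbTE.
have /pred0P/(_ i) := apart_disj ap.
by rewrite /= iT inE /= => ->.
Qed.

Section FromSubtree.
Variables (I : {set 'I_n}) (j : 'I_n).
Hypothesis tree : subtree j (gstring G j) I S.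

(** Converse of [grown_subtree]. The hypotheses say that [S'] is all of [S] that flows into [w], so
    the heads met along [w] in [A] are exactly the joins of the tree. They pass to the trunk and to
    the branch because the two parts are disjoint. *)
Lemma subtree_grown y w I' S' : subtree y w I' S' -> forall w' h,
  gstring G y = w ++ w' -> S' \subset S ->
  (forall e, e \in w -> e.1 \in S -> ~~ e.2 /\ e.1 \in S') ->
  (forall a, a \in S -> hstr a \in I' -> a \in S') ->
  (h <= size (astring A y))%N ->
  [seq e <- w | e.1 \in S] = map fe (take h (astring A y)) ->
  exists T s, [/\ grown A y h T, drawn T s,
    sorted (fun u v : 'I_n => (u < v)%N) s & s =i y |: I'].
Proof.
elim=> {y w I' S'} [y|y w e I' S' hS IH|y w a I1 S1 I2 S2 I' S' h1 IH1 h2 IH2 ap EI ES]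
  w' h Gy S'S H H2 hs Ew.
- have -> : h = 0%N.
    by move: (congr1 size Ew); rewrite size_map size_takel // => <-.
  exists (Leaf y), [:: y]; split => //; try constructor.
  by move=> u; rewrite !inE orbF.
- have Gy1 : gstring G y = w ++ e :: w' by rewrite -cat_rcons.
  (* A skipped end is no end of [S]: its arrow would be in [S'], with its head earlier on [w], which
     would repeat it, or on the string of a leaf, which [y] is not. *)
  have enS : e.1 \notin S.
    apply/negP => eS; have [e2 eS'] := H e (etrans (mem_rcons _ _ _) (mem_head _ _)) eS.
    have Ee : e = head e.1 by case: (e) e2 => b [].
    have he : hstr e.1 = y.
      have : head e.1 \in gstring G y by rewrite -Ee Gy1 mem_cat mem_head orbT.
      by rewrite mem_gstring => /eqP.
    case: (subtree_head hS eS'); last by rewrite he (negPf (subtree_notin hS)).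
    rewrite -Ee => ew; have := gstring_uniq G y.
    by rewrite Gy1 cat_uniq /= ew /= andbF.
  apply: (IH (e :: w')) => //; first by move=> b bw; apply: H;
    rewrite mem_rcons inE bw orbT.
  by rewrite -Ew filter_rcons (negPf enS).
have hS : subtree y (rcons w (head a)) I' S' by apply: subtree_join h1 h2 ap EI ES.
have Gy1 : gstring G y = w ++ head a :: w' by rewrite -cat_rcons.
have aS' : a \in S' by rewrite ES !inE eqxx.
have aS := fintype.subsetP S'S a aS'.
have ha : hstr a = y.
  have : head a \in gstring G y by rewrite Gy1 mem_cat mem_head orbT.
  by rewrite mem_gstring => /eqP.
have aw : head a \notin w.
  have := gstring_uniq G y; rewrite Gy1 cat_uniq /=.
  by case/and3P=> _ /norP[].
have [w2 Gt] := before_tailE a.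
have /pred0P dis := apart_disj ap.
have disj u : u \in y |: I1 -> u \in tstr a |: I2 -> False.
  by move=> u1 u2; have := dis u; rewrite /= u1 u2.
have splitS b : b \in S' -> [\/ b = a, b \in S1 | b \in S2].
  by rewrite ES !inE => /or3P[/eqP|?|?]; [constructor 1|constructor 2|constructor 3].
have tinj : {in S &, injective (@tstr n G)} := subtree_tstr_inj tree.
rewrite filter_rcons /= aS in Ew.
case: h hs Ew => [|h] hs; first by move/(congr1 size); rewrite take0 size_rcons.
have [[a0 b0] Ea0] : exists e0, onth (astring A y) h = Some e0.
  by case: onth (onthTE (astring A y) h) => [e0|]; [exists e0 | rewrite hs].
have Eh : nth (a0, b0) (astring A y) h = (a0, b0).
  exact: onth_nth Ea0.
rewrite (take_nth (a0, b0)) // Eh map_rcons => /rcons_inj[Ew Ea Eb0].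
have {b0 Eb0 Eh}Ea0 : onth (astring A y) h = Some (head a0) by rewrite Ea0 -Eb0.
have [T1 [s1 [g1 d1 so1 m1]]] : exists T s, [/\ grown A y h T, drawn T s,
    sorted (fun u v : 'I_n => (u < v)%N) s & s =i y |: I1].
  apply: (IH1 (head a :: w')) => //; last exact: ltnW.
  - by apply: fintype.subset_trans S'S; rewrite ES; apply/fintype.subsetP => b;
      rewrite !inE => ->; rewrite orbT.
  - move=> e ew eS; have [e2 /splitS eS'] := H e (etrans (mem_rcons _ _ _)
      (mem_behead (s := _ :: _) ew)) eS.
    have Ee : e = head e.1 by case: (e) e2 => b [].
    have he : hstr e.1 = y.
      have : head e.1 \in gstring G y by rewrite -Ee Gy1 mem_cat ew.
      by rewrite mem_gstring => /eqP.
    split=> //; case: eS' => // [E|/(subtree_hstr Gt h2)].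
      by move: ew; rewrite Ee E (negPf aw).
    by rewrite he => yt; case: (disj y); rewrite // !inE eqxx.
  - move=> b bS b1; case: (splitS b) => //.
    + by apply: H2 => //; rewrite EI inE b1.
    + by move=> E; move: b1; rewrite E ha (negPf (subtree_notin h1)).
    + by move=> /(subtree_hstr Gt h2) b2; case: (disj (hstr b));
        rewrite // !inE b1 orbT.
have ta0 : tail a0 \in astring A (tstr a) by rewrite emb_tstr -Ea.
have [T2 [s2 [g2 d2 so2 m2]]] : exists T s,
  [/\ grown A (tstr a) (index (tail a0) (astring A (tstr a))) T,
    drawn T s, sorted (fun u v : 'I_n => (u < v)%N) s & s =i tstr a |: I2].
  apply: (IH2 (tail a :: w2)) => //; last first.
  - by rewrite -emb_before_tail // -Ea.
  - exact: index_size.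
  - move=> b bS b2; case: (splitS b) => //.
    + by apply: H2 => //; rewrite EI !inE b2 !orbT.
    + by move=> E; case: (disj y); rewrite -?ha -?E !inE ?b2 ?orbT // E ha eqxx.
    + by move=> /(subtree_hstr Gy1 h1) b1; case: (disj (hstr b));
        rewrite // !inE b2 orbT.
  - move=> e ew eS.
    (* Tails in [S] are on distinct strings, so a tail met here would be that of [a], but the trunk
       of the branch stops before it. *)
    have e2 : ~~ e.2.
      apply/negP => e2; have Ee : e = tail e.1 by case: (e) e2 => b [].
      have te : tstr e.1 = tstr a.
        have : tail e.1 \in gstring G (tstr a) by rewrite -Ee Gt mem_cat ew.
        by rewrite mem_gstring => /eqP.
      have := gstring_uniq G (tstr a).
      rewrite Gt cat_uniq /=.
      have -> : tail a \in before_tail a.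
        by rewrite -[X in tail X](tinj _ _ eS aS te) -Ee.
      by rewrite andbF.
    split=> //; have Ee : e = head e.1 by case: (e) e2 => b [].
    have he : hstr e.1 = tstr a.
      have : head e.1 \in gstring G (tstr a) by rewrite -Ee Gt mem_cat ew.
      by rewrite mem_gstring => /eqP.
    case: (splitS e.1) => //.
    + by apply: H2 => //; rewrite he EI !inE eqxx orbT.
    + move=> E; have ty : tstr a = y by rewrite -he E ha.
      by case: (disj y); rewrite ?ty !inE eqxx.
    + by move=> /(subtree_hstr Gy1 h1); rewrite he => t1; case: (disj (tstr a));
        rewrite // !inE eqxx.
  - by apply: fintype.subset_trans S'S; rewrite ES; apply/fintype.subsetP => b;
      rewrite !inE => ->; rewrite !orbT.
have gN : grown A y h.+1 (Node T1 T2) by apply: grown_head g1 Ea0 ta0 g2.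
case/orP: ap => /beforeP bef.
  exists (Node T1 T2), (s1 ++ s2); split=> //; first by constructor.
    rewrite sorted_ord_cat so1 so2 !andbT; apply/allrelP => u v u1 v2.
    by apply: bef; rewrite -?m1 -?m2.
  by move=> u; rewrite mem_cat m1 m2 EI !inE -!orbA.
exists (Node T1 T2), (s2 ++ s1); split=> //; first by constructor.
  rewrite sorted_ord_cat so1 so2 !andbT; apply/allrelP => u v u1 v2.
  by apply: bef; rewrite -?m1 -?m2.
by move=> u; rewrite mem_cat m1 m2 EI !inE orbC -!orbA.
Qed.

Hypothesis jI : j \notin I.

Let Gj : gstring G j = gstring G j ++ [::].
Proof. by rewrite cats0. Qed.

Let phiS a : phi a \in S.
Proof. by apply/imsetP; exists a. Qed.

Let grown_trunk : exists T s, [/\ grown A j (size (astring A j)) T, drawn T s,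
    sorted (fun u v : 'I_n => (u < v)%N) s & s =i j |: I].
Proof.
apply: (subtree_grown tree Gj) => //; last by rewrite take_size -emb_filter.
(* A tail on [j] would make [j] a leaf. *)
move=> [a []] /= aj aS; split=> //.
have := subtree_tstr tree aS; rewrite mem_gstring -/(tstr a) in aj.
by rewrite -(eqP aj) (negPf jI).
Qed.

Let tree_of : exists T s, [/\ is_tree_of A I j T, drawn T s &
    sorted (fun u v : 'I_n => (u < v)%N) s].
Proof.
have [T [s [gT dT so mT]]] := grown_trunk; exists T, s; split=> //; split=> //.
have irr : irreflexive (fun u v : 'I_n => (u < v)%N) by move=> u; exact: ltnn.
have tr : transitive (fun u v : 'I_n => (u < v)%N) by move=> v u w; apply: ltn_trans.
have := drawn_leaves dT; rewrite perm_sym => /perm_trans; apply; apply: uniq_perm.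
- exact: (sorted_uniq tr irr so).
- exact: enum_uniq.
- by move=> u; rewrite mT mem_enum.
Qed.

Lemma subtree_planar : planar I j A.
Proof. exact: tree_of. Qed.

Lemma subtree_tree_diagram : tree_diagram I j A.
Proof.
split.
- move=> a i; rewrite emb_tstr emb_hstr => -[/eqP -> /eqP E].
  by case/eqP: (subtree_no_loop Gj tree (phiS a)).
- move=> i; rewrite -size_filter.
  case: (boolP (i \in I)) => [iI|niI]; last first.
    rewrite (eq_in_filter (a2 := pred0)) ?filter_pred0 // => -[a []] //= ai.
    move: ai niI; rewrite (emb_tstr a) => /eqP ->.
    by rewrite (subtree_tstr tree).
  have [b bS tb] := subtree_tstr_onto tree iI.
  have [a _ Eb] := imsetP bS; rewrite {}Eb in bS tb.
  suff /perm_size -> : perm_eq [seq e <- astring A i | e.2] [:: tail a] by [].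
  apply: uniq_perm => //.
    apply: filter_uniq; apply: (@map_uniq _ _ fe).
    by rewrite emb_filter filter_uniq // gstring_uniq.
  move=> [c []]; rewrite mem_filter mem_seq1 /=; last by apply/esym/eqP => -[].
  rewrite (emb_tstr c) -tb; apply/eqP/eqP => [E|[->] //].
  by rewrite /tail (emb_inj (subtree_tstr_inj tree bS (phiS c) E)).
- move=> a i; rewrite emb_hstr => /eqP ->.
  exact: (subtree_hstr Gj tree).
- move=> i a b iI; rewrite emb_tstr emb_hstr => /eqP ti /eqP hi.
  have ta : tail a \in astring A i by rewrite emb_tstr ti.
  have hb : head b \in astring A i by rewrite emb_hstr hi.
  have := subtree_order Gj tree (phiS a) (phiS b) (etrans (esym hi) ti).
  move=> /(conj (phiS b))/andP; rewrite -(mem_filter (fun e => e.1 \in S) (head _)).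
  rewrite (emb_before_tail ta) -[head (phi b)]/(fe (head b)) (mem_map fe_inj).
  by rewrite in_take.
- by have [T [s [? _ _]]] := tree_of; exists T.
Qed.

End FromSubtree.

(** The tree found inside [S] has as many arrows as [S], namely one per leaf, so it is all of
    [S]. *)
Lemma planar_subtree (I : {set 'I_n}) j : #|I| = m -> j \notin I ->
  planar I j A -> subtree j (gstring G j) I S.
Proof.
move=> Im jI [T [s [[gT pT] dT so]]].
have Gj : gstring G j = gstring G j ++ [::] by rewrite cats0.
have := grown_subtree gT dT so Gj; rewrite take_size -emb_filter => /(_ erefl).
have -> : [set u in leaves T] :\ j = I.
  apply/setP => u; rewrite !inE (perm_mem pT) mem_enum !inE.
  by case: eqVneq => //= ->; rewrite (negPf jI).
case=> S' h S'S; suff -> : S = S' by [].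
apply/esym/eqP; rewrite eqEcard S'S.
by rewrite emb_card (subtree_card h) Im /=.
Qed.

End Embeddings.

(** The canonical numbering recovers [phi] from its image, and the words of [A] are then the strings
    of [G] restricted to that image. *)
Lemma emb_eq (n m : nat) (A A' : arrow_diagram n m) (G : gauss_diagram n)
    (phi phi' : {ffun 'I_m -> garrow G}) :
  embedding A phi -> embedding A' phi' ->
  [set phi a | a : 'I_m] = [set phi' a | a : 'I_m] -> A = A' /\ phi = phi'.
Proof.
move=> emb emb' E.
have Ephi : phi = phi'.
  have := emb_numbering emb; rewrite E -(emb_numbering emb') => /eq_in_map Ein.
  by apply/ffunP => a; apply: Ein; rewrite mem_enum.
split=> //; apply: val_inj; apply/ffunP => i; apply: val_inj => /=.
rewrite -/(astring A i) -/(astring A' i).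
have fe_inj : injective (fun e : arrow_end 'I_m => (phi e.1, e.2)).
  by move=> [a b] [a' b'] [/(emb_inj emb) -> ->].
apply: (inj_map fe_inj).
by rewrite (emb_filter emb) E -(emb_filter emb') Ephi.
Qed.

(** * The arrow diagram carried by a set of arrows *)

Section Subdiagrams.
Variables (n m : nat) (G : gauss_diagram n) (S : {set garrow G}).
Hypothesis Sm : #|S| = m.

(** Listing the arrows in the order of their tails is what the normal form of an arrow diagram
    demands. *)
Let order := [seq e.1 | e <- all_ends (gstring G) & e.2 && (e.1 \in S)].

Let mem_order a : (a \in order) = (a \in S).
Proof.
apply/mapP/idP => [[e]|aS]; first by rewrite mem_filter => /andP[/andP[_ eS] _] ->.
by exists (tail a); rewrite // mem_filter /= aS mem_ends.
Qed.

Let order_uniq : uniq order.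
Proof.
rewrite map_inj_in_uniq ?filter_uniq ?uniq_ends //.
move=> [a b] [a' b']; rewrite !mem_filter /= => /andP[/andP[-> _] _].
by move=> /andP[/andP[-> _] _] ->.
Qed.

Let order_size : size order == m.
Proof.
by rewrite -(card_uniqP order_uniq) -Sm; apply/eqP/eq_card => a; rewrite mem_order.
Qed.

Let phi : {ffun 'I_m -> garrow G} := [ffun a => tnth (Tuple order_size) a].

Let phi_inj : injective phi.
Proof.
move=> a b; rewrite !ffunE => E.
by apply: (tuple_uniqP (Tuple order_size) order_uniq).
Qed.

Let phi_img : [set phi a | a : 'I_m] = S.
Proof.
apply/setP => b; apply/imsetP/idP => [[a _ ->]|].
  by rewrite ffunE -mem_order mem_tnth.
by rewrite -mem_order => /(tnthP (Tuple order_size))[a ->]; exists a; rewrite ?ffunE.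
Qed.

Let fe (e : arrow_end 'I_m) : arrow_end (garrow G) := (phi e.1, e.2).

Let fe_inj : injective fe.
Proof. by move=> [a b] [a' b'] [/phi_inj -> ->]. Qed.

(** An arrow outside [S] has index [m] in [order], where [insub] fails, so its ends are dropped. *)
Let word i : seq (arrow_end 'I_m) :=
  pmap (fun e => omap (fun a => (a, e.2)) (insub (index e.1 order)))
    (gstring G i).

Let word_map i : map fe (word i) = [seq e <- gstring G i | e.1 \in S].
Proof.
rewrite /word; elim: (gstring G i) => //= e s IH.
rewrite -mem_order -index_mem; case: insubP => [a ae va|] /=; last first.
  by rewrite (eqP order_size) => /negPf ->.
rewrite (eqP order_size) ae /= IH; congr (_ :: _).
rewrite /fe /= ffunE (tnth_nth e.1) va /= nth_index ?(eqP order_size) //;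
  first by case: (e).
by rewrite -index_mem (eqP order_size).
Qed.

Let word_uniq i : uniq (word i).
Proof. by apply: (@map_uniq _ _ fe); rewrite word_map filter_uniq // gstring_uniq. Qed.

Let word_size i : (size (word i) <= m.*2)%N.
Proof.
rewrite -(card_uniqP (word_uniq i)); apply: leq_trans (max_card _) _.
by rewrite card_prod card_ord card_bool muln2.
Qed.

Let words : {ffun 'I_n -> {bseq m.*2 of ('I_m * bool)%type}} :=
  [ffun i => Bseq (word_size i)].

Let words_ends : map fe (all_ends (fun i => words i : seq _)) =
  [seq e <- all_ends (gstring G) | e.1 \in S].
Proof. by apply: map_flatten_filter => i; rewrite ffunE /= word_map. Qed.

Let words_diagram : is_arrow_diagram words.
Proof.
apply/andP; split.
  apply: uniq_perm; rewrite ?enum_uniq //.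
    by apply: (@map_uniq _ _ fe); rewrite words_ends filter_uniq // uniq_ends.
  move=> e; rewrite mem_enum -(mem_map fe_inj) words_ends mem_filter mem_ends.
  by rewrite -phi_img andbT; apply/imsetP; exists e.1.
apply/eqP/(inj_map phi_inj); rewrite -map_comp.
transitivity order.
  rewrite /order filter_predI -words_ends filter_map -map_comp.
  exact: eq_map.
rewrite (eq_map (g := tnth (Tuple order_size))) => [|a]; last by rewrite ffunE.
by rewrite map_tnth_enum.
Qed.

Lemma subdiagram_exists : exists (A : arrow_diagram n m)
    (phi : {ffun 'I_m -> garrow G}),
  embedding A phi /\ [set phi a | a : 'I_m] = S.
Proof.
exists (exist _ words words_diagram), phi; split=> //.
apply/forallP => i; rewrite /astring /= ffunE /= -[map _ _]/(map fe (word i)).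
by rewrite word_map filter_subseq.
Qed.

End Subdiagrams.

(** A planar tree diagram together with an embedding amounts to the image of the embedding, a set of
    arrows forming a planar tree. Each right-pointing arrow contributes -1 to the sign of the
    diagram, and [weight] puts this factor on the arrow itself. *)
Lemma tree_sumE (n : nat) (I : {set 'I_n}) (j : 'I_n) (G : gauss_diagram n) :
  j \notin I -> tree_sum I j G = subtree_sum j (gstring G j) I.
Proof.
move=> jI; have Gj : gstring G j = gstring G j ++ [::] by rewrite cats0.
pose pairs := [set p : arrow_diagram n #|I| * {ffun 'I_#|I| -> garrow G} |
  (p.1 \in planar_trees I j) && embedding p.1 p.2].
pose img (p : arrow_diagram n #|I| * {ffun 'I_#|I| -> garrow G}) :=
  [set p.2 a | a : 'I_#|I|].
transitivity (\sum_(p in pairs) tree_sign p.1 * \prod_a gsign (p.2 a)).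
  transitivity (\sum_(A in planar_trees I j)
      \sum_(phi : {ffun 'I_#|I| -> garrow G} | embedding A phi)
        tree_sign A * \prod_a gsign (phi a)).
    by apply: eq_bigr => A _; rewrite mulr_sumr.
  by rewrite pair_big_dep /=; apply: eq_bigl => p; rewrite !inE.
rewrite /subtree_sum (eq_bigl [in img @: pairs]) => [|S]; last first.
  apply/asboolP/imsetP => [h|[[A phi]]].
    have [A [phi [emb ES]]] := subdiagram_exists (subtree_card h).
    exists (A, phi); last by rewrite /img ES.
    rewrite -ES in h; rewrite !inE emb andbT; apply/asboolP; split.
      exact: (subtree_tree_diagram emb h jI).
    exact: (subtree_planar emb h jI).
  rewrite !inE /= => /andP[/asboolP[_ pl] emb] ->.
  exact: (planar_subtree emb).
rewrite big_imset /= => [|[A phi] [A' phi']]; last first.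
  rewrite !inE /= => /andP[_ emb] /andP[_ emb'] E.
  by have [-> ->] := emb_eq emb emb' E.
apply: eq_bigr => -[A phi]; rewrite !inE /= => /andP[_ emb].
rewrite /img big_imset /= => [|a b _ _]; last exact: (emb_inj emb).
rewrite /tree_sign -prodr_const.
rewrite (eq_bigl (right_pointing A) (fun=> -1)) => [|a]; last by rewrite inE.
rewrite [X in X * _]big_mkcond -big_split /=; apply: eq_bigr => a _.
have -> : right_pointing A a = (tstr (phi a) < hstr (phi a))%N.
  apply/existsP/idP => [[p /existsP[s]]|lt].
    by rewrite (emb_tstr emb) (emb_hstr emb) => /and3P[/eqP -> /eqP ->].
  exists (tstr (phi a)); apply/existsP; exists (hstr (phi a)).
  by rewrite (emb_tstr emb) (emb_hstr emb) !eqxx.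
by rewrite /weight; case: ifP; rewrite ?mulN1r ?mul1r.
Qed.

(** * Gauss diagrams of skein quadruples *)

Section Passages.
Variables (R : realType) (p : nat -> R) (n top bot : nat).
Notation tangle := (tangle p n top bot).
Notation passage := (passage R n).
Implicit Types (D L : tangle) (u v : passage).

(** Endpoints of strings have y = 0 and z = 0 or 1, while inner points have z strictly between. An
    endpoint can thus share its shadow only with an endpoint, and then both have the same y. *)
Lemma crossing_sym_interior L u v : shadow (at_ L u) = shadow (at_ L v) ->
  yc (at_ L u) != yc (at_ L v) -> 0 <= u.2 <= 1 -> 0 <= v.2 <= 1 -> 0 < u.2 < 1.
Proof.
move=> sh yuv /andP[u0 u1] /andP[v0 v1].
have ends w : w.2 = 0 \/ w.2 = 1 -> yc (at_ L w) = 0 /\ (zc (at_ L w) = 0 \/ zc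
  (at_ L w) = 1).
  by move=> w01; case: (strand_ends L w.1 w01) => -[a _ E]; rewrite /at_ E; split; auto.
rewrite !lt_neqAle u0 u1 !andbT; apply/negPn/negP; rewrite negb_and !negbK => ue.
have [yu zu] : yc (at_ L u) = 0 /\ (zc (at_ L u) = 0 \/ zc (at_ L u) = 1).
  by apply: ends; case/orP: ue => /eqP ->; auto.
have zz : zc (at_ L u) = zc (at_ L v) by case: sh.
have [v01|/norP[v_0 v_1]] := boolP ((v.2 == 0) || (v.2 == 1)).
  have [yv _] : yc (at_ L v) = 0 /\ (zc (at_ L v) = 0 \/ zc (at_ L v) = 1).
    by apply: ends; case/orP: v01 => /eqP ->; auto.
  by move: yuv; rewrite yu yv eqxx.
have [|_ /andP[]] := strand_proper L v.1 (t := v.2).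
  by rewrite !lt_neqAle eq_sym v_0 v0 v_1 v1.
by rewrite -/(at_ L v) -zz; case: zu => ->; rewrite ltxx.
Qed.

Lemma crossing_interior L u v : crossing L u v -> 0 < u.2 < 1 /\ 0 < v.2 < 1.
Proof.
case=> u01 v01 sh yuv; split.
  by apply: crossing_sym_interior sh _ u01 v01; rewrite lt_eqF.
by apply: crossing_sym_interior (esym sh) _ v01 u01; rewrite gt_eqF.
Qed.

(* A Gauss diagram of D with the passages of D through its arrow ends. *)
Record placed D (G : gauss_diagram n) (pass : arrow_end (garrow G) -> passage) :
    Prop := Placed {
  placed_string : forall e, (pass e).1 = estr e;
  placed_sorted : forall i, sorted (fun e f => (pass e).2 < (pass f).2) (gstring G i);
  placed_crossing : forall a, crossing D (pass (tail a)) (pass (head a));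
  placed_sign : forall a, gsign a = writhe D (pass (tail a)) (pass (head a));
  placed_onto : forall u v, crossing D u v ->
    exists2 a, pass (tail a) = u & pass (head a) = v }.

Lemma placed_inj D G pass : @placed D G pass -> injective pass.
Proof.
move=> pl e f E; have Ef : estr e = estr f by rewrite -!(placed_string pl) E.
have so := placed_sorted pl (estr e).
have un : uniq (map (fun e => (pass e).2) (gstring G (estr e))).
  by apply: lt_sorted_uniq; rewrite sorted_map.
by apply: (uniq_map_inj un); rewrite ?mem_gstring ?Ef ?E.
Qed.

Lemma placed_at D G pass : @placed D G pass -> gauss_diagram_at D G.
Proof.
move=> pl; exists (fun e => (pass e).2); split.
- exact: placed_sorted pl.
- move=> a i i'; rewrite !mem_gstring => /eqP -> /eqP -> /=.
  rewrite -!(placed_string pl) -!surjective_pairing.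
  by split; [exact: placed_crossing pl a | exact: placed_sign pl a].
- move=> u v /(placed_onto pl)[a <- <-]; exists a; split=> //.
    by rewrite mem_gstring (placed_string pl).
  by rewrite mem_gstring (placed_string pl).
Qed.

Lemma perm_flatten_filter (T : eqType) (s : seq T) (f : T -> 'I_n) (w : 'I_n -> seq T) :
  (forall i, perm_eq (w i) [seq e <- s | f e == i]) ->
  perm_eq (flatten [seq w i | i <- enum 'I_n]) s.
Proof.
move=> pw; apply/permP => P; rewrite count_flatten -map_comp.
rewrite sumnE big_map big_enum /= -[RHS]sum1_count (partition_big f xpredT) //=.
apply: eq_bigr => i _; rewrite (permP (pw i)) count_filter -sum1_count.
by apply: eq_bigl => e.
Qed.

(** The arrows are the crossings themselves, and each string lists its ends by increasing time. *)
Lemma placed_exists D : generic D -> exists G pass, @placed D G pass.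
Proof.
move=> gD; have /finite_seqP[s Es] := generic_finite gD.
pose X : finType := seq_sub s.
have crX (a : X) : crossing D (val a).1 (val a).2.
  have : [set c : passage * passage | crossing D c.1 c.2]%classic (val a).
    by rewrite Es; exact: valP a.
  by [].
have Xcr u v : crossing D u v -> exists a : X, val a = (u, v).
  move=> uv; have uvs : (u, v) \in s.
    have : [set c : passage * passage | crossing D c.1 c.2]%classic (u, v) by [].
    by rewrite Es.
  by exists (SeqSub uvs).
pose pass (e : arrow_end X) : passage := if e.2 then (val e.1).1 else (val e.1).2.
(* A passage used by two ends would lie with two others over one point of the plane, against
   [generic_double]. *)
have pass_inj : injective pass.
  have double := generic_double gD.
  have yneq u v : crossing D u v -> u != v.
    by case=> _ _ _; apply: contraTneq => ->; rewrite ltxx.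
  have same b (a a' : X) : pass (a, b) = pass (a', b) -> a = a'.
    move=> E; apply: val_inj; have := crX a; have := crX a'; move: E.
    rewrite /pass; case: b; case: (val a) (val a') => [u v] [u' v'] /= <-.
      move=> c' c; have [u01 v01 sv yv] := c; have [_ v'01 sv' yv'] := c'.
      case: (double v u v') => // E; last by rewrite E.
        by move: (yneq _ _ c); rewrite E eqxx.
      by move: (yneq _ _ c'); rewrite -E eqxx.
    move=> c' c; have [u01 v01 sv yv] := c; have [u'01 _ sv' yv'] := c'.
    case: (double u v u') => // E; last by rewrite E.
      by move: (yneq _ _ c); rewrite E eqxx.
    by move: (yneq _ _ c'); rewrite -E eqxx.
  have cross (a a' : X) : pass (a, true) <> pass (a', false).
    move=> E; have := crX a; have := crX a'; move: E.
    rewrite /pass; case: (val a) (val a') => [u v] [u' v'] /= <-.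
    move=> c' c; have [u01 v01 sv yv] := c; have [u'01 _ sv' yv'] := c'.
    case: (double u' u v) => // E.
    - by move: (yneq _ _ c'); rewrite E eqxx.
    - by move: (yneq _ _ c); rewrite E eqxx.
    - by move: (lt_trans yv' yv); rewrite E ltxx.
  move=> [a b] [a' b'] E; have Eb : b = b'.
    by case: b b' E => -[] // E; [case: (cross _ _ E) | case: (cross _ _ (esym E))].
  by move: E; rewrite Eb => /same ->.
pose le : rel (arrow_end X) := fun e f => (pass e).2 <= (pass f).2.
pose word i := sort le [seq e <- enum {: (X * bool)%type} | (pass e).1 == i].
have word_perm : perm_eq (all_ends word) (enum {: (X * bool)%type}).
  by apply: (@perm_flatten_filter _ _ (fun e => (pass e).1)) => i; rewrite perm_sort.
pose sg (a : X) := writhe D (val a).1 (val a).2.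
have sgU a : sg a = 1 \/ sg a = -1.
  rewrite /sg /writhe; have := generic_transversal gD (crX a).
  by case: sgzP => // _ _; auto.
pose G := GaussDiagram word_perm sgU.
have mem_word e i : (e \in word i) = ((pass e).1 == i).
  by rewrite mem_sort mem_filter mem_enum andbT.
have pstr (e : arrow_end (garrow G)) : (pass e).1 = estr e.
  by have := mem_estr e; rewrite mem_word => /eqP.
exists G, pass; split=> //.
- move=> i; suff : sorted <%R (map (fun e =>
    (pass e).2) (word i)) by rewrite sorted_map.
  rewrite lt_sorted_uniq_le.
  apply/andP; split; last first.
    by rewrite sorted_map; apply: sort_sorted => e f; apply: le_total.
  rewrite map_inj_in_uniq ?(gstring_uniq G) // => e f.
  rewrite !mem_word => /eqP ei /eqP fi E; apply: pass_inj.
  by case: (pass e) (pass f) ei fi E => [k t] [k' t'] /= -> -> ->.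
- by move=> u v /Xcr[a Ea]; exists a; rewrite /pass Ea.
Qed.

End Passages.

(** * Tangles that locally run along another tangle *)

Section LocalCopies.
Variable R : realType.

Lemma derive1_local (f g : R -> R) (a b t : R) : a < t < b ->
  (forall s, a < s < b -> f s = g s) -> derive1 f t = derive1 g t.
Proof.
move=> atb fg; rewrite !derive1E; apply: near_eq_derive.
have /near_in_itvoo : t \in `]a, b[ by rewrite in_itv.
by apply: filterS => s; rewrite in_itv /=; apply: fg.
Qed.

Lemma derive1_reflect (f : R -> R) (t : R) : derivable f (1 - t) 1 ->
  derive1 (fun s => f (1 - s)) t = - derive1 f (1 - t).
Proof.
move=> df; have dr : is_derive t 1 (fun s : R => 1 - s) (-1).
  by apply: is_derive_eq; rewrite add0r mul1r.
have := @derive1_comp R (fun s => 1 - s) f t (@ex_derive _ _ _ _ _ _ _ dr) df.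
rewrite [X in _ * X]derive1E derive_val mulrN1 => <-.
by [].
Qed.

Variables (p : nat -> R) (n top bot : nat).
Notation tangle := (tangle p n top bot).
Notation passage := (passage R n).
Implicit Types (D : tangle) (u v : passage).

(* Near the passage u, the tangle D' runs along D near u', backwards if the
   boolean is true. *)
Definition copied D' D u u' (back : bool) : Prop := exists a b : R,
  [/\ a < u.2 < b, u'.2 = (if back then 1 - u.2 else u.2)
    & forall t, a < t < b -> D' u.1 t = D u'.1 (if back then 1 - t else t)].

Lemma copied_at D' D u u' back : copied D' D u u' back -> at_ D' u = at_ D u'.
Proof. by case=> a [b [ab E]] /(_ _ ab); rewrite /at_ E. Qed.

Lemma copied_velocity D' D u u' back : copied D' D u u' back ->
  velocity D' u = if back then - velocity D u' else velocity D u'.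
Proof.
case=> a [b [ab Eu E]].
have der (c : Defs.space R -> R) : smooth (c \o D u'.1) ->
    derive1 (c \o D' u.1) u.2 = if back then - derive1 (c \o D u'.1) u'.2
      else derive1 (c \o D u'.1) u'.2.
  move=> sm.
  rewrite (@derive1_local _ (fun t => (c \o D u'.1) (if back then 1 - t else t)) a
    b) //.
    by rewrite Eu; case: back {Eu E} => //; apply: derive1_reflect; exact: (sm 0%N).
  by move=> t /E /= ->.
have [smx _ smz] := strand_smooth D u'.1.
by rewrite /velocity !der // {der}; case: back {Eu E}.
Qed.

(** The determinant of two velocities changes sign with each of them, so only a single reversal
    matters. *)
Lemma copied_writhe D' D u u' back v v' back' :
  copied D' D u u' back -> copied D' D v v' back' ->
  writhe D' u v = if back (+) back' then - writhe D u' v' else writhe D u' v'.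
Proof.
move=> /copied_velocity vu /copied_velocity vv; rewrite /writhe vu vv.
have detNl a b : det2 (- a) b = - det2 a b :> R by rewrite /det2 /=; ring.
have detNr a b : det2 a (- b) = - det2 a b :> R by rewrite /det2 /=; ring.
by case: back back' {vu vv} => -[] /=; rewrite ?detNl ?detNr ?opprK ?sgzN.
Qed.

Lemma copied_crossing D' D u u' back v v' back' :
  copied D' D u u' back -> copied D' D v v' back' ->
  0 <= u'.2 <= 1 -> 0 <= v'.2 <= 1 -> crossing D' u v -> crossing D u' v'.
Proof.
move=> /copied_at Eu /copied_at Ev u01 v01 [_ _ sh yy].
by split; rewrite -?Eu -?Ev.
Qed.

Lemma copied_crossing_inv D' D u u' back v v' back' :
  copied D' D u u' back -> copied D' D v v' back' ->
  0 <= u.2 <= 1 -> 0 <= v.2 <= 1 -> crossing D u' v' -> crossing D' u v.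
Proof.
move=> /copied_at Eu /copied_at Ev u01 v01 [_ _ sh yy].
by split; rewrite ?Eu ?Ev.
Qed.

(** Arrows are crossings, so a correspondence of passages that respects crossings yields a map of
    arrows; [omit] sets aside the crossing that the smoothing removes. *)
Lemma placed_match D' D G' G pass' pass (sigma sigma' : passage -> passage)
    (omit : pred (garrow G)) :
  @placed _ _ _ _ _ D' G' pass' -> @placed _ _ _ _ _ D G pass ->
  (forall u v, crossing D' u v -> [/\ crossing D (sigma u) (sigma v),
     sigma' (sigma u) = u & sigma' (sigma v) = v]) ->
  (forall a, ~~ omit a ->
     crossing D' (sigma' (pass (tail a))) (sigma' (pass (head a))) /\
     forall b, sigma (sigma' (pass (a, b))) = pass (a, b)) ->
  exists g : garrow G' -> garrow G,
    [/\ injective g, forall e, pass (emap g e) = sigma (pass' e) &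
        forall e, ~~ omit e.1 ->
          exists2 e', emap g e' = e & pass' e' = sigma' (pass e)].
Proof.
move=> pl' pl fwd bwd.
have ex (a' : garrow G') : exists a, forall b, pass (a, b) = sigma (pass' (a', b)).
  have [/(placed_onto pl)[a Et Eh] _ _] := fwd _ _ (placed_crossing pl' a').
  by exists a => -[].
have [g gP] := choice ex.
have retr e : sigma' (sigma (pass' e)) = pass' e.
  by case: e => a []; have [] := fwd _ _ (placed_crossing pl' a).
exists g; split.
- move=> a b E; have := gP b true; rewrite -E gP => /(congr1 sigma').
  by rewrite !retr => /(placed_inj pl')[].
- by move=> [a b]; rewrite /emap gP.
- move=> [a b] /= na; have [/(placed_onto pl')[a' Et Eh] sec] := bwd a na.
  have Ep : pass' (a', b) = sigma' (pass (a, b)) by case: b.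
  by exists (a', b) => //; apply: (placed_inj pl); rewrite /emap gP Ep sec.
Qed.

(** A word strictly sorted by time is determined by its set of elements. The function [time] is
    chosen on the target, whose own parametrization may run backwards. *)
Lemma string_eq D' G' pass' (T : eqType) (h : arrow_end (garrow G') -> T) i
    (W : seq T) (time : T -> R) :
  @placed _ _ _ _ _ D' G' pass' ->
  sorted (fun e f => time e < time f) W ->
  (forall e, e \in gstring G' i -> h e \in W /\ time (h e) = (pass' e).2) ->
  (forall f, f \in W -> exists2 e, e \in gstring G' i & h e = f) ->
  map h (gstring G' i) = W.
Proof.
move=> pl' so hW Wh; apply: (irr_sorted_eq (leT := fun e f => time e < time f)) => //.
- by move=> y x z; apply: lt_trans.
- rewrite sorted_map; have := placed_sorted pl' i.
  apply: (@sub_in_sorted _ (mem (gstring G' i))); last exact/allP.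
  move=> e f /hW[_ Ee] /hW[_ Ef].
  by rewrite /= Ee Ef.
- move=> f; apply/mapP/idP => [[e /hW[] + _ ->]|/Wh[e]]; first by [].
  by move=> eG <-; exists e.
Qed.

Lemma sorted_split_time D G pass i (w1 w2 : seq (arrow_end (garrow G))) e0 e :
  @placed _ _ _ _ _ D G pass -> gstring G i = w1 ++ e0 :: w2 ->
  (e \in w1 -> (pass e).2 < (pass e0).2) /\ (e \in w2 -> (pass e0).2 < (pass e).2).
Proof.
move=> pl Gi; have := placed_sorted pl i; rewrite Gi sorted_pairwise; last first.
  by move=> y x z; apply: lt_trans.
rewrite pairwise_cat /= => /and3P[/allrelP al _ /andP[/allP al2 _]].
by split=> [ew|/al2//]; apply: al; rewrite ?mem_head.
Qed.

End LocalCopies.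

(** * From passages to the Gauss diagrams of a skein quadruple *)

Section SkeinPassages.
Variables (R : realType) (p : nat -> R) (n top bot : nat).
Notation tangle := (tangle p n top bot).
Notation passage := (passage R n).
Implicit Types (D : tangle) (u v : passage).
Variables (j k : 'I_n).
Hypothesis jk : j != k.

(** The times in [1/3, 2/3] are those that the two strings spend over the disk of the skein move;
    [outside] also leaves out the endpoints, where no crossing lies. *)
Definition in_arc u := ((u.1 == j) || (u.1 == k)) && (1/3 <= u.2 <= 2/3).
Definition outside u := (0 < u.2 < 1) && ~~ in_arc u.

(* The passage of L_+ that a passage of L_0 comes from. *)
Definition sigma0 u : passage :=
  if u.2 < 1/2 then u else
  (if u.1 == j then k else if u.1 == k then j else u.1, u.2).

(* The passage of L_+ that a passage of L_oo comes from, and conversely. *)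
Definition sigmai u : passage :=
  if u.1 == j then (if u.2 < 1/2 then u else (k, 1 - u.2))
  else if u.1 == k then (if u.2 < 1/2 then (k, 1 - u.2) else (j, u.2))
  else u.
Definition sigmai' u : passage :=
  if u.1 == j then (if u.2 < 1/2 then u else (k, u.2))
  else if u.1 == k then (if u.2 < 1/2 then (j, 1 - u.2) else (k, 1 - u.2))
  else u.

Lemma outsideP u : outside u ->
  [/\ u.1 = j /\ (0 < u.2 < 1/3 \/ 2/3 < u.2 < 1) \/
      u.1 = k /\ (0 < u.2 < 1/3 \/ 2/3 < u.2 < 1) \/
      u.1 != j /\ u.1 != k /\ 0 < u.2 < 1 & 0 < u.2 < 1].
Proof.
rewrite /outside /in_arc => /andP[u01]; have /andP[u0 u1] := u01.
have [Ej|nj] := eqVneq u.1 j; last have [Ek|nk] := eqVneq u.1 k; rewrite /=.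
- rewrite negb_and -!ltNge => /orP[] lt; split=> //; left; split=> //.
    by left; apply/andP; split; lra.
  by right; apply/andP; split; lra.
- rewrite negb_and -!ltNge => /orP[] lt; split=> //; right; left; split=> //.
    by left; apply/andP; split; lra.
  by right; apply/andP; split; lra.
- by split=> //; right; right.
Qed.

Let kj : (k == j) = false.
Proof. by rewrite eq_sym (negPf jk). Qed.

Let halves (t : R) : 0 < t < 1/3 \/ 2/3 < t < 1 ->
  [\/ [/\ (t < 1/2) = true, (1 - t < 1/2) = false & 0 < t < 1/3] |
      [/\ (t < 1/2) = false, (1 - t < 1/2) = true & 2/3 < t < 1]].
Proof.
case=> h; have /andP[h1 h2] := h; [left|right]; split=> //.
- by lra.
- by apply/negbTE; rewrite -leNgt; lra.
- by apply/negbTE; rewrite -leNgt; lra.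
- by lra.
Qed.

Let third (t : R) : 0 < t < 1/3 \/ 2/3 < t < 1 -> forall i, outside (i,
  t) /\ outside (i, 1 - t).
Proof.
move=> ht i; rewrite /outside /in_arc /=; split; apply/andP; split.
- by case: ht => /andP[h1 h2]; apply/andP; split; lra.
- by rewrite negb_and negb_and -!ltNge; apply/orP; right; case: ht =>
    /andP[h1 h2]; apply/orP; [left|right]; lra.
- by case: ht => /andP[h1 h2]; apply/andP; split; lra.
- by rewrite negb_and negb_and -!ltNge; apply/orP; right; case: ht =>
    /andP[h1 h2]; apply/orP; [right|left]; lra.
Qed.

Let ar1 (t : R) : t < 1/2 -> 2/3 < t -> False. Proof. by move=> *; lra. Qed.
Let ar2 (t : R) : 1/2 <= t -> t < 1/3 -> False. Proof. by move=> *; lra. Qed.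
Let ar3 (s t : R) : s < 1/3 -> 2/3 < t -> s < t. Proof. by move=> *; lra. Qed.
Let ar4 : 1/3 < 1/2 :> R. Proof. by lra. Qed.
Let ar5 (t : R) : 2/3 < t -> 1/2 <= t. Proof. by move=> *; lra. Qed.
Let ar6 (s t : R) : s < 1/3 -> t < 1/3 -> s < 1 - t. Proof. by move=> *; lra. Qed.
Let ar7 (s t : R) : s < t -> 1 - t < 1 - s. Proof. by move=> *; lra. Qed.
Let ar8 (t : R) : 1/2 <= t -> 0 < t < 1/3 \/ 2/3 < t < 1 -> 1 - t < 1/2.
Proof. by move=> h [] /andP[h1 h2]; lra. Qed.

Lemma sigma0_out u : outside u -> outside (sigma0 u) /\ sigma0 (sigma0 u) = u.
Proof.
case: u => i t ou; have [/= [[-> ht]|[[-> ht]|[ij [ik ht]]]] _] := outsideP ou.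
- by case: (halves ht) => -[E1 E2 _]; rewrite /sigma0 /= E1 /= ?E1 ?eqxx ?kj /= ?eqxx;
    split=> //; apply: (third ht _).1.
- by case: (halves ht) => -[E1 E2 _]; rewrite /sigma0 /= E1 /= ?E1 ?eqxx ?kj /= ?eqxx;
    split=> //; apply: (third ht _).1.
- by rewrite /sigma0 /= (negPf ij) (negPf ik); case: ifP => E;
    rewrite /= ?E ?(negPf ij) ?(negPf ik).
Qed.

Lemma sigmai_out u : outside u -> outside (sigmai u) /\ sigmai' (sigmai u) = u.
Proof.
case: u => i t ou; have [/= [[-> ht]|[[-> ht]|[ij [ik ht]]]] _] := outsideP ou.
- case: (halves ht) => -[E1 E2 _]; rewrite /sigmai /sigmai' /= eqxx E1 /= ?E1 ?eqxx
    ?kj /= ?eqxx ?E2.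
    by split=> //; apply: (third ht _).1.
  by split; [apply: (third ht _).2 | congr (_, _); ring].
- case: (halves ht) => -[E1 E2 _]; rewrite /sigmai /sigmai' /= kj eqxx E1 /= ?E1
    ?eqxx ?kj /= ?eqxx ?E2.
    by split; [apply: (third ht _).2 | congr (_, _); ring].
  by split=> //; apply: (third ht _).1.
- by rewrite /sigmai /sigmai' /= (negPf ij) (negPf ik) /= (negPf ij) (negPf ik).
Qed.

Lemma sigmai'_out u : outside u -> outside (sigmai' u) /\ sigmai (sigmai' u) = u.
Proof.
case: u => i t ou; have [/= [[-> ht]|[[-> ht]|[ij [ik ht]]]] _] := outsideP ou.
- case: (halves ht) => -[E1 E2 _]; rewrite /sigmai /sigmai' /= eqxx E1 /= ?E1 ?eqxx
    ?kj /= ?eqxx ?E2.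
    by split=> //; apply: (third ht _).1.
  by split=> //; apply: (third ht _).1.
- case: (halves ht) => -[E1 E2 _]; rewrite /sigmai /sigmai' /= kj eqxx E1 /= ?E1
    ?eqxx ?kj /= ?eqxx ?E2.
    by split; [apply: (third ht _).2 | congr (_, _); ring].
  by split; [apply: (third ht _).2 | congr (_, _); ring].
- by rewrite /sigmai /sigmai' /= (negPf ij) (negPf ik) /= (negPf ij) (negPf ik).
Qed.

(* A skein quadruple seen from its first diagram Da, where the string k crosses
   over the string j at the passages ud, vd; Db is the other of L_+ and L_-. *)
Record skein_passages (Da Db D0 Di : tangle) (ud vd : passage) : Prop := SkeinPassages {
  sp_strings : ud.1 = k /\ vd.1 = j;
  sp_arcs : in_arc ud /\ in_arc vd;
  sp_a_d : crossing Da ud vd;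
  sp_a : forall u v, crossing Da u v -> (u = ud /\ v = vd) \/ (outside u /\ outside v);
  sp_b_d : crossing Db vd ud;
  sp_b : forall u v, crossing Db u v -> (u = vd /\ v = ud) \/ (outside u /\ outside v);
  sp_0 : forall u v, crossing D0 u v -> outside u /\ outside v;
  sp_i : forall u v, crossing Di u v -> outside u /\ outside v;
  sp_b_copy : forall u, outside u -> copied Db Da u u false;
  sp_0_copy : forall u, outside u -> copied D0 Da u (sigma0 u) false;
  sp_i_copy : forall u, outside u ->
    copied Di Da u (sigmai u) ((sigmai u).1 == k) }.

Lemma map_eq_cat_cons (T U : eqType) (h : T -> U) s w1 x w2 :
  map h s = w1 ++ x :: w2 -> exists s1 y s2,
    [/\ s = s1 ++ y :: s2, map h s1 = w1, h y = x & map h s2 = w2].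
Proof.
elim: s w1 => [|y s IH] [|z w1] //=.
  by case=> <- <-; exists [::], y, s.
by case=> <- /IH[s1 [y' [s2 [-> <- <- <-]]]]; exists (y :: s1), y', s2.
Qed.

Section GaussDiagrams.
Variables (Da Db D0 Di : tangle) (ud vd : passage).
Hypothesis sp : skein_passages Da Db D0 Di ud vd.
Variables (Ga Gb G0 Gi : gauss_diagram n).
Variables (pa : arrow_end (garrow Ga) -> passage) (pb : arrow_end (garrow Gb) ->
  passage).
Variables (p0 : arrow_end (garrow G0) -> passage) (pi : arrow_end (garrow Gi) ->
  passage).
Hypotheses (pla : placed Da pa) (plb : placed Db pb).
Hypotheses (pl0 : placed D0 p0) (pli : placed Di pi).
Variable d : garrow Ga.
Hypotheses (pd : pa (tail d) = ud) (phd : pa (head d) = vd).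
Variables P Q U V : seq (arrow_end (garrow Ga)).
Hypotheses (Gj : gstring Ga j = P ++ head d :: Q) (Gk : gstring Ga k = U ++ tail d
  :: V).

Let time01 u : outside u -> 0 <= u.2 <= 1.
Proof. by case/andP => /andP[h1 h2] _; rewrite !ltW. Qed.

Let pa_out e : (e.1 != d) = outside (pa e).
Proof.
case: (eqVneq e.1 d) => [E|ne]; apply/esym; last first.
  have : outside (pa (tail e.1)) /\ outside (pa (head e.1)).
    case: (sp_a sp (placed_crossing pla e.1)) => // -[Et _].
    have [E] : tail e.1 = tail d by apply: (placed_inj pla); rewrite Et pd.
    by rewrite E eqxx in ne.
  by case: e ne => a [] /= _ [].
have [au av] := sp_arcs sp; apply/negbTE; rewrite negb_and negbK.
by case: e E => a [] /= ->; rewrite ?pd ?phd ?au ?av orbT.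
Qed.

Let pa_str e i : (e \in gstring Ga i) = ((pa e).1 == i).
Proof. by rewrite mem_gstring (placed_string pla) eq_sym. Qed.

(** The ends of [d] are on the distinct strings [j] and [k], so each of these carries only one of
    them. *)
Let string_neq_d i w1 w2 e0 e : gstring Ga i = w1 ++ e0 :: w2 ->
  (i == j) || (i == k) -> e0.1 = d -> e \in w1 ++ w2 -> e.1 != d.
Proof.
move=> Gs ijk e0d ew; apply: contraNneq (jk) => ed.
have ei : e \in gstring Ga i by rewrite Gs; move: ew; rewrite !mem_cat inE =>
  /orP[] ->; rewrite ?orbT.
have e0i : e0 \in gstring Ga i by rewrite Gs mem_cat mem_head orbT.
have ee0 : e != e0.
  apply: contraTneq (gstring_uniq Ga i) => E; rewrite Gs cat_uniq /= negb_or.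
  by rewrite -!andbA; apply/negP => /and5P[_ n1 _ n2 _]; move: ew;
    rewrite E mem_cat (negPf n1) (negPf n2).
have [Eu Ev] := sp_strings sp.
move: ei e0i; rewrite !pa_str.
case: e e0 ed e0d ee0 {ew Gs} => a [] [a0 []] /= -> ->;
  rewrite ?eqxx //= -/(tail d) -/(head d) pd phd Eu Ev => _ /eqP -> /eqP.
  by move=> ->.
by move=> ->.
Qed.

(** Outside the arcs, a passage on [j] or [k] is in the first or the last third of its string; the
    last is excluded since the end [e0] of [d] comes later, at a time at most 2/3. *)
Let early i e0 w1 w2 e : gstring Ga i = w1 ++ e0 :: w2 -> (i == j) || (i == k) ->
  e0.1 = d -> e \in w1 -> [/\ (pa e).1 = i, e.1 != d & 0 < (pa e).2 < 1/3].
Proof.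
move=> Gs ijk e0d ew; have ed : e.1 != d.
  by apply: (string_neq_d Gs) => //; rewrite mem_cat ew.
have /eqP ei : (pa e).1 == i by rewrite -pa_str Gs mem_cat ew.
split=> //; have [lt _] := sorted_split_time e pla Gs; have {}lt := lt ew.
have e0t : 1/3 <= (pa e0).2 <= 2/3.
  have [au av] := sp_arcs sp.
  by case: (e0) e0d => a [] /= ->; rewrite -/(tail d) -/(head d) ?pd ?phd;
     [case/andP: au|case/andP: av].
move: ed; rewrite pa_out => /outsideP[+ /andP[h1 h2]].
case/andP: e0t => e1 e2.
case=> [[_ ht]|[[_ ht]|[nj [nk _]]]]; last by move: ijk;
  rewrite -ei (negPf nj) (negPf nk).
- by case: ht => // /andP[h3 _]; move: (lt_trans h3 (lt_le_trans lt e2)); rewrite ltxx.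
- by case: ht => // /andP[h3 _]; move: (lt_trans h3 (lt_le_trans lt e2)); rewrite ltxx.
Qed.

Let late i e0 w1 w2 e : gstring Ga i = w1 ++ e0 :: w2 -> (i == j) || (i == k) ->
  e0.1 = d -> e \in w2 -> [/\ (pa e).1 = i, e.1 != d & 2/3 < (pa e).2 < 1].
Proof.
move=> Gs ijk e0d ew; have ed : e.1 != d.
  by apply: (string_neq_d Gs) => //; rewrite mem_cat ew orbT.
have /eqP ei : (pa e).1 == i by rewrite -pa_str Gs mem_cat inE ew !orbT.
split=> //; have [_ lt] := sorted_split_time e pla Gs; have {}lt := lt ew.
have e0t : 1/3 <= (pa e0).2 <= 2/3.
  have [au av] := sp_arcs sp.
  by case: (e0) e0d => a [] /= ->; rewrite -/(tail d) -/(head d) ?pd ?phd;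
     [case/andP: au|case/andP: av].
move: ed; rewrite pa_out => /outsideP[+ /andP[h1 h2]].
case/andP: e0t => e1 e2.
case=> [[_ ht]|[[_ ht]|[nj [nk _]]]]; last by move: ijk;
  rewrite -ei (negPf nj) (negPf nk).
- by case: ht => // /andP[_ h3]; move: (lt_trans (le_lt_trans e1 lt) h3); rewrite ltxx.
- by case: ht => // /andP[_ h3]; move: (lt_trans (le_lt_trans e1 lt) h3); rewrite ltxx.
Qed.

Let early_mem i e0 w1 w2 e : gstring Ga i = w1 ++ e0 :: w2 ->
  (i == j) || (i == k) -> e0.1 = d -> (pa e).1 = i -> outside (pa e) ->
  (pa e).2 < 1/2 -> e \in w1.
Proof.
move=> Gs ijk e0d /eqP; rewrite -pa_str -pa_out => ei ed lt; move: (ei).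
rewrite Gs mem_cat inE => /or3P[//|/eqP E|ew]; first by rewrite E e0d eqxx in ed.
by have [_ _ /andP[h _]] := late Gs ijk e0d ew; case: (ar1 lt h).
Qed.

Let late_mem i e0 w1 w2 e : gstring Ga i = w1 ++ e0 :: w2 ->
  (i == j) || (i == k) -> e0.1 = d -> (pa e).1 = i -> outside (pa e) ->
  1/2 <= (pa e).2 -> e \in w2.
Proof.
move=> Gs ijk e0d /eqP; rewrite -pa_str -pa_out => ei ed le; move: (ei).
rewrite Gs mem_cat inE => /or3P[ew|/eqP E|//]; last by rewrite E e0d eqxx in ed.
by have [_ _ /andP[_ h]] := early Gs ijk e0d ew; case: (ar2 le h).
Qed.

Let jj : (j == j) || (j == k). Proof. by rewrite eqxx. Qed.
Let kk : (k == j) || (k == k). Proof. by rewrite eqxx orbT. Qed.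

Let sorted_part i w1 w2 w : gstring Ga i = w1 ++ w ++ w2 ->
  sorted (fun e f => (pa e).2 < (pa f).2) w.
Proof.
have tr : transitive (fun e f => (pa e).2 < (pa f).2) by move=> y x z; apply: lt_trans.
move=> Gs; have := placed_sorted pla i.
by rewrite Gs !(sorted_pairwise tr) !pairwise_cat => /and3P[_ _ /and3P[]].
Qed.

Let other_string (D' : tangle) (G' : gauss_diagram n)
    (pass' : arrow_end (garrow G') -> passage)
    (sigma sigma' : passage -> passage) (g : garrow G' -> garrow Ga) i :
  placed D' pass' -> (forall e, pa (emap g e) = sigma (pass' e)) ->
  (forall e, e.1 != d -> exists2 e', emap g e' = e & pass' e' = sigma' (pa e)) ->
  (forall u, u.1 != j -> u.1 != k -> sigma u = u /\ sigma' u = u) ->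
  i != j -> i != k -> map (emap g) (gstring G' i) = gstring Ga i.
Proof.
move=> pl' fwd bwd fixed ij ik.
apply: (string_eq (time := fun e => (pa e).2) pl' (placed_sorted pla i)) => e.
  rewrite mem_gstring -(placed_string pl') eq_sym pa_str fwd => /eqP ei.
  by have [||-> _] := fixed (pass' e); rewrite ei ?eqxx.
rewrite pa_str => /eqP ei; have ed : e.1 != d.
  have [Eu Ev] := sp_strings sp.
  apply: contraNneq ij => E; have := ik; rewrite -ei.
  by case: e E {ei} => a [] /= ->; rewrite -/(tail d) -/(head d) ?pd ?phd ?Eu ?Ev ?eqxx.
have [e' Ee' Ep'] := bwd e ed; exists e' => //.
rewrite mem_gstring -(placed_string pl') Ep'.
by have [||_ ->] := fixed (pa e); rewrite ei ?eqxx.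
Qed.

Let match_0 : exists g0 : garrow G0 -> garrow Ga,
  [/\ injective g0, map (emap g0) (gstring G0 k) = U ++ Q,
    forall i, i != j -> i != k -> map (emap g0) (gstring G0 i) = gstring Ga i &
    forall a, gsign a = gsign (g0 a)].
Proof.
have [u v uv|a na|g [g_inj fwd bwd]] :=
    placed_match (sigma := sigma0) (sigma' := sigma0) (omit := pred1 d) pl0 pla.
- have [ou ov] := sp_0 sp uv.
  have [[ou' Eu] [ov' Ev]] := (sigma0_out ou, sigma0_out ov); split=> //.
  by apply: (copied_crossing (sp_0_copy sp ou) (sp_0_copy sp ov)); rewrite ?time01.
- have oe b : outside (pa (a, b)) by rewrite -pa_out.
  split=> [|b]; last by have [] := sigma0_out (oe b).
  have [ot Et] := sigma0_out (oe true); have [oh Eh] := sigma0_out (oe false).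
  have ct := sp_0_copy sp ot; have ch := sp_0_copy sp oh; rewrite Et in ct;
    rewrite Eh in ch.
  by apply: (copied_crossing_inv ct ch (time01 ot) (time01 oh));
    apply: placed_crossing pla a.
exists g; split=> //.
- have out' e : outside (p0 e).
    by case: e => a []; have [] := sp_0 sp (placed_crossing pl0 a).
  apply: (string_eq (time := fun e => (pa e).2) pl0).
  (* [U] lies in the first third of the string [k] and [Q] in the last third of [j], so times
     increase along [U ++ Q]. *)
  + have tr : transitive (fun e f : arrow_end (garrow Ga) => (pa e).2 < (pa f).2).
      by move=> y x z; apply: lt_trans.
    rewrite (sorted_pairwise tr) pairwise_cat -!(sorted_pairwise tr).
    rewrite (@sorted_part k [::] (tail d :: V)) // (@sorted_part j (P ++ [:: head
      d]) [::]) ?cats0 -?catA //.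
    rewrite !andbT; apply/allrelP => e f eU fQ.
    have [_ _ /andP[_ h1]] := early Gk kk (erefl d) eU.
    by have [_ _ /andP[h2 _]] := late Gj jj (erefl d) fQ; apply: ar3.
  + move=> e; rewrite mem_gstring -(placed_string pl0) eq_sym => /eqP ek.
    have [oe _] := sigma0_out (out' e); rewrite -fwd in oe.
    have Ee := fwd e; rewrite /sigma0 ek kj eqxx in Ee.
    case: ltP Ee => lt Ee; rewrite Ee in oe; split; rewrite ?Ee // mem_cat;
      apply/orP; [left|right].
      by apply: (early_mem Gk); rewrite ?Ee.
    by apply: (late_mem Gj); rewrite ?Ee.
  + move=> f; rewrite mem_cat => /orP[fU|fQ].
      have [fk fd /andP[f0 f1]] := early Gk kk (erefl d) fU.
      have [e Ee Ep] := bwd f fd; exists e => //.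
      rewrite mem_gstring -(placed_string pl0) Ep /sigma0 ifT ?fk //.
      exact: lt_trans f1 ar4.
    have [fj fd /andP[f0 f1]] := late Gj jj (erefl d) fQ.
    have [e Ee Ep] := bwd f fd; exists e => //.
    rewrite mem_gstring -(placed_string pl0) Ep /sigma0 ifF /= ?fj ?eqxx //.
    by apply/negbTE; rewrite -leNgt; apply: ar5.
- move=> i ij ik; apply: (other_string pl0 fwd bwd) => // u uj uk.
  by rewrite /sigma0 (negPf uj) (negPf uk); case: ifP; case: u {uj uk}.
- move=> a; rewrite (placed_sign pl0) (placed_sign pla) -[tail (g a)]/(emap g (tail a)).
  rewrite -[head (g a)]/(emap g (head a)) !fwd.
  have [ou ov] := sp_0 sp (placed_crossing pl0 a).
  by rewrite (copied_writhe (sp_0_copy sp ou) (sp_0_copy sp ov)).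
Qed.

Let match_i : exists gi : garrow Gi -> garrow Ga,
  [/\ injective gi, map (emap gi) (gstring Gi j) = P ++ rev U,
    forall i, i != j -> i != k -> map (emap gi) (gstring Gi i) = gstring Ga i &
    forall a, tstr a != j -> tstr a != k ->
      gsign a = if hstr (gi a) == k then - gsign (gi a) else gsign (gi a)].
Proof.
have [u v uv|a na|g [g_inj fwd bwd]] :=
    placed_match (sigma := sigmai) (sigma' := sigmai') (omit := pred1 d) pli pla.
- have [ou ov] := sp_i sp uv.
  have [[ou' Eu] [ov' Ev]] := (sigmai_out ou, sigmai_out ov); split=> //.
  by apply: (copied_crossing (sp_i_copy sp ou) (sp_i_copy sp ov)); rewrite ?time01.
- have oe b : outside (pa (a, b)) by rewrite -pa_out.
  split=> [|b]; last by have [] := sigmai'_out (oe b).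
  have [ot Et] := sigmai'_out (oe true); have [oh Eh] := sigmai'_out (oe false).
  have ct := sp_i_copy sp ot; have ch := sp_i_copy sp oh; rewrite Et in ct;
    rewrite Eh in ch.
  by apply: (copied_crossing_inv ct ch (time01 ot) (time01 oh));
    apply: placed_crossing pla a.
have out' e : outside (pi e).
  by case: e => a []; have [] := sp_i sp (placed_crossing pli a).
exists g; split=> //.
(* This is the time on the string [j] of [Di], which runs along [P] and then backwards along [U]. *)
- pose time (e : arrow_end (garrow Ga)) := if (pa e).1 == j then (pa e).2 else 1 -
    (pa e).2.
  apply: (string_eq (time := time) pli).
  + have tr : transitive (fun e f => time e < time f).
      by move=> y x z; apply: lt_trans.
    have trk : transitive (fun e f : arrow_end (garrow Ga) => (pa e).2 < (pa f).2).
      by move=> y x z; apply: lt_trans.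
    have timeP e : e \in P -> time e = (pa e).2.
      by move=> /(early Gj jj (erefl d))[ej _ _]; rewrite /time ej eqxx.
    have timeU e : e \in U -> time e = 1 - (pa e).2.
      by move=> /(early Gk kk (erefl d))[ek _ _]; rewrite /time ek kj.
    rewrite (sorted_pairwise tr) pairwise_cat -!(sorted_pairwise tr); apply/and3P;
      split.
    * apply/allrelP => e f eP; rewrite mem_rev => fU; rewrite timeP // timeU //.
      have [_ _ /andP[_ h1]] := early Gj jj (erefl d) eP.
      by have [_ _ /andP[_ h2]] := early Gk kk (erefl d) fU; apply: ar6.
    * have := @sorted_part j [::] (head d :: Q) P Gj.
      apply: (@sub_in_sorted _ (mem P)); last exact/allP.
      by move=> e f eP fP /=; rewrite !timeP.
    * rewrite rev_sorted; have := @sorted_part k [::] (tail d :: V) U Gk.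
      apply: (@sub_in_sorted _ (mem U)); last exact/allP.
      by move=> e f eU fU /=; rewrite !timeU //; apply: ar7.
  + move=> e; rewrite mem_gstring -(placed_string pli) eq_sym => /eqP ej.
    have [oe _] := sigmai_out (out' e); rewrite -fwd in oe.
    have Ee := fwd e; rewrite /sigmai ej eqxx in Ee.
    rewrite /time mem_cat mem_rev; case: ltP Ee => lt Ee; rewrite Ee in oe.
      rewrite Ee ej eqxx; split=> //; apply/orP; left.
      by apply: (early_mem Gj); rewrite ?Ee.
    rewrite Ee /= kj; split; last by ring.
    apply/orP; right; apply: (early_mem Gk); rewrite ?Ee //=.
    have [+ _] := outsideP (out' e); rewrite ej.
    case=> [[_ ht]|[[E _]|[]]]; last by rewrite eqxx.
      exact: ar8.
    by move: kj; rewrite -E eqxx.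
  + move=> f; rewrite mem_cat mem_rev => /orP[fP|fU].
      have [fj fd /andP[f0 f1]] := early Gj jj (erefl d) fP.
      have [e Ee Ep] := bwd f fd; exists e => //.
      rewrite mem_gstring -(placed_string pli) Ep /sigmai' fj eqxx ifT ?fj //.
      exact: lt_trans f1 ar4.
    have [fk fd /andP[f0 f1]] := early Gk kk (erefl d) fU.
    have [e Ee Ep] := bwd f fd; exists e => //.
    rewrite mem_gstring -(placed_string pli) Ep /sigmai' fk kj eqxx ifT //.
    exact: lt_trans f1 ar4.
- move=> i ij ik; apply: (other_string pli fwd bwd) => // u uj uk.
  by rewrite /sigmai /sigmai' (negPf uj) (negPf uk).
- move=> a aj ak; rewrite (placed_sign pli) (placed_sign pla).
  rewrite -[tail (g a)]/(emap g (tail a)) -[head (g a)]/(emap g (head a)) !fwd.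
  have [ou ov] := sp_i sp (placed_crossing pli a).
  rewrite (copied_writhe (sp_i_copy sp ou) (sp_i_copy sp ov)).
  (* The tail is on neither [j] nor [k], hence on an unreversed string; the string of the head alone
     decides the sign. *)
  have -> : (sigmai (pi (tail a))).1 == k = false.
    have tj : (pi (tail a)).1 != j by rewrite (placed_string pli).
    have tk : (pi (tail a)).1 != k by rewrite (placed_string pli).
    by rewrite /sigmai (negPf tj) (negPf tk) (negPf tk).
  by rewrite -fwd (placed_string pla).
Qed.

(** Changing the crossing exchanges the two ends of its arrow, so [emap gb] has the wrong kind of
    end at [db]. The map [h] flips the kind there and carries strings to strings; away from [db] the
    two maps agree. *)
Lemma skein_gauss_exists : exists db Pb Qb Ub Vb gb g0 gi,
  @skein_gauss n j k Ga Gb G0 Gi d db P Q U V Pb Qb Ub Vb gb g0 gi.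
Proof.
have [g0 [g0_inj g0_k g0_o g0_s]] := match_0.
have [gi [gi_inj gi_j gi_o gi_s]] := match_i.
have [db dbt dbh] := placed_onto plb (sp_b_d sp).
have [Eu Ev] := sp_strings sp.
have notdb a : a != db -> outside (pb (tail a)) /\ outside (pb (head a)).
  move=> ne; case: (sp_b sp (placed_crossing plb a)) => // -[Et _].
  have [E] : tail a = tail db by apply: (placed_inj plb); rewrite Et dbt.
  by rewrite E eqxx in ne.
have exg a : exists c, forall b, pa (c, if a == db then ~~ b else b) = pb (a, b).
  case: (eqVneq a db) => [->|/notdb[ot oh]]; first by exists d => -[];
    [exact: etrans phd (esym dbt) | exact: etrans pd (esym dbh)].
  have := copied_crossing (sp_b_copy sp ot) (sp_b_copy sp oh) (time01 ot) (time01
    oh) (placed_crossing plb a).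
  by move=> /(placed_onto pla)[c Et Eh]; exists c => -[].
have [gb gbP] := choice exg.
pose h (e : arrow_end (garrow Gb)) : arrow_end (garrow Ga) :=
  (gb e.1, if e.1 == db then ~~ e.2 else e.2).
have hP e : pa (h e) = pb e by case: e => a b; rewrite /h gbP.
have h_inj : injective h by move=> e f /(congr1 pa); rewrite !hP => /(placed_inj plb).
have gb_db : gb db = d.
  have : h (tail db) = head d by apply: (placed_inj pla); rewrite hP dbt phd.
  by case.
have hdb b : h (db, b) = (d, ~~ b) by rewrite /h /= gb_db eqxx.
have gb_inj : injective gb.
  move=> a b E; case: (eqVneq a db) => [Ea|na]; case: (eqVneq b db) => [Eb|nb].
  - by rewrite Ea Eb.
  - have : h (tail b) = h (head db) by rewrite hdb /h /= (negPf nb) -E Ea gb_db.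
    by move/h_inj => [] .
  - have : h (tail a) = h (head db) by rewrite hdb /h /= (negPf na) E Eb gb_db.
    by move/h_inj => [].
  - have : h (tail a) = h (tail b) by rewrite /h /= (negPf na) (negPf nb) E.
    by move/h_inj => [].
have h_onto e : exists2 e', h e' = e & pb e' = pa e.
  have [a Ea] : exists a, gb a = e.1.
    case: (eqVneq e.1 d) => [->|ne]; first by exists db.
    have ot : outside (pa (tail e.1)) by rewrite -pa_out.
    have oh : outside (pa (head e.1)) by rewrite -pa_out.
    have := copied_crossing_inv (sp_b_copy sp ot) (sp_b_copy sp oh) (time01 ot)
      (time01 oh) (placed_crossing pla e.1).
    move=> /(placed_onto plb)[a Et Eh]; exists a.
    have : h (tail a) = tail e.1 by apply: (placed_inj pla); rewrite hP.
    by case.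
  exists (a, if a == db then ~~ e.2 else e.2).
    by rewrite /h /= Ea; case: e {Ea} => c b /=; case: (a == db); rewrite ?negbK.
  by rewrite -hP /h /= Ea; case: e {Ea} => c b /=; case: (a == db); rewrite ?negbK.
have h_str i : map h (gstring Gb i) = gstring Ga i.
  apply: (string_eq (time := fun e => (pa e).2) plb (placed_sorted pla i)) => e.
    by rewrite mem_gstring -(placed_string plb) pa_str hP eq_sym.
  rewrite pa_str => /eqP ei; have [e' Ee Ep] := h_onto e; exists e' => //.
  by rewrite mem_gstring -(placed_string plb) Ep ei.
have h_emap w' w : map h w' = w -> (forall e, e \in w -> e.1 != d) ->
  map (emap gb) w' = w.
  move=> <- nd; apply/eq_in_map => e ew; rewrite /h /emap; case: ifP => // /eqP E.
  by have := nd _ (map_f h ew); rewrite /h /= E gb_db eqxx.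
have [Pb [ej [Qb [Ebj EP Ej EQ]]]] := map_eq_cat_cons (etrans (h_str j) Gj).
have [Ub [ek [Vb [Ebk EU Ek EV]]]] := map_eq_cat_cons (etrans (h_str k) Gk).
have ejE : ej = tail db by apply: h_inj; rewrite Ej hdb.
have ekE : ek = head db by apply: h_inj; rewrite Ek hdb.
rewrite {}ejE {Ej} in Ebj; rewrite {}ekE {Ek} in Ebk.
exists db, Pb, Qb, Ub, Vb, gb, g0, gi; split=> //.
- split; apply: h_emap => // e ew.
  + by have [] := early Gj jj (erefl d) ew.
  + by have [] := late Gj jj (erefl d) ew.
  + by have [] := early Gk kk (erefl d) ew.
  + by have [] := late Gk kk (erefl d) ew.
- move=> i ij ik; apply: (h_emap _ _ (h_str i)) => e.
  rewrite pa_str => /eqP ei; apply: contraNneq ij => E; have := ik; rewrite -ei.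
  by case: e E {ei} => a [] /= ->; rewrite -/(tail d) -/(head d) ?pd ?phd ?Eu ?Ev ?eqxx.
- move=> a na; have [ot oh] := notdb a na.
  rewrite (placed_sign plb) (placed_sign pla) -(hP (tail a)) -(hP (head a)) /h /=
    (negPf na).
  have := copied_writhe (sp_b_copy sp ot) (sp_b_copy sp oh).
  by rewrite -(hP (tail a)) -(hP (head a)) /h /= (negPf na).
Qed.

End GaussDiagrams.
End SkeinPassages.

(** * From geometric skein quadruples to passages *)

Section SkeinDiagrams.
Variables (R : realType) (p : nat -> R) (n top bot : nat).
Notation tangle := (tangle p n top bot).
Notation passage := (passage R n).
Implicit Types (D : tangle) (u v : passage).
Variables (j k : 'I_n) (Dp Dm D0 Di : tangle) (c : R * R) (rho : R).
Hypothesis jk : j != k.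
Hypothesis sk : skein_diagrams j k Dp Dm D0 Di c rho.

Let arcE D u : [\/ D = Dp, D = Dm, D = D0 | D = Di] -> 0 <= u.2 <= 1 ->
  in_disk c rho (shadow (at_ D u)) <-> in_arc j k u.
Proof.
move=> HD u01; rewrite /in_arc; split=> [/(skein_disk sk HD u.1 u01)[ijk ->]|].
  by rewrite andbT; case: ijk => ->; rewrite eqxx ?orbT.
move=> /andP[ijk t]; apply/(skein_disk sk HD u.1 u01); split=> //.
by case/orP: ijk => /eqP; auto.
Qed.

(** The two passages have the same shadow, so both are over the disk or neither is. *)
Let crossing_arcs D u v : [\/ D = Dp, D = Dm, D = D0 | D = Di] -> crossing D u v ->
  (in_arc j k u /\ in_arc j k v /\ in_disk c rho (shadow (at_ D u))) \/
  (outside j k u /\ outside j k v).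
Proof.
move=> HD uv; have [u01 v01 sh _] := uv; have [iu iv] := crossing_interior uv.
rewrite /outside iu iv /=; case: (boolP (in_arc j k u)) => au.
  have du := (arcE HD u01).2 au; left; split=> //; split=> //.
  by apply/(arcE HD v01); rewrite -sh.
right; split=> //; apply: contra au => av; apply/(arcE HD u01).
by rewrite sh; apply/(arcE HD v01).
Qed.

Let base_eq D i t : D = Dp \/ D = Dm -> 0 <= t <= 1/3 \/ 2/3 <= t <= 1 ->
  D i t = Dp i t.
Proof. by case=> -> //; apply: (skein_Dm sk). Qed.

Let base_others D i t : D = Dp \/ D = Dm -> i != j -> i != k -> 0 <= t <= 1 ->
  D i t = Dp i t.
Proof.
by case=> -> // /eqP ij /eqP ik t01; have [] := skein_others sk ij ik t01.
Qed.

Let early01 (t : R) : 0 < t < 1/3 -> 0 <= t <= 1/3.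
Proof. by case/andP=> h1 h2; rewrite !ltW. Qed.
Let late01 (t : R) : 2/3 < t < 1 -> 2/3 <= t <= 1.
Proof. by case/andP=> h1 h2; rewrite !ltW. Qed.
Let int01 (t : R) : 0 < t < 1 -> 0 <= t <= 1.
Proof. by case/andP=> h1 h2; rewrite !ltW. Qed.
Let early_refl (t : R) : 0 < t < 1/3 -> 2/3 <= 1 - t <= 1.
Proof. by case/andP=> h1 h2; apply/andP; split; lra. Qed.
Let late_refl (t : R) : 2/3 < t < 1 -> 0 <= 1 - t <= 1/3.
Proof. by case/andP=> h1 h2; apply/andP; split; lra. Qed.
Let early_half (t : R) : 0 < t < 1/3 -> t < 1/2.
Proof. by case/andP=> h1 h2; lra. Qed.
Let late_half (t : R) : 2/3 < t < 1 -> (t < 1/2) = false.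
Proof. by case/andP=> h1 h2; apply/negbTE; rewrite -leNgt; lra. Qed.
Let kj : (k == j) = false.
Proof. by rewrite eq_sym (negPf jk). Qed.

Let copy_base Da Db u : Da = Dp \/ Da = Dm -> Db = Dp \/ Db = Dm ->
  outside j k u -> copied Db Da u u false.
Proof.
move=> Ha Hb; case: u => i t ou.
have [/= [[_ [ht|ht]]|[[_ [ht|ht]]|[ij [ik ht]]]] _] := outsideP ou.
- by exists 0, (1/3); split=> // s /early01 hs; rewrite /= !base_eq //; left.
- by exists (2/3), 1; split=> // s /late01 hs; rewrite /= !base_eq //; right.
- by exists 0, (1/3); split=> // s /early01 hs; rewrite /= !base_eq //; left.
- by exists (2/3), 1; split=> // s /late01 hs; rewrite /= !base_eq //; right.
- by exists 0, 1; split=> // s /int01 hs; rewrite /= !base_others.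
Qed.

Let copy_0 Da u : Da = Dp \/ Da = Dm -> outside j k u ->
  copied D0 Da u (sigma0 j k u) false.
Proof.
move=> Ha; case: u => i t ou.
have [/= [[-> [ht|ht]]|[[-> [ht|ht]]|[ij [ik ht]]]] _] := outsideP ou.
- rewrite /sigma0 /= early_half //; exists 0, (1/3); split=> // s /early01 hs /=.
  by rewrite (base_eq (D := Da)) //; [case: (skein_D0_in sk hs) | left].
- rewrite /sigma0 /= late_half // eqxx; exists (2/3), 1; split=> // s /late01 hs /=.
  by rewrite (base_eq (D := Da)) //; [case: (skein_D0_out sk hs) | right].
- rewrite /sigma0 /= early_half //; exists 0, (1/3); split=> // s /early01 hs /=.
  by rewrite (base_eq (D := Da)) //; [case: (skein_D0_in sk hs) | left].
- rewrite /sigma0 /= late_half // kj eqxx; exists (2/3), 1; split=> // s /late01 hs /=.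
  by rewrite (base_eq (D := Da)) //; [case: (skein_D0_out sk hs) | right].
- have -> : sigma0 j k (i, t) = (i, t).
    by rewrite /sigma0 /= (negPf ij) (negPf ik); case: ifP.
  exists 0, 1; split=> // s /int01 hs /=; rewrite (base_others (D := Da)) //.
  by have [_ ->] := skein_others sk (elimN eqP ij) (elimN eqP ik) hs.
Qed.

Let copy_i Da u : Da = Dp \/ Da = Dm -> outside j k u ->
  copied Di Da u (sigmai j k u) ((sigmai j k u).1 == k).
Proof.
move=> Ha; case: u => i t ou.
have [/= [[-> [ht|ht]]|[[-> [ht|ht]]|[ij [ik ht]]]] _] := outsideP ou.
- rewrite /sigmai /= eqxx early_half //= (negPf jk).
  exists 0, (1/3); split=> // s /early01 hs /=.
  by rewrite (base_eq (D := Da)) //; [case: (skein_Di_in sk hs) | left].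
- rewrite /sigmai /= eqxx late_half //= eqxx.
  exists (2/3), 1; split=> // s hs /=.
  rewrite (base_eq (D := Da)) //; first by case: (skein_Di_out sk (late01 hs)).
  by left; apply: late_refl.
- rewrite /sigmai /= kj eqxx early_half //= eqxx.
  exists 0, (1/3); split=> // s hs /=.
  rewrite (base_eq (D := Da)) //; first by case: (skein_Di_in sk (early01 hs)).
  by right; apply: early_refl.
- rewrite /sigmai /= kj eqxx late_half //= (negPf jk).
  exists (2/3), 1; split=> // s /late01 hs /=.
  by rewrite (base_eq (D := Da)) //; [case: (skein_Di_out sk hs) | right].
- rewrite /sigmai /= (negPf ij) (negPf ik) /= (negPf ik).
  exists 0, 1; split=> // s /int01 hs /=; rewrite (base_others (D := Da)) //.
  by have [_ _ ->] := skein_others sk (elimN eqP ij) (elimN eqP ik) hs.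
Qed.

Let velocity_pm u : 0 < u.2 < 1 -> velocity Dm u = velocity Dp u.
Proof.
move=> u01; rewrite /velocity; congr (_, _); apply: (derive1_local u01) => s /int01 hs;
  by have [] := skein_shadow sk u.1 hs.
Qed.

Let base_passages Da Db ud vd : Da = Dp \/ Da = Dm -> Db = Dp \/ Db = Dm ->
  ud.1 = k -> vd.1 = j ->
  crossing Da ud vd -> in_disk c rho (shadow (at_ Da ud)) ->
  (forall u v, crossing Da u v -> in_disk c rho (shadow (at_ Da u)) ->
    u = ud /\ v = vd) ->
  crossing Db vd ud ->
  (forall u v, crossing Db u v -> in_disk c rho (shadow (at_ Db u)) ->
    u = vd /\ v = ud) ->
  skein_passages j k Da Db D0 Di ud vd.
Proof.
move=> Ha Hb ek ej ca da ua cb ub.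
have Ha4 : [\/ Da = Dp, Da = Dm, Da = D0 | Da = Di].
  by case: Ha; [constructor 1 | constructor 2].
have Hb4 : [\/ Db = Dp, Db = Dm, Db = D0 | Db = Di].
  by case: Hb; [constructor 1 | constructor 2].
have H0 : [\/ D0 = Dp, D0 = Dm, D0 = D0 | D0 = Di] by constructor 3.
have Hi : [\/ Di = Dp, Di = Dm, Di = D0 | Di = Di] by constructor 4.
split=> //.
- case: (crossing_arcs Ha4 ca) => [[? []]|[]] //.
  have [u01 _ _ _] := ca; have := (arcE Ha4 u01).1 da => au.
  by rewrite /outside au andbF.
- move=> u v uv; case: (crossing_arcs Ha4 uv) => [[_ [_ du]]|]; last by right.
  by left; apply: ua.
- move=> u v uv; case: (crossing_arcs Hb4 uv) => [[_ [_ du]]|]; last by right.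
  by left; apply: ub.
- move=> u v uv; case: (crossing_arcs H0 uv) => [[_ [_ du]]|//].
  by case: (skein_D0_crossing sk uv).
- move=> u v uv; case: (crossing_arcs Hi uv) => [[_ [_ du]]|//].
  by case: (skein_Di_crossing sk uv).
- by move=> u; apply: copy_base.
- by move=> u; apply: copy_0.
- by move=> u; apply: copy_i.
Qed.

(** [Da] is whichever of [Dp] and [Dm] has [k] passing over [j], so that the arrow of the crossing
    points to [j]; its writhe tells which one it is. *)
Lemma skein_base : exists Da Db ud vd,
  skein_passages j k Da Db D0 Di ud vd /\
  ([/\ Da = Dp, Db = Dm & writhe Da ud vd = 1] \/
   [/\ Da = Dm, Db = Dp & writhe Da ud vd = -1]).
Proof.
have [u [v [cp dp jkuv wp uniqp]]] := skein_Dp_crossing sk.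
have [u' [v' [cm dm _ wm uniqm]]] := skein_Dm_crossing sk.
have shE w : 0 <= w.2 <= 1 -> shadow (at_ Dm w) = shadow (at_ Dp w).
  by move=> w01; apply: (skein_shadow sk).
(* The passages of [Dm] have equal shadows in [Dp] too. The same order there would give the same
   writhe, and equal depths a double point of an embedding; so the order is reversed, and uniqueness
   of the crossing applies. *)
have [Eu Ev] : u' = v /\ v' = u.
  have [u01 v01 sh ylt] := cm.
  have sh' : shadow (at_ Dp u') = shadow (at_ Dp v') by rewrite -!shE.
  have dm' : in_disk c rho (shadow (at_ Dp u')) by rewrite -shE.
  case: (ltgtP (yc (at_ Dp u')) (yc (at_ Dp v'))) => [lt|gt|eq].
  - have cr : crossing Dp u' v' by split.
    have [E1 E2] := uniqp _ _ cr dm'.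
    have [iu iv] := crossing_interior cr.
    have := wm; rewrite /writhe !velocity_pm // -/(writhe Dp u' v') E1 E2 wp.
    by move=> H; have : (1 : int) == -1 by rewrite H.
  - have cr : crossing Dp v' u' by split.
    by have [-> ->] := uniqp _ _ cr (eq_rect _ (fun q => in_disk c rho q) dm' _ sh').
  - have Ept : at_ Dp u' = at_ Dp v'.
      move: sh' eq; rewrite /shadow /yc /xc /zc.
      by case: (at_ Dp u') (at_ Dp v') => -[x y] z [[x' y'] z'] /= [-> ->] ->.
    have [E1 E2] := @strand_embedded _ _ _ _ _ Dp u'.1 v'.1 u'.2 v'.2 u01 v01 Ept.
    have E : u' = v' by case: (u') (v') E1 E2 => [a b] [a' b'] /= -> ->.
    by move: ylt; rewrite E ltxx.
rewrite Eu Ev in cm dm wm uniqm.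
have [_ _ shp _] := cp; have [_ _ shm _] := cm.
have dm' : in_disk c rho (shadow (at_ Dm u)) by rewrite -shm.
case: jkuv => [[Ej Ek]|[Ek Ej]].
  exists Dm, Dp, v, u; split; last by right.
  by apply: base_passages => //; [right | left].
exists Dp, Dm, u, v; split; last by left.
by apply: base_passages => //; [left | right].
Qed.

End SkeinDiagrams.

(** * The skein formulas for tangles *)

(* The indices i_1 < i_2 < etc are i 0, i 1, etc: i is numbered from 0. *)
Theorem theorem4p3 (R : realType) (p : nat -> R)
  (p_inj : injective p) (p_disk : forall a, `|p a| < 1)
  (n top bot : nat) (n_def : n.*2 = (top + bot)%N)
  (Z : {set 'I_n} -> 'I_n -> tangle p n top bot -> int)
  (Z_def : tree_invariants Z)
  (r : nat) (j : 'I_n) (i : 'I_r -> 'I_n)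
  (j_lt : forall s, (j < i s)%N)
  (i_incr : forall s t : 'I_r, (s < t)%N -> (i s < i t)%N)
  (k : 'I_r) (Lp Lm L0 Li : tangle p n top bot)
  (skein : skein_quadruple j (i k) Lp Lm L0 Li) :
  let I := [set i s | s : 'I_r] in
  let Iminus (m : 'I_r) := [set i s | s : 'I_r & (s < m)%N] in
  let Iplus (m : 'I_r) := (I :\: Iminus m) :\ i k in
  [/\ Z I j Lp - Z I j Lm = Z (Iminus k) j Li * Z (Iplus k) (i k) L0,
      forall m : 'I_r, (m <= k)%N -> Z (Iminus m) j Lp = Z (Iminus m) j Lm
    & Z I j Lp - Z I j Lm =
        \sum_(m : 'I_r | (m <= k)%N)
           Z (Iminus m) j Lp * Z (Iplus m) (i k) L0].
Proof.
move=> I Iminus Iplus.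
have jk : j != i k by rewrite neq_ltn j_lt.
have EI : I = itv i 0 r.
  apply/setP => u; apply/imsetP/itvP => [[s _ ->]|[s _ ->]]; exists s => //.
  exact: ltn_ord.
have EIminus m : Iminus m = itv i 0 m by [].
(* Removing [i k] cuts the interval from m to r in two; for m = k the first piece is empty. *)
have EIplus (m : 'I_r) : (m <= k)%N -> Iplus m = itv i m k :|: itv i k.+1 r.
  move=> mk; apply/setP => u; rewrite /Iplus EI EIminus !inE.
  apply/and3P/orP => [[+ + /itvP[s /andP[_ sr] us]]|].
    rewrite us (inj_eq (x_inj i_incr)) -val_eqE neq_ltn !mem_itv //= -leqNgt sr
      andbT => lt ->.
    by case/orP: lt; [left | right].
  case=> /itvP[s /andP[h1 h2] us]; rewrite us (inj_eq (x_inj i_incr)) -val_eqE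
    neq_ltn !mem_itv //= -leqNgt.
    by rewrite h1 h2 ltn_ord.
  by rewrite h1 h2 (leq_trans mk (ltnW h1)) orbT.
have jI a b : j \notin itv i a b.
  by apply/itvP => -[s _ E]; have := j_lt s; rewrite -E ltnn.
have kI m : i k \notin itv i m k :|: itv i k.+1 r.
  by rewrite inE !mem_itv // ltnn andbF.
have [Dp [Dm [D0 [Di [c [rho [isop isom iso0 isoi sk]]]]]]] := skein.
(* Any generic diagram of the tangle computes [Z], in particular those of the skein quadruple. *)
have ZE (L D : tangle p n top bot) G pass (J : {set 'I_n}) t : isotopic L D ->
  generic D -> placed (G := G) D pass ->
    t \notin J -> Z J t L = subtree_sum t (gstring G t) J.
  move=> iso gen pl tJ; rewrite -tree_sumE //; apply: Z_def => //.
  by exists D; split=> //; apply: placed_at pl.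
have [gp gm g0 gi] := skein_generic sk.
have [Da [Db [ud [vd [sp base]]]]] := skein_base jk sk.
have [gena genb] : generic Da /\ generic Db by case: base => -[-> -> _].
have [Ga [pa pla]] := placed_exists gena; have [Gb [pb plb]] := placed_exists genb.
have [G0 [p0 pl0]] := placed_exists g0; have [Gi [pi pli]] := placed_exists gi.
have [d pd phd] := placed_onto pla (sp_a_d sp).
have [Eu Ev] := sp_strings sp.
have split_mem (T : eqType) (x : T) s : x \in s -> exists s1 s2, s = s1 ++ x :: s2.
  by case/splitPr => s1 s2; exists s1, s2.
have [P [Q Gj]] : exists P Q, gstring Ga j = P ++ head d :: Q.
  by apply: split_mem; rewrite mem_gstring -(placed_string pla) phd Ev.
have [U [V Gk]] : exists U V, gstring Ga (i k) = U ++ tail d :: V.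
  by apply: split_mem; rewrite mem_gstring -(placed_string pla) pd Eu.
have [db [Pb [Qb [Ub [Vb [hb [h0 [hi sg]]]]]]]] :=
  skein_gauss_exists jk sp pla plb pl0 pli pd phd Gj Gk.
have sd : gsign d = writhe Da ud vd by rewrite (placed_sign pla) pd phd.
have diff := skein_difference i_incr j_lt sg.
have low := skein_low i_incr j_lt sg.
have sum := skein_sum i_incr j_lt sg.
have Zi : Z (Iminus k) j Li = subtree_sum j (gstring Gi j) (itv i 0 k).
  by rewrite EIminus; apply: (ZE _ _ _ _ _ _ isoi gi pli (jI _ _)).
have Z0 (m : 'I_r) : (m <= k)%N -> Z (Iplus m) (i k) L0 =
    subtree_sum (i k) (gstring G0 (i k)) (itv i m k :|: itv i k.+1 r).
  by move=> mk; rewrite EIplus //; apply: (ZE _ _ _ _ _ _ iso0 g0 pl0 (kI _)).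
(* The sign of [d] is 1 if [Da] is [Dp] and -1 if it is [Dm]; in the second case it undoes the
   exchange of the two terms of the difference. *)
case: base => -[Ea Eb w]; rewrite w in sd; rewrite {}Ea in gena pla;
  rewrite {}Eb in genb plb.
- have Zp a : Z (itv i 0 a) j Lp = subtree_sum j (gstring Ga j) (itv i 0 a).
    by apply: (ZE _ _ _ _ _ _ isop gena pla (jI _ _)).
  have Zm a : Z (itv i 0 a) j Lm = subtree_sum j (gstring Gb j) (itv i 0 a).
    by apply: (ZE _ _ _ _ _ _ isom genb plb (jI _ _)).
  rewrite Zi Z0 // EI !Zp !Zm; split.
  + by rewrite diff sd mul1r.
  + by move=> m mk; rewrite EIminus Zp Zm; apply: low.
  + rewrite sum sd mul1r; apply: eq_bigr => m mk.
    by rewrite EIminus Zp Z0.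
- have Zp a : Z (itv i 0 a) j Lp = subtree_sum j (gstring Gb j) (itv i 0 a).
    by apply: (ZE _ _ _ _ _ _ isop genb plb (jI _ _)).
  have Zm a : Z (itv i 0 a) j Lm = subtree_sum j (gstring Ga j) (itv i 0 a).
    by apply: (ZE _ _ _ _ _ _ isom gena pla (jI _ _)).
  rewrite Zi Z0 // EI !Zp !Zm -opprB; split.
  + by rewrite diff sd mulN1r opprK.
  + by move=> m mk; rewrite EIminus Zp Zm; apply/esym/low.
  + rewrite sum sd mulN1r opprK; apply: eq_bigr => m mk.
    by rewrite EIminus Zp Z0 // low.
Qed.
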